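(* Let $V$ be a complete DVR with residue field $k$. (1) If $V$ has characteristic $p \ne 0$ and $k$ is perfect, then there does not exist an analytically ramified local Noetherian domain containing $k$ whose normalization is $V$. (2) If either (a) $V = \widehat{\mathbb{Z}}_p$ for a prime $p$, (b) $V$ and $k$ have characteristic $0$, or (c) $V$ has characteristic $p \ne 0$ and $[k:k^p]$ is uncountable, then for every integer $d>1$ there exists a bad Noetherian stable domain of embedding dimension $d$ whose normalization is $V$. There also exists (in each of these cases) a non-Noetherian bad stable domain whose normalization is $V$.
   Context: A DVR is a rank one discrete valuation ring. $\widehat{\mathbb{Z}}_p$ is the ring of $p$-adic integers. In (1), $k$ is viewed as a subfield of $V$ mapping isomorphically onto the residue field (a coefficient field, which exists by the Cohen structure theorem). The normalization of a domain is its integral closure in its quotient field. A local Noetherian ring is analytically ramified if its completion in the topology of its maximal ideal has a nonzero nilpotent element. An ideal $I$ of a ring $R$ is stable if $I$ is projective over its ring of endomorphisms; $R$ is a stable ring if every ideal of $R$ containing a nonzerodivisor is stable. A bad stable domain is a one-dimensional quasilocal (i.e. having a unique maximal ideal, not necessarily Noetherian) stable domain whose normalization is not a finitely generated module over it; a bad Noetherian stable domain is one that is also Noetherian. Embedding dimension is the minimal number of generators of the maximal ideal. $k^p$ is the subfield of $p$-th powers of elements of $k$. *)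

(* Defs.v *)
From HB Require Import structures.
From mathcomp Require Import all_boot all_order all_algebra.
From mathcomp Require Import boolp classical_sets functions cardinality.

Set Implicit Arguments.
Unset Strict Implicit.
Unset Printing Implicit Defensive.

Import Order.TTheory GRing.Theory Num.Theory.
Local Open Scope classical_set_scope.
Local Open Scope ring_scope.

Section Ideals.
Variable R : comPzRingType.
Implicit Types (I J P m S : set R).

Definition is_ideal I :=
  [/\ I 0, (forall x y, I x -> I y -> I (x + y)) &
      forall a x, I x -> I (a * x)].

Definition ideal_span S : set R := smallest is_ideal S.

Definition prime_ideal P :=
  [/\ is_ideal P, ~ P 1 & forall x y, P (x * y) -> P x \/ P y].

Definition maximal_ideal m :=
  [/\ is_ideal m, ~ m 1 &
      forall J, is_ideal J -> m `<=` J -> J = m \/ J = setT].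

Definition the_maximal_ideal m :=
  maximal_ideal m /\ forall m', maximal_ideal m' -> m' = m.

Definition generated_by_n I (n : nat) :=
  exists g : 'I_n -> R, I = ideal_span (range g).

Definition ideal_pow I (n : nat) : set R :=
  ideal_span
    [set x | exists2 f : 'I_n -> R, (forall i, I (f i)) & x = \prod_i f i].

Definition coset I (a : R) : set R := [set x | I (x - a)].

Lemma ideal_span_ideal S : is_ideal (ideal_span S).
Proof.
split.
- by move=> J [[]].
- move=> x y Hx Hy J HJ; have [[_ HD _] _] := HJ.
  by apply: HD; [apply: Hx | apply: Hy].
- by move=> a x Hx J HJ; have [[_ _ HM] _] := HJ; apply: HM; apply: Hx.
Qed.

Lemma sub_ideal_span S : S `<=` ideal_span S.
Proof. by move=> x Sx J [_]; apply. Qed.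

Lemma ideal_pow_ideal I n : is_ideal (ideal_pow I n).
Proof. exact: ideal_span_ideal. Qed.

Lemma ideal_powS I n : ideal_pow I n.+1 `<=` ideal_pow I n.
Proof.
have [z zD zM] := ideal_pow_ideal I n.
move=> x; apply; split; first exact: ideal_pow_ideal.
move=> _ [f fI ->]; rewrite big_ord_recl; apply: zM.
by apply: sub_ideal_span; exists (fun i => f (lift ord0 i)).
Qed.

Section IdealTheory.
Variables (I : set R) (HI : is_ideal I).

Lemma idealN x : I x -> I (- x).
Proof. by case: HI => _ _ HM Ix; rewrite -mulN1r; apply: HM. Qed.

Lemma idealB x y : I x -> I y -> I (x - y).
Proof. by case: (HI) => _ HD _ Ix /idealN; apply: HD. Qed.

Lemma coset_eqP a b : coset I a = coset I b <-> I (a - b).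
Proof.
have [I0 ID _] := HI; split=> [E|Iab].
  have Iaa : coset I a a by rewrite /coset /= subrr.
  by rewrite E in Iaa.
apply/seteqP; split=> x /= Hx; rewrite /coset /=.
  by rewrite -(subrKA a); apply: ID.
by rewrite -(subrKA b); apply: ID => //; rewrite -opprB; apply: idealN.
Qed.

End IdealTheory.

End Ideals.

(* The inverse limit of the rings R / I^n, whose elements are the sequences
   (c_n) of cosets of the I^n with c_(n+1) mapping to c_n, that is, contained
   in c_n. *)
Record adic_completion (R : comPzRingType) (I : set R) := AdicCompletion {
  adic_coset : nat -> set R;
  adic_cosetP :
    (forall n, exists a, adic_coset n = coset (ideal_pow I n) a) /\
    (forall n, adic_coset n.+1 `<=` adic_coset n) }.

HB.instance Definition _ R I := gen_eqMixin (@adic_completion R I).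
HB.instance Definition _ R I := gen_choiceMixin (@adic_completion R I).

Section CompletionRing.
Variables (R : comPzRingType) (I : set R).
Local Notation C := (adic_completion I).
Local Notation Ip := (ideal_pow I).
Implicit Types c d e : C.

Definition coherent (u : nat -> R) := forall n, (Ip n) (u n.+1 - u n).

Lemma completion_of_subproof u : coherent u ->
  (forall n, exists a, coset (Ip n) (u n) = coset (Ip n) a) /\
  (forall n, coset (Ip n.+1) (u n.+1) `<=` coset (Ip n) (u n)).
Proof.
move=> uP; split=> [n|n x Hx]; first by exists (u n).
rewrite /coset /= -(subrKA (u n.+1)).
have [_ D _] := ideal_pow_ideal I n.
by apply: D => //; apply: ideal_powS.
Qed.

Definition completion_of u (uP : coherent u) : C :=
  AdicCompletion (completion_of_subproof uP).

(* A representative of the n-th coset; the operations below do not depend on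
   its choice. *)
Definition adic_rep c n : R := xget 0 (adic_coset c n).

Lemma adic_repP c n : adic_coset c n = coset (Ip n) (adic_rep c n).
Proof.
have [/(_ n) [a E] _] := adic_cosetP c.
have : adic_coset c n (adic_rep c n).
  have ca : adic_coset c n a.
    by rewrite E /coset /= subrr; case: (ideal_pow_ideal I n).
  exact: (xgetPex 0 (ex_intro _ a ca)).
rewrite E => H; apply/(coset_eqP (ideal_pow_ideal I n)).
by rewrite -opprB; apply: (idealN (ideal_pow_ideal I n)).
Qed.

Lemma adic_rep_coherent c : coherent (adic_rep c).
Proof.
move=> n; have [_ /(_ n)] := adic_cosetP c.
rewrite !adic_repP => /(_ (adic_rep c n.+1)); apply.
by rewrite /coset /= subrr; case: (ideal_pow_ideal I n.+1).
Qed.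

Lemma completion_eqP c d :
  (forall n, (Ip n) (adic_rep c n - adic_rep d n)) -> c = d.
Proof.
move=> H; have : adic_coset c = adic_coset d.
  apply/funext => n; rewrite !adic_repP.
  by apply/(coset_eqP (ideal_pow_ideal I n)).
case: c d {H} => [c cP] [d dP] /= E.
by subst d; congr AdicCompletion; apply: Prop_irrelevance.
Qed.

Lemma completion_of_rep u (uP : coherent u) n :
  (Ip n) (adic_rep (completion_of uP) n - u n).
Proof.
apply/(coset_eqP (ideal_pow_ideal I n)).
by rewrite -adic_repP.
Qed.

Lemma completion_of_eqP u v (uP : coherent u) (vP : coherent v) :
  (forall n, (Ip n) (u n - v n)) -> completion_of uP = completion_of vP.
Proof.
move=> H; apply: completion_eqP => n.
have Hi := ideal_pow_ideal I n; have [_ D _] := Hi.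
rewrite -(subrKA (u n)); apply: (D); first exact: completion_of_rep.
rewrite -(subrKA (v n)); apply: (D); first exact: H.
by rewrite -opprB; apply: (idealN Hi); exact: completion_of_rep.
Qed.

Lemma completion_ofK c : completion_of (adic_rep_coherent c) = c.
Proof.
by apply: completion_eqP => n; exact: completion_of_rep.
Qed.

Lemma coherent_cst a : coherent (fun=> a).
Proof. by move=> n; rewrite subrr; case: (ideal_pow_ideal I n). Qed.

Lemma coherent_add u v : coherent u -> coherent v ->
  coherent (fun n => u n + v n).
Proof.
move=> uP vP n; have [_ D _] := ideal_pow_ideal I n.
by rewrite opprD addrACA; apply: D.
Qed.

Lemma coherent_opp u : coherent u -> coherent (fun n => - u n).
Proof.
move=> uP n; rewrite -opprD.
by apply: (idealN (ideal_pow_ideal I n)).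
Qed.

Lemma ideal_mulB n a b a' b' : (Ip n) (a - a') -> (Ip n) (b - b') ->
  (Ip n) (a * b - a' * b').
Proof.
have [_ D M] := ideal_pow_ideal I n => Ha Hb.
rewrite -(subrKA (a * b')) -mulrBr -mulrBl.
by apply: D; [apply: M | rewrite mulrC; apply: M].
Qed.

Lemma coherent_mul u v : coherent u -> coherent v ->
  coherent (fun n => u n * v n).
Proof. by move=> uP vP n; apply: ideal_mulB. Qed.

Definition to_completion (a : R) : C := completion_of (coherent_cst a).

Definition completion_add c d : C :=
  completion_of (coherent_add (adic_rep_coherent c) (adic_rep_coherent d)).

Definition completion_opp c : C :=
  completion_of (coherent_opp (adic_rep_coherent c)).

Definition completion_mul c d : C :=
  completion_of (coherent_mul (adic_rep_coherent c) (adic_rep_coherent d)).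

Lemma completion_addE u v (uP : coherent u) (vP : coherent v) :
  completion_add (completion_of uP) (completion_of vP) =
  completion_of (coherent_add uP vP).
Proof.
apply: completion_of_eqP => n; have [_ D _] := ideal_pow_ideal I n.
by rewrite opprD addrACA; apply: D; exact: completion_of_rep.
Qed.

Lemma completion_oppE u (uP : coherent u) :
  completion_opp (completion_of uP) = completion_of (coherent_opp uP).
Proof.
apply: completion_of_eqP => n; rewrite -opprD.
by apply: (idealN (ideal_pow_ideal I n)); exact: completion_of_rep.
Qed.

Lemma completion_mulE u v (uP : coherent u) (vP : coherent v) :
  completion_mul (completion_of uP) (completion_of vP) =
  completion_of (coherent_mul uP vP).
Proof.
by apply: completion_of_eqP => n; apply: ideal_mulB; exact: completion_of_rep.
Qed.

Lemma completion_of_ext u v (uP : coherent u) (vP : coherent v) :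
  (forall n, u n = v n) -> completion_of uP = completion_of vP.
Proof.
move=> E; apply: completion_of_eqP => n; rewrite E subrr.
by case: (ideal_pow_ideal I n).
Qed.

Let addA : associative completion_add.
Proof.
move=> c d e; rewrite -(completion_ofK c) -(completion_ofK d).
rewrite -(completion_ofK e) !completion_addE.
by apply: completion_of_ext => n; rewrite addrA.
Qed.

Let addC : commutative completion_add.
Proof.
move=> c d; rewrite -(completion_ofK c) -(completion_ofK d) !completion_addE.
by apply: completion_of_ext => n; rewrite addrC.
Qed.

Let add0 : left_id (to_completion 0) completion_add.
Proof.
move=> c; rewrite -{1}(completion_ofK c) completion_addE.
by rewrite -[RHS]completion_ofK; apply: completion_of_ext => n; rewrite add0r.
Qed.

Let addN : left_inverse (to_completion 0) completion_opp completion_add.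
Proof.
move=> c; rewrite -(completion_ofK c) completion_oppE completion_addE.
by apply: completion_of_ext => n; rewrite addNr.
Qed.

HB.instance Definition _ := GRing.isZmodule.Build C addA addC add0 addN.

Let mulA : associative completion_mul.
Proof.
move=> c d e; rewrite -(completion_ofK c) -(completion_ofK d).
rewrite -(completion_ofK e) !completion_mulE.
by apply: completion_of_ext => n; rewrite mulrA.
Qed.

Let mulC : commutative completion_mul.
Proof.
move=> c d; rewrite -(completion_ofK c) -(completion_ofK d) !completion_mulE.
by apply: completion_of_ext => n; rewrite mulrC.
Qed.

Let mul1 : left_id (to_completion 1) completion_mul.
Proof.
move=> c; rewrite -{1}(completion_ofK c) completion_mulE.
by rewrite -[RHS]completion_ofK; apply: completion_of_ext => n; rewrite mul1r.
Qed.

Let mulDl : left_distributive completion_mul completion_add.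
Proof.
move=> c d e; rewrite -(completion_ofK c) -(completion_ofK d).
rewrite -(completion_ofK e) completion_addE !completion_mulE completion_addE.
by apply: completion_of_ext => n; rewrite mulrDl.
Qed.

HB.instance Definition _ :=
  GRing.Zmodule_isComPzRing.Build C mulA mulC mul1 mulDl.

End CompletionRing.

Arguments to_completion {R} I a.

Definition padic_integers (p : nat) : comPzRingType :=
  adic_completion (ideal_span [set p%:Z]).

(* Endomorphism rings act on the left, so that a product is a composite. *)
Section Endomorphisms.
Variables (R : pzRingType) (M : lmodType R).

Definition endo_pred : {pred M -> M} := fun f => `[< linear f >].

Definition endo := {f : M -> M | endo_pred f}.
HB.instance Definition _ := [isSub of endo for (@sval _ _)].
HB.instance Definition _ := [Choice of endo by <:].

Lemma endo_zmod_closed : zmod_closed endo_pred.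
Proof.
split=> [|f g /asboolP fP /asboolP gP]; apply/asboolP => a x y.
  by rewrite scaler0 addr0.
have E z : (f - g) z = f z - g z by [].
by rewrite !E fP gP scalerBr opprD addrACA.
Qed.
HB.instance Definition _ :=
  GRing.isZmodClosed.Build (M -> M) endo_pred endo_zmod_closed.
HB.instance Definition _ := [SubChoice_isSubZmodule of endo by <:].

Lemma endo_linear (f : endo) : linear (val f).
Proof. exact/asboolP/(valP f). Qed.

Fact endo_one_subproof : endo_pred id.
Proof. exact/asboolP. Qed.

Fact endo_mul_subproof (f g : endo) : endo_pred (val f \o val g).
Proof. by apply/asboolP => a x y /=; rewrite !endo_linear. Qed.

Definition endo_one : endo := Sub id endo_one_subproof.
Definition endo_mul (f g : endo) : endo :=
  Sub (val f \o val g) (endo_mul_subproof f g).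

Lemma endoP (f g : endo) : (forall x, val f x = val g x) -> f = g.
Proof. by move=> E; apply/val_inj/funext. Qed.

Lemma endo_addE (f g : endo) x : val (f + g) x = val f x + val g x.
Proof. by []. Qed.

Let mulA : associative endo_mul.
Proof. by move=> f g h; apply: endoP. Qed.

Let mul1 : left_id endo_one endo_mul.
Proof. by move=> f; apply: endoP. Qed.

Let mulr1 : right_id endo_one endo_mul.
Proof. by move=> f; apply: endoP. Qed.

Let mulDl : left_distributive endo_mul +%R.
Proof. by move=> f g h; apply: endoP. Qed.

Let mulDr : right_distributive endo_mul +%R.
Proof.
move=> f g h; apply: endoP => x; rewrite endo_addE /=.
by have := endo_linear f 1 (val g x) (val h x); rewrite !scale1r.
Qed.

HB.instance Definition _ :=
  GRing.Zmodule_isPzRing.Build endo mulA mul1 mulr1 mulDl mulDr.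

(* M as a module over its ring of endomorphisms. *)
Definition endo_mod : Type := M.
HB.instance Definition _ := GRing.Zmodule.on endo_mod.

Definition endo_scale (f : endo) (x : endo_mod) : endo_mod := val f x.

Let scaleA f g x : endo_scale f (endo_scale g x) = endo_scale (f * g) x.
Proof. by []. Qed.

Let scale1 : left_id 1 endo_scale.
Proof. by []. Qed.

Let scaleDr : right_distributive endo_scale +%R.
Proof.
by move=> f x y; have := endo_linear f 1 x y; rewrite !scale1r.
Qed.

Let scaleDl x : {morph endo_scale^~ x : f g / f + g}.
Proof. by []. Qed.

HB.instance Definition _ :=
  GRing.Zmodule_isLmodule.Build endo endo_mod scaleA scale1 scaleDr scaleDl.

End Endomorphisms.

Definition projective_module (E : pzRingType) (P : lmodType E) :=
  forall (M N : lmodType E) (g : {linear M -> N}) (f : {linear P -> N}),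
    (forall y, exists x, g x = y) ->
    exists h : {linear P -> M}, forall x, g (h x) = f x.

Section IdealModule.
Variables (R : comPzRingType) (I : set R) (HI : is_ideal I).

Definition ideal_pred of is_ideal I : {pred R^o} := fun x => x \in I.

Definition ideal_mod := {x : R^o | ideal_pred HI x}.
HB.instance Definition _ := [isSub of ideal_mod for (@sval _ _)].
HB.instance Definition _ := [Choice of ideal_mod by <:].

Lemma ideal_submod_closed : submod_closed (ideal_pred HI).
Proof.
case: HI => I0 ID IM; split=> [|a x y /set_mem Ix /set_mem Iy].
  exact/mem_set.
by apply/mem_set/ID => //; apply: IM.
Qed.
HB.instance Definition _ :=
  GRing.isSubmodClosed.Build R R^o (ideal_pred HI) ideal_submod_closed.
HB.instance Definition _ := [SubChoice_isSubLmodule of ideal_mod by <:].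

Definition stable_ideal := projective_module (endo_mod ideal_mod).

End IdealModule.

Section RingProperties.
Variable R : comPzRingType.

Definition stable_ring :=
  forall (I : set R) (HI : is_ideal I),
    (exists2 x, I x & GRing.lreg x) -> stable_ideal HI.

Definition noetherian :=
  forall I : set R, is_ideal I -> exists n, generated_by_n I n.

Definition quasilocal := exists m : set R, the_maximal_ideal m.

Definition prime_chain (n : nat) :=
  exists P : nat -> set R,
    (forall i, (i <= n)%N -> prime_ideal (P i)) /\
    (forall i, (i < n)%N -> P i `<` P i.+1).

Definition krull_dim (n : nat) := prime_chain n /\ ~ prime_chain n.+1.

Definition embedding_dimension (d : nat) :=
  exists m : set R, [/\ the_maximal_ideal m, generated_by_n m d &
    forall n, generated_by_n m n -> (d <= n)%N].

Definition complete_local :=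
  exists m : set R, the_maximal_ideal m /\ bijective (to_completion m).

Definition analytically_ramified :=
  exists m : set R, the_maximal_ideal m /\
    exists c : adic_completion m, c != 0 /\ exists n, c ^+ n = 0.

End RingProperties.

Section Domains.
Variable R : idomainType.
Local Notation K := {fraction R}.
Local Notation frac := (@tofrac R).

Definition discrete_valuation (v : K -> int) :=
  [/\ forall x y, x != 0 -> y != 0 -> v (x * y) = v x + v y,
      forall x y, x != 0 -> y != 0 -> x + y != 0 ->
        Num.min (v x) (v y) <= v (x + y) &
      forall n, exists2 x, x != 0 & v x = n].

Definition dvr :=
  exists v : K -> int, discrete_valuation v /\
    forall x, x != 0 -> (0 <= v x <-> exists a, x = frac a).

Definition normalization : set K := [set x | integralOver frac x].

(* g identifies V with the normalization of R. *)
Definition is_normalization (V : idomainType) (g : {rmorphism V -> K}) :=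
  injective g /\ range g = normalization.

Definition finite_normalization :=
  exists n (g : 'I_n -> K), normalization =
    [set x | exists a : 'I_n -> R, x = \sum_i frac (a i) * g i].

Definition bad_stable_domain :=
  [/\ krull_dim R 1, quasilocal R, stable_ring R & ~ finite_normalization].

End Domains.

Section Fields.
Variable k : fieldType.

Definition pth_powers (p : nat) : set k := [set x ^+ p | x in setT].

Definition perfect_field := forall p, p \in [pchar k] -> pth_powers p = setT.

(* B is a basis of k as a vector space over its subfield F. *)
Definition basis_over (F B : set k) :=
  (forall (s : seq k) (a : k -> k), uniq s -> (forall x, x \in s -> B x) ->
     (forall x, F (a x)) -> \sum_(x <- s) a x * x = 0 ->
     forall x, x \in s -> a x = 0) /\
  (forall y, exists (s : seq k) (a : k -> k),
     [/\ forall x, x \in s -> B x, forall x, F (a x) &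
         y = \sum_(x <- s) a x * x]).

Definition uncountable_degree (F : set k) :=
  exists B, basis_over F B /\ ~ countable B.

End Fields.

(* res presents the field k as the residue field of V; its kernel is a maximal
   ideal, hence the maximal ideal when V is quasilocal. *)
Definition residue_map (V : idomainType) (k : fieldType)
    (res : {rmorphism V -> k}) := range res = setT.

(* Main.v *)
Require Import Defs.
From HB Require Import structures.
From mathcomp Require Import all_boot all_order all_algebra.
From mathcomp Require Import boolp classical_sets functions cardinality.
From mathcomp Require Import ring zify.

Set Implicit Arguments.
Unset Strict Implicit.
Unset Printing Implicit Defensive.

Import Order.TTheory GRing.Theory Num.Theory.
Local Open Scope classical_set_scope.
Local Open Scope ring_scope.

(** Bad stable domains.  Let t be a uniformizer of V, F the fraction field of V
    and D a derivation from F to a direct sum of copies of F, with components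
    D_0, D_1, ...  Suppose that D t = 0, that the elements of V at which D
    vanishes represent all residues, and that D is abundant: for each n some
    x_n in V has D_n x_n = 1 and D_i x_n = 0 for i > n.  For a nonempty set J of
    indices let R be the ring of those x in V with D_i x in V for all i in J.

    The elements killed by D are t-adically dense in V.  Approximating two
    elements a and b of V by such elements shows that ab lies in Ra + Rb + R
    ([twisted_quadratic]).  Hence V is integral over R, and if x has least value
    in an ideal I of R, then the square of I is x I, which makes I free of rank
    one over its ring of endomorphisms ([overring_stable],
    [principal_square_stable]).  Every element of V is carried into R by high
    powers of t, but no power of t carries all of V into R, because D has
    unbounded denominators; so V is not finite over R ([overring_not_finite]).  Finally the residues of r / t and of the
    D_i r, for i in J, are coordinates on the cotangent space of R.  If J has n
    elements, R is noetherian of embedding dimension n + 1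
    ([twisted_noetherian], [twisted_embedding_dimension]); if J is infinite, the
    maximal ideal is not finitely generated ([twisted_not_noetherian]), because
    each value of D has finitely many nonzero components.

    It remains to find D.  A derivation amounts to a multiplicative section
    x |-> (x, D x) of the projection of a square-zero extension of F, and such
    sections, with prescribed values on a subring, are found by lifting the
    residue field of a henselian ring ([lift_residue_field],
    [extend_derivation]); in characteristic p the subring has to contain the pth
    powers.  So it suffices to give a subring A_0 of F that contains t and
    represents all residues, and a sequence of x_n in V none of which is
    separably algebraic over A_0 and the preceding ones
    ([triangular_derivation]).
    - For the p-adic integers, A_0 is the ring of integers, and the x_n are
      chosen one by one among uncountably many power series ([greedy_tower]).
    - In equal characteristic zero the same choice, made over the polynomials in
      t with integer coefficients, yields D on the power series with integer
      coefficients.  A coefficient field K of V is linearly disjoint from these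
      over the integers, and D extends K-linearly ([extension_well_defined]).
    - In characteristic p, an uncountable p-degree yields a sequence of
      p-independent residues b_n ([pth_independent_sequence]).  A maximal subring
      over whose residues they stay independent, with lifts of the b_n adjoined,
      represents all residues ([limit_residue]); the x_n are power series whose
      coefficients are disjoint blocks of lifts ([block_series_independent]).

    Unramified completions.  Let R have normalization V and contain the perfect
    field k, and let s be a nonzero element of the maximal ideal of R.  The
    completion of R is reduced as soon as, for each g, all elements of R of high
    value in V lie in s^g R ([valuation_topology]).  Since the elements of V are
    integral over R of bounded degree ([uniform_integral]), this holds for their
    p^e-th powers with some e ([power_dominated_start]).  Now e can be lowered:
    R is generated over its pth powers by finitely many elements, up to powers of
    s, because k is perfect, while V is free over its pth powers on
    1, t, ..., t^(p-1) ([frobenius_basis]); so x is, up to a denominator, a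
    combination of powers of t with coefficients y^p, where the elements y of R
    have high value because x does ([power_dominated_step]). *)

(** * Subrings and the adjunction of an element *)

Section Subrings.
Variable T : comNzRingType.
Implicit Types (S G : set T) (f : {poly T}).

Definition subring S :=
  [/\ S 1, forall x y, S x -> S y -> S (x - y) &
      forall x y, S x -> S y -> S (x * y)].

Definition coefs_in S f := forall i, S f`_i.

Definition adjoin S z : set T := [set f.[z] | f in coefs_in S].

Section SubringTheory.
Variables (S : set T) (subS : subring S).

Lemma subring1 : S 1. Proof. by case: subS. Qed.
Lemma subringB x y : S x -> S y -> S (x - y).
Proof. by case: subS => _ H _; apply: H. Qed.
Lemma subringM x y : S x -> S y -> S (x * y).
Proof. by case: subS => _ _ H; apply: H. Qed.
Lemma subring0 : S 0.
Proof. by have := subringB subring1 subring1; rewrite subrr. Qed.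
Lemma subringN x : S x -> S (- x).
Proof. by move=> Sx; rewrite -sub0r; apply: subringB => //; apply: subring0. Qed.
Lemma subringD x y : S x -> S y -> S (x + y).
Proof. by move=> Sx Sy; rewrite -[y]opprK; apply: subringB => //; apply: subringN. Qed.
Lemma subring_sum (I : Type) (r : seq I) (P : pred I) (F : I -> T) :
  (forall i, P i -> S (F i)) -> S (\sum_(i <- r | P i) F i).
Proof. by move=> H; elim/big_ind: _ => //; [apply: subring0|apply: subringD]. Qed.
Lemma subringX x n : S x -> S (x ^+ n).
Proof.
move=> Sx; elim: n => [|n IH]; rewrite ?expr0 ?exprS; first exact: subring1.
exact: subringM.
Qed.
Lemma subring_nat n : S n%:R.
Proof.
elim: n => [|n IH]; first exact: subring0.
by rewrite -addn1 natrD; apply: subringD => //; apply: subring1.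
Qed.
Lemma subring_int (n : int) : S n%:~R.
Proof.
case: n => n; first exact: subring_nat.
by rewrite NegzE mulrNz; apply/subringN/subring_nat.
Qed.

Lemma coefs_inB f g : coefs_in S f -> coefs_in S g -> coefs_in S (f - g).
Proof. by move=> Hf Hg i; rewrite coefB; apply: subringB. Qed.
Lemma coefs_inC c : S c -> coefs_in S c%:P.
Proof. by move=> Sc i; rewrite coefC; case: eqP => _ //; apply: subring0. Qed.
Lemma coefs_inX n : coefs_in S 'X^n.
Proof. by move=> i; rewrite coefXn; apply: subring_nat. Qed.
Lemma coefs_inM f g : coefs_in S f -> coefs_in S g -> coefs_in S (f * g).
Proof.
by move=> Hf Hg i; rewrite coefM; apply: subring_sum => j _; apply: subringM.
Qed.
Lemma coefs_in_deriv f : coefs_in S f -> coefs_in S f^`().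
Proof.
move=> Hf i; rewrite coef_deriv -mulr_natr.
by apply: subringM => //; apply: subring_nat.
Qed.

Lemma coefs_in_horner f x : coefs_in S f -> S x -> S f.[x].
Proof.
move=> Hf Sx; rewrite horner_coef; apply: subring_sum => i _.
by apply: subringM => //; apply: subringX.
Qed.

Lemma subring_adjoin z : subring (adjoin S z).
Proof.
split.
- by exists 1; rewrite ?hornerC //; apply: coefs_inC subring1.
- move=> _ _ [f Hf <-] [g Hg <-]; exists (f - g); rewrite ?hornerE //.
  exact: coefs_inB.
- move=> _ _ [f Hf <-] [g Hg <-]; exists (f * g); rewrite ?hornerM //.
  exact: coefs_inM.
Qed.

Lemma sub_adjoin z : S `<=` adjoin S z.
Proof. by move=> x Sx; exists x%:P; rewrite ?hornerC //; apply: coefs_inC. Qed.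

Lemma mem_adjoin z : adjoin S z z.
Proof. by exists 'X; rewrite ?hornerX //; apply: (coefs_inX 1). Qed.

End SubringTheory.

Lemma adjoin_min S S' z : subring S' -> S `<=` S' -> S' z -> adjoin S z `<=` S'.
Proof.
move=> subS' SS' S'z _ [f Hf <-].
by apply: coefs_in_horner => // i; apply/SS'/Hf.
Qed.

Lemma subring_bigcup (I : Type) (D : set I) (F : I -> set T) :
  D !=set0 -> (forall i, D i -> subring (F i)) ->
  (forall i j, D i -> D j -> exists2 k, D k & F i `|` F j `<=` F k) ->
  subring (\bigcup_(i in D) F i).
Proof.
move=> [i0 Di0] HF dir; split.
- by exists i0 => //; exact: subring1 (HF _ Di0).
- move=> x y [i Di Fx] [j Dj Fy]; have [l Dl sl] := dir i j Di Dj.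
  exists l => //; apply: (subringB (HF l Dl)); apply: sl; first by left.
  by right.
- move=> x y [i Di Fx] [j Dj Fy]; have [l Dl sl] := dir i j Di Dj.
  exists l => //; apply: (subringM (HF l Dl)); apply: sl; first by left.
  by right.
Qed.

Lemma subring_chain (F : set (set T)) : F !=set0 ->
  (forall X, F X -> subring X) -> total_on F subset ->
  subring (\bigcup_(X in F) X).
Proof.
move=> F0 HF tot; apply: subring_bigcup => // X Y FX FY.
by have [s|s] := tot _ _ FX FY; [exists Y|exists X] => // x [] // /s.
Qed.

(** Division with remainder by f stays over G, because the leading coefficient
    of f is invertible in G; the remainder vanishes by minimality. *)
Lemma divide_by_minimal (Phi : comNzRingType) (pi : {rmorphism T -> Phi}) G y f w :
  subring G -> coefs_in G f -> G w -> w * lead_coef f = 1 ->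
  (map_poly pi f).[y] = 0 ->
  (forall g, coefs_in G g -> (map_poly pi g).[y] = 0 -> (size g < size f)%N -> g = 0) ->
  forall P, coefs_in G P -> (map_poly pi P).[y] = 0 ->
    exists2 Q, coefs_in G Q & P = Q * f.
Proof.
move=> subG Gf Gw wf fy fmin P.
have [n] := ubnP (size P); elim: n P => // n IH P; rewrite ltnS => szP GP Py.
have [ltPf|lefP] := ltnP (size P) (size f).
  exists 0; last by rewrite mul0r (fmin P).
  by move=> i; rewrite coef0; apply: subring0.
have f0 : f != 0.
  by apply/eqP=> f0; move: wf; rewrite f0 lead_coef0 mulr0 => /eqP; rewrite eq_sym oner_eq0.
pose q := (lead_coef P * w)%:P * 'X^(size P - size f).
have Gq : coefs_in G q.
  apply: coefs_inM => //; last exact: coefs_inX.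
  by apply: coefs_inC => //; apply: subringM => //; apply: GP.
have sf : (0 < size f)%N by rewrite size_poly_gt0.
have sPgt : (0 < size P)%N by apply: leq_trans lefP.
have [|||Q GQ E] := IH (P - q * f).
- suff: (size (P - q * f)%R < size P)%N by lia.
  rewrite -(prednK sPgt) ltnS; apply/leq_sizeP => j lej; rewrite coefB.
  have [ej|nj] := eqVneq j (size P).-1.
    rewrite ej /q -mulrA coefCM coefXnM ifF; last by apply/negbTE; rewrite -leqNgt; lia.
    have -> : ((size P).-1 - (size P - size f) = (size f).-1)%N by lia.
    by rewrite -mulrA wf mulr1 subrr.
  have lPj : (size P <= j)%N.
    by rewrite -(prednK sPgt) ltn_neqAle eq_sym nj.
  rewrite (nth_default _ lPj).
  rewrite nth_default ?subr0 //.
  apply: leq_trans (size_polyMleq _ _) _.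
  suff : (size q <= (size P - size f).+1)%N.
    by move: lefP lPj; move: (size q) (size f) (size P) => a b c; lia.
  apply: leq_trans (size_polyMleq _ _) _; rewrite size_polyXn size_polyC.
  by case: (_ != 0); lia.
- by apply: coefs_inB => //; apply: coefs_inM.
- by rewrite rmorphB rmorphM hornerD hornerN hornerM Py fy mulr0 subr0.
exists (Q + q); last by rewrite mulrDl -E subrK.
by move=> i; rewrite coefD; apply: subringD.
Qed.

End Subrings.

Lemma subring_image (T U : comNzRingType) (f : {rmorphism T -> U}) (S : set T) :
  subring S -> subring (f @` S).
Proof.
move=> [S1 SB SM]; split; first by exists 1; rewrite ?rmorph1.
  by move=> _ _ [a Sa <-] [b Sb <-]; exists (a - b); rewrite ?rmorphB //; apply: SB.
by move=> _ _ [a Sa <-] [b Sb <-]; exists (a * b); rewrite ?rmorphM //; apply: SM.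
Qed.

Lemma subring_preimage (T U : comNzRingType) (f : {rmorphism T -> U}) (S : set U) :
  subring S -> subring (f @^-1` S).
Proof.
move=> [S1 SB SM]; rewrite /preimage; split=> [|x y|x y] /=.
- by rewrite rmorph1.
- by rewrite rmorphB; apply: SB.
- by rewrite rmorphM; apply: SM.
Qed.

Lemma subring_range (T U : comNzRingType) (f : {rmorphism T -> U}) : subring (range f).
Proof. by apply: subring_image; split. Qed.

(** The chains considered are nonempty, so that Zorn's lemma applies to
    properties, such as being a subring, that fail for the empty set. *)
Lemma maximal_above (T : Type) (P : set (set T)) (A : set T) : P A ->
  (forall G, G !=set0 -> total_on G subset -> (forall X, G X -> P X) ->
     P (\bigcup_(X in G) X)) ->
  exists E, [/\ P E, A `<=` E & forall E', P E' -> E `<=` E' -> E' `<=` E].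
Proof.
move=> PA Pchain.
have [G /= GP Gtot|E [PE Emax]] := @Zorn_bigcup T (fun E => P (E `|` A)).
  have [G0|G0] := pselect (G !=set0); last first.
    by rewrite bigcup0 ?set0U // => X GX; case: G0; exists X.
  have -> : (\bigcup_(X in G) X) `|` A = \bigcup_(X in (fun X => X `|` A) @` G) X.
    apply/seteqP; split => x.
      move=> [[X GX Xx]|Ax]; first by exists (X `|` A); [exists X|left].
      by case: G0 => X GX; exists (X `|` A); [exists X|right].
    by move=> [_ [X GX <-]] [Xx|]; [left; exists X|right].
  apply: Pchain.
  - by case: G0 => X GX; exists (X `|` A), X.
  - move=> _ _ [X GX <-] [Y GY <-].
    by have [s|s] := Gtot _ _ GX GY; [left|right]; apply: setSU.
  - by move=> _ [X GX <-]; apply: GP.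
exists (E `|` A); split=> // E' PE' EE' x E'x; left; apply: contrapT => nEx.
apply: (Emax E'); first by split=> [y Ey|/(_ x E'x)//]; apply: EE'; left.
by rewrite setUidl // => y Ay; apply: EE'; right.
Qed.

(** * Lifting the residue field of a henselian ring *)

Section Lifting.
Variables (T : comNzRingType) (Phi : fieldType) (pi : {rmorphism T -> Phi}).

(** The possible images of partial sections of pi. *)
Definition sectional (G : set T) := subring G /\ forall x, G x -> pi x = 0 -> x = 0.

Hypothesis pi_onto : forall y, exists z, pi z = y.
Hypothesis pi_unit : forall z, pi z != 0 -> exists w, w * z = 1.
Hypothesis hensel : forall (f : {poly T}) y, pi f.[y] = 0 -> pi (f^`()).[y] != 0 ->
  exists2 z, pi z = pi y & f.[z] = 0.

Lemma sectional_adjoin G z : subring G ->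
  (forall P, coefs_in G P -> pi P.[z] = 0 -> P.[z] = 0) -> sectional (adjoin G z).
Proof.
move=> subG H; split; first exact: subring_adjoin.
by move=> _ [P GP <-]; apply: H.
Qed.

(** The localization of G at one of its nonzero elements is again sectional,
    since pi maps that element to a unit of the field Phi. *)
Lemma maximal_sectional_inv G : sectional G ->
  (forall G', sectional G' -> G `<=` G' -> G' `<=` G) ->
  forall g, G g -> g != 0 -> exists2 w, G w & w * g = 1.
Proof.
move=> [subG Gpi] Gmax g Gg g0.
have /pi_unit[w wg] : pi g != 0 by apply: contra_neq g0; apply: Gpi.
exists w => //; pose G' := [set x | exists n, G (x * g ^+ n)].
apply: (Gmax G'); last 2 first.
- by move=> x Gx; exists 0; rewrite expr0 mulr1.
- by exists 1; rewrite expr1 wg; apply: subring1.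
have pow x m n : G (x * g ^+ m) -> G (x * g ^+ (m + n)).
  by move=> Gx; rewrite exprD mulrA; apply: subringM => //; apply: subringX.
split; first split.
- by exists 0; rewrite expr0 mulr1; apply: subring1.
- move=> x y [m Gx] [n Gy]; exists (m + n)%N; rewrite mulrBl.
  by apply: subringB => //; [apply: pow|rewrite addnC; apply: pow].
- move=> x y [m Gx] [n Gy]; exists (m + n)%N; rewrite exprD mulrACA.
  exact: subringM.
- move=> x [n Gx] pix.
  have : x * g ^+ n = 0 by apply: Gpi; rewrite // rmorphM pix mul0r.
  move/(congr1 ( *%R^~ (w ^+ n))); rewrite -mulrA -exprMn mulrC [g * w]mulrC wg.
  by rewrite expr1n mul1r mul0r.
Qed.

(** A root z over y of the lift of the minimal polynomial of y makes G[z]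
    sectional. If y is transcendental every z over y will do; a separable
    minimal polynomial has a root over y by Hensel's lemma; an inseparable one
    is X^p - z^p. *)
Lemma sectional_step G y : sectional G ->
  (forall g, G g -> g != 0 -> exists2 w, G w & w * g = 1) ->
  [pchar Phi] =i pred0 \/
    (exists2 p, p \in [pchar Phi] & exists2 z, pi z = y & G (z ^+ p)) ->
  exists2 z, pi z = y & sectional (adjoin G z).
Proof.
move=> [subG Gpi] Ginv charP.
have [z0 z0y] := pi_onto y.
have map0 f : coefs_in G f -> map_poly pi f = 0 -> f = 0.
  move=> Gf /polyP f0; apply/polyP => i; rewrite coef0; apply: Gpi => //.
  by have := f0 i; rewrite coef_map coef0.
(* the minimal polynomial of y lifts to G, or y is transcendental *)
pose root_of f := [/\ coefs_in G f, f != 0 & (map_poly pi f).[y] = 0].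
have [[f0 f0r]|trans] := pselect (exists f, root_of f); last first.
  exists z0 => //; apply: sectional_adjoin => // P GP PZ.
  have [->|P0] := eqVneq P 0; first by rewrite horner0.
  by case: trans; exists P; split=> //; rewrite -z0y horner_map PZ.
have Pn : exists n, `[< exists2 f, root_of f & size f = n >].
  by exists (size f0); apply/asboolP; exists f0.
have [n /asboolP[f [Gf fN0 fy] szf] nmin] := ex_minnP Pn.
have fmin g : coefs_in G g -> (map_poly pi g).[y] = 0 -> (size g < size f)%N -> g = 0.
  move=> Gg gy; have [//|gN0] := eqVneq g 0; rewrite ltnNge => /negP[].
  by rewrite szf; apply: nmin; apply/asboolP; exists g.
have key f1 z : coefs_in G f1 -> f1 != 0 -> (map_poly pi f1).[y] = 0 ->
    size f1 = size f -> pi z = y -> f1.[z] = 0 -> sectional (adjoin G z).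
  move=> Gf1 f10 f1y szf1 zy f1z; apply: sectional_adjoin => // P GP PZ.
  have [||w Gw wf] := Ginv (lead_coef f1); rewrite ?lead_coef_eq0 //.
    exact: Gf1.
  have [||Q GQ ->] := divide_by_minimal subG Gf1 Gw wf f1y _ GP.
  - by move=> g Gg gy; rewrite szf1; apply: fmin.
  - by rewrite -zy horner_map PZ.
  by rewrite hornerM f1z mulr0.
have sz1 : (1 < size f)%N.
  rewrite ltnNge; apply/negP => /size1_polyC E; move: fy; rewrite E map_polyC hornerC /=.
  by move/(Gpi _ (Gf 0%N)) => f00; case/eqP: fN0; rewrite E f00.
have [f'0|f'N0] := eqVneq f^`() 0; last first.
  have [||z zz0 fz] := @hensel f z0.
  - by rewrite -horner_map z0y.
  - rewrite -horner_map z0y; apply: contra_neq f'N0 => f'y.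
    by apply: fmin => //; [apply: coefs_in_deriv | apply: lt_size_deriv].
  by exists z; [rewrite zz0 | apply: key fz; rewrite ?zz0].
have lead0 : (size f).-1%:R = 0 :> Phi.
  have := congr1 (fun g : {poly T} => g`_(size f).-2) f'0.
  rewrite coef0 coef_deriv.
  have -> : (size f).-2.+1 = (size f).-1 by case: (size f) sz1 => // [[]].
  move/(congr1 pi); rewrite rmorphMn rmorph0 -mulr_natr => /eqP.
  rewrite mulf_eq0 => /orP[/eqP l0|/eqP //].
  case/eqP: fN0; apply/eqP; rewrite -lead_coef_eq0; apply/eqP.
  by apply: Gpi l0; apply: Gf.
case: charP => [char0|[p charp [z zy Gzp]]].
  move/eqP: lead0; rewrite ((pcharf0P Phi).1 char0).
  by case: (size f) sz1 => // [[]].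
exists z => //.
have p_gt0 : (0 < p)%N by apply/prime_gt0/(pcharf_prime charp).
pose f1 : {poly T} := 'X^p - (z ^+ p)%:P.
have szf1 : size f1 = p.+1 by apply: size_XnsubC.
have Gf1 : coefs_in G f1.
  by apply: coefs_inB => //; [apply: coefs_inX | apply: coefs_inC].
have f1z : f1.[z] = 0 by rewrite !hornerE subrr.
have f1N0 : f1 != 0 by rewrite -size_poly_gt0 szf1.
have f1y : (map_poly pi f1).[y] = 0 by rewrite -zy horner_map f1z rmorph0.
apply: (key f1) => //; apply/eqP; rewrite eqn_leq szf1; apply/andP; split.
  move/eqP: lead0; rewrite -(dvdn_pcharf charp) => /dvdn_leq.
  by case: (size f) sz1 => [|[|m]] //= _; apply.
by rewrite -szf1 leqNgt; apply: contra_neqN f1N0 => /fmin; apply.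
Qed.

(** Formal smoothness of a field over its prime field, made concrete: a subring
    mapping injectively to the residue field of a henselian ring lies in a
    subring mapping bijectively to it.  In characteristic p, simple roots do not
    suffice, and the subring is asked to contain pth powers of lifts. *)
Theorem lift_residue_field G0 : sectional G0 ->
  [pchar Phi] =i pred0 \/
    (exists2 p, p \in [pchar Phi] & forall y, exists2 z, pi z = y & G0 (z ^+ p)) ->
  exists G, [/\ sectional G, G0 `<=` G & forall y, exists2 x, G x & pi x = y].
Proof.
move=> secG0 charP.
have [F F0 Ftot Fsec|G [Ggood G0G Gmax]] := maximal_above (P := sectional) secG0.
  split; first by apply: subring_chain => // X /Fsec[].
  by move=> x [X FX Xx]; have [_] := Fsec X FX; apply.
exists G; split => // y.
have Ginv := maximal_sectional_inv Ggood Gmax.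
have [|z zy secz] := @sectional_step _ y Ggood Ginv.
  case: charP => [|[p charp H]]; [by left|right; exists p => //].
  by have [z zy G0z] := H y; exists z => //; apply: G0G.
exists z => //; apply: (Gmax _ secz); last exact: mem_adjoin Ggood.1 _.
exact: sub_adjoin Ggood.1 _.
Qed.

End Lifting.

Section Multiples.
Variable R : comNzRingType.
Implicit Type a : R.

Definition multiples a : set R := [set x | exists y, x = a * y].

Lemma multiples_ideal a : is_ideal (multiples a).
Proof.
split; first by exists 0; rewrite mulr0.
- by move=> _ _ [y ->] [z ->]; exists (y + z); rewrite mulrDr.
- by move=> b _ [y ->]; exists (b * y); rewrite mulrCA.
Qed.

Lemma ideal_pow_multiples a n : ideal_pow (multiples a) n = multiples (a ^+ n).
Proof.
apply/seteqP; split=> [x|x [y ->]].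
  apply; split; first exact: multiples_ideal.
  move=> _ [f fI ->]; elim: n f fI => [|n IH] f fI.
    by exists 1; rewrite big_ord0 mulr1.
  have [z zE] := IH (fun j => f (lift ord0 j)) (fun j => fI _).
  have [y yE] := fI ord0.
  by rewrite big_ord_recl yE zE exprS mulrACA; exists (y * z).
have [_ _ M] := ideal_pow_ideal (multiples a) n; rewrite mulrC; apply: M.
apply: sub_ideal_span; exists (fun=> a); last by rewrite prodr_const card_ord.
by move=> _; exists 1; rewrite mulr1.
Qed.

End Multiples.

(** * Discrete valuation rings and their uniformizers *)

Section Dvr.
Variable V : idomainType.

Definition uniformizer (t : V) :=
  [/\ t != 0, t \isn't a GRing.unit &
      forall x, x != 0 -> exists n u, u \is a GRing.unit /\ x = t ^+ n * u].

Lemma fraction_numden (q : {fraction V}) :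
  exists a b, b != 0 /\ q * tofrac b = tofrac a.
Proof.
elim/quotW: q => x; exists \n_x, \d_x; split; first exact: denom_ratioP.
rewrite !piE; apply/eqP; rewrite piE /FracField.equivf /FracField.mulf.
by rewrite !numden_Ratio ?mulf_neq0 ?oner_eq0 ?denom_ratioP //= ?mulr1 mulrC.
Qed.

(** An element of value one will do. *)
Lemma dvr_uniformizer : dvr V -> exists t, uniformizer t.
Proof.
move=> [v [[vM _ von] vV]].
have v1 : v 1 = 0.
  by have := vM 1 1 (oner_neq0 _) (oner_neq0 _); rewrite mulr1 -[LHS]addr0 => /addrI.
have vX x n : x != 0 -> v (x ^+ n) = v x *+ n.
  move=> x0; elim: n => [|n IH]; first by rewrite expr0 v1 mulr0n.
  by rewrite exprS vM ?expf_neq0 // IH mulrS.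
have vI x : x != 0 -> v x^-1 = - v x.
  move=> x0; apply/eqP; rewrite -addr_eq0 -vM ?invr_eq0 //.
  by rewrite mulVf // v1.
have [x1 x10 vx1] := von 1.
have [|t x1t] := (vV _ x10).1; first by rewrite vx1.
rewrite {}x1t tofrac_eq0 in x10 vx1; exists t; split=> // [|x x0].
  apply/negP => /divrr /(congr1 (@tofrac V)); rewrite tofracM tofrac1 => /(congr1 v).
  have ti0 : t^-1 != 0 by rewrite invr_eq0.
  rewrite vM ?tofrac_eq0 // v1 vx1 => H.
  have [|_ /(_ _)] := vV (tofrac t^-1); first by rewrite tofrac_eq0.
  by move=> /(_ (ex_intro _ _ erefl)); move: H; case: (v _) => // n; rewrite -PoszD.
have x0' : tofrac x != 0 by rewrite tofrac_eq0.
have : 0 <= v (tofrac x) by apply/(vV _ x0'); exists x.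
case vx : (v (tofrac x)) => [n|//] _.
have tn0 : tofrac t ^+ n != 0 by rewrite expf_neq0 // tofrac_eq0.
pose q := tofrac x / tofrac t ^+ n.
have q0 : q != 0 by rewrite mulf_neq0 // invr_eq0.
have vq : v q = 0.
  by rewrite vM ?invr_eq0 // vI // vX ?tofrac_eq0 // vx vx1 natz subrr.
have [|u qu] := (vV _ q0).1; first by rewrite vq.
have [||w qw] := (vV q^-1 _).1; rewrite ?invr_eq0 ?vI ?vq //.
exists n, u; split.
  apply/unitrP; exists w; split; apply/eqP; rewrite -tofrac_eq tofracM -qu -qw tofrac1 ?mulVf //.
  by rewrite mulfV.
by apply/eqP; rewrite -tofrac_eq tofracM -qu tofracXn mulrC divfK.
Qed.

Section Uniformizer.
Variables (t : V) (unift : uniformizer t).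

Definition tpow n : set V := multiples (t ^+ n).

Lemma t_neq0 : t != 0. Proof. by case: unift. Qed.
Lemma tX_neq0 n : t ^+ n != 0. Proof. by rewrite expf_neq0 // t_neq0. Qed.

Lemma tpow_ideal n : is_ideal (tpow n). Proof. exact: multiples_ideal. Qed.
Lemma tpow0 n : tpow n 0. Proof. by case: (tpow_ideal n). Qed.
Lemma tpowD n x y : tpow n x -> tpow n y -> tpow n (x + y).
Proof. by case: (tpow_ideal n) => _ H _; apply: H. Qed.
Lemma tpowN n x : tpow n x -> tpow n (- x).
Proof. by move=> [a ->]; exists (- a); rewrite mulrN. Qed.
Lemma tpowB n x y : tpow n x -> tpow n y -> tpow n (x - y).
Proof. by move=> Hx Hy; apply/tpowD/tpowN. Qed.
Lemma tpowMl n a x : tpow n x -> tpow n (a * x).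
Proof. by case: (tpow_ideal n) => _ _; apply. Qed.
Lemma tpowMr n a x : tpow n x -> tpow n (x * a).
Proof. by rewrite mulrC; apply: tpowMl. Qed.
Lemma tpowM m n x y : tpow m x -> tpow n y -> tpow (m + n) (x * y).
Proof. by move=> [a ->] [b ->]; exists (a * b); rewrite exprD mulrACA. Qed.
Lemma tpowX m n x : tpow m x -> tpow (m * n) (x ^+ n).
Proof. by move=> [a ->]; exists (a ^+ n); rewrite exprMn exprM. Qed.
Lemma tpowW m n x : (m <= n)%N -> tpow n x -> tpow m x.
Proof.
by move=> lemn [a ->]; exists (t ^+ (n - m) * a); rewrite mulrA -exprD subnKC.
Qed.
Lemma tpow_sum n (I : Type) (r : seq I) (P : pred I) (F : I -> V) :
  (forall i, P i -> tpow n (F i)) -> tpow n (\sum_(i <- r | P i) F i).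
Proof. by move=> H; elim/big_ind: _ => //; [apply: tpow0|apply: tpowD]. Qed.
Lemma tpowP0 x : tpow 0 x. Proof. by exists x; rewrite mul1r. Qed.
Lemma tpow_tX n : tpow n (t ^+ n). Proof. by exists 1; rewrite mulr1. Qed.
Lemma tpow_cancel m n x : tpow (m + n) (t ^+ m * x) -> tpow n x.
Proof. by move=> [y]; rewrite exprD -mulrA => /(mulfI (tX_neq0 m)) ->; exists y. Qed.

Lemma tpow1_nonunit x : tpow 1 x <-> x \isn't a GRing.unit.
Proof.
have [_ tu tdec] := unift; split.
  by move=> [y ->]; rewrite expr1 unitrM negb_and tu.
have [->|/tdec[[|n] [u [uu ->]]]] := eqVneq x 0; first by move=> _; apply: tpow0.
  by rewrite mul1r uu.
by move=> _; exists (t ^+ n * u); rewrite expr1 exprS mulrA.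
Qed.

Lemma tpow1_prime x y : tpow 1 (x * y) -> tpow 1 x \/ tpow 1 y.
Proof.
by rewrite !tpow1_nonunit unitrM negb_and => /orP.
Qed.

Lemma tpow_exact x : x != 0 -> exists n, tpow n x /\ ~ tpow n.+1 x.
Proof.
move=> x0; have [_ _ /(_ x x0)[n [u [uu xE]]]] := unift.
exists n; split; first by exists u.
rewrite xE -addn1 => /tpow_cancel /tpow1_nonunit; by rewrite uu.
Qed.

Lemma tpow_separated x : (forall n, tpow n x) -> x = 0.
Proof.
by move=> H; apply/eqP/negPn/negP => /tpow_exact[n [_]]; apply.
Qed.

Lemma maximal_ideal_tpow m : maximal_ideal m -> m = tpow 1.
Proof.
move=> [idm m1 mmax]; have [m0 mD mM] := idm.
have mt : m `<=` tpow 1.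
  move=> x mx; apply/tpow1_nonunit; apply/negP => ux.
  by apply: m1; rewrite -(mulVr ux); apply: mM.
case: (mmax _ (tpow_ideal 1) mt) => [//|/seteqP[_ /(_ 1 I)]].
by move/tpow1_nonunit; rewrite unitr1.
Qed.

Lemma ideal_pow_tpow n : ideal_pow (tpow 1) n = tpow n.
Proof. by rewrite ideal_pow_multiples. Qed.

Lemma complete_limit : complete_local V -> forall u : nat -> V,
  (forall n, tpow n (u n.+1 - u n)) -> exists v, forall n, tpow n (v - u n).
Proof.
move=> [m [[maxm _] [f fK Kf]]] u cu; move: f fK Kf.
rewrite (maximal_ideal_tpow maxm) => f fK Kf.
have uP : coherent (tpow 1) u by move=> n; rewrite ideal_pow_tpow.
exists (f (completion_of uP)) => n; rewrite -ideal_pow_tpow.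
have /(congr1 (fun c => adic_coset c n)) /= := Kf (completion_of uP).
by move/coset_eqP; apply; apply: ideal_pow_ideal.
Qed.

Lemma complete_series : complete_local V -> forall a : nat -> V,
  exists v, forall n, tpow n (v - \sum_(i < n) a i * t ^+ i).
Proof.
move=> cV a; apply: (complete_limit cV (u := fun n => \sum_(i < n) a i * t ^+ i)) => n.
by rewrite big_ord_recr /= addrAC subrr add0r; exists (a n); rewrite mulrC.
Qed.

Lemma fraction_tpow (q : {fraction V}) : exists n v, q * tofrac t ^+ n = tofrac v.
Proof.
have [a [b [b0 qE]]] := fraction_numden q.
have [_ _ /(_ b b0)[n [u [uu bE]]]] := unift.
exists n, (a / u); apply: (@mulIf _ (tofrac u)).
  by rewrite tofrac_eq0; apply: contraTneq uu => ->; rewrite unitr0.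
by rewrite -tofracM divrK // -qE bE tofracM tofracXn mulrA.
Qed.

End Uniformizer.
End Dvr.

(** * Extension of derivations *)

Section TrivialExtension.
Variables (F : fieldType) (L : lmodType F).

(** The ring F + L in which L has square zero. Its purpose is that x |-> (x, D
    x) is a ring morphism exactly when D is a derivation, so that derivations
    can be extended by lifting fields. *)
Definition trivext : Type := (F * L)%type.
HB.instance Definition _ := GRing.Zmodule.on trivext.
Implicit Types x y z : trivext.

Definition te_mul x y : trivext := (x.1 * y.1, x.1 *: y.2 + y.1 *: x.2).

Let mulA : associative te_mul.
Proof.
move=> x y z; congr pair; rewrite /= ?mulrA // !scalerDr !scalerA -addrA.
by congr (_ + _); rewrite addrC [z.1 * _]mulrC [_ * z.1]mulrC addrC [z.1 * y.1]mulrC.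
Qed.
Let mulC : commutative te_mul.
Proof. by move=> x y; congr pair; [rewrite mulrC | rewrite addrC]. Qed.
Let mul1 : left_id ((1, 0) : trivext) te_mul.
Proof. by case=> a b; rewrite /te_mul /= mul1r scale1r scaler0 addr0. Qed.
Let mulDl : left_distributive te_mul +%R.
Proof.
move=> x y z; congr pair; rewrite /= ?mulrDl // scalerDl scalerDr.
by rewrite addrACA.
Qed.
Let one_neq0 : ((1, 0) : trivext) != 0.
Proof. by apply/eqP => -[/eqP]; rewrite oner_eq0. Qed.
HB.instance Definition _ :=
  GRing.Zmodule_isComNzRing.Build trivext mulA mulC mul1 mulDl one_neq0.

Definition te_proj x : F := x.1.
Lemma te_proj_zmod : zmod_morphism te_proj. Proof. by []. Qed.
Lemma te_proj_monoid : monoid_morphism te_proj. Proof. by []. Qed.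
HB.instance Definition _ := GRing.isZmodMorphism.Build trivext F te_proj te_proj_zmod.
HB.instance Definition _ := GRing.isMonoidMorphism.Build trivext F te_proj te_proj_monoid.

Lemma te_mulE x y : x * y = (x.1 * y.1, x.1 *: y.2 + y.1 *: x.2).
Proof. by []. Qed.

Definition derivation (D : F -> L) :=
  (forall x y : F, D (x + y) = D x + D y) /\
  (forall x y : F, D (x * y) = x *: D y + y *: D x).

End TrivialExtension.

Lemma horner_taylor1 (T : comNzRingType) (f : {poly T}) (a h : T) :
  exists c, f.[a + h] = f.[a] + f^`().[a] * h + h ^+ 2 * c.
Proof.
elim/poly_ind: f => [|f b [c IH]].
  by exists 0; rewrite deriv0 !horner0; ring.
exists (c * (a + h) + f^`().[a]); rewrite derivD derivC derivM derivX.
rewrite !hornerE IH; ring.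
Qed.

Section ExtendDerivation.
Variables (F : fieldType) (L : lmodType F).
Local Notation T := (trivext L).
Local Notation pi := (@te_proj F L).

Lemma te_unit (z : T) : pi z != 0 -> exists w : T, w * z = 1.
Proof.
case: z => a b; rewrite /te_proj /= => a0.
exists ((a^-1, - (a ^- 2 *: b)) : T); congr pair; rewrite /= ?mulVf //.
by rewrite scalerN scalerA expr2 invfM mulrA divff // mul1r subrr.
Qed.

(** A single Newton step is exact, because the kernel has square zero. *)
Lemma te_hensel (f : {poly T}) (y : T) : pi f.[y] = 0 -> pi (f^`()).[y] != 0 ->
  exists2 z, pi z = pi y & f.[z] = 0.
Proof.
move=> fy /te_unit[w wE]; exists (y - w * f.[y]).
  by rewrite rmorphB rmorphM /= fy mulr0 subr0.
have [c ->] := horner_taylor1 f y (- (w * f.[y])).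
rewrite mulrN mulrA [_ * w]mulrC wE mul1r subrr add0r sqrrN exprMn.
suff -> : f.[y] ^+ 2 = 0 by rewrite mulr0 mul0r.
by move: fy; case: f.[y] => a b; rewrite /te_proj /= => ->; rewrite expr2 te_mulE /= mul0r !scale0r addr0.
Qed.

(** The prescribed values, as a subring of pairs in F + L, lie in a subring
    that maps bijectively to F; this is the graph of the derivation. *)
Theorem extend_derivation (G0 : set T) : sectional pi G0 ->
  [pchar F] =i pred0 \/
    (exists2 p, p \in [pchar F] & forall y, G0 (y ^+ p, 0)) ->
  exists2 D : F -> L, derivation D & forall z, G0 z -> D z.1 = z.2.
Proof.
move=> secG0 charP.
have [||G [[subG Gpi] G0G Gonto]] := lift_residue_field _ te_unit te_hensel secG0.
- by move=> y; exists (y, 0).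
- case: charP => [|[p charp H]]; [by left | right; exists p => // y].
  exists ((y, 0) : T) => //.
  have E n : ((y, 0) : T) ^+ n = (y ^+ n, 0).
    elim: n => // n IH.
    by rewrite exprS IH te_mulE /= !scaler0 addr0 -exprS.
  by rewrite E.
have Guniq a b b' : G (a, b) -> G (a, b') -> b = b'.
  move=> Gb Gb'; have := Gpi _ (subringB subG Gb Gb').
  by rewrite rmorphB subrr => /(_ erefl) [_ /eqP]; rewrite subr_eq0 => /eqP.
pose D a := xget 0 [set b | G (a, b)].
have GD a : G (a, D a).
  have [[a' b] Gab /= ab] := Gonto a; rewrite -ab.
  exact: (@xgetPex _ 0 [set b' | G (a', b')] (ex_intro _ b Gab)).
exists D; last by case=> a b /G0G Gab; apply: Guniq (GD a) Gab.
split=> x y.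
  exact: (Guniq _ _ _ (GD (x + y)) (subringD subG (GD x) (GD y))).
exact: (Guniq _ _ _ (GD (x * y)) (subringM subG (GD x) (GD y))).
Qed.

End ExtendDerivation.

Section DerivationTheory.
Variables (F : fieldType) (L : lmodType F) (D : F -> L).
Hypothesis isD : derivation D.
Lemma derD x y : D (x + y) = D x + D y. Proof. exact: isD.1. Qed.
Lemma derM x y : D (x * y) = x *: D y + y *: D x. Proof. exact: isD.2. Qed.
Lemma der0 : D 0 = 0.
Proof. by apply: (addrI (D 0)); rewrite -derD !addr0. Qed.
Lemma derN x : D (- x) = - D x.
Proof. by apply/eqP; rewrite -addr_eq0 -derD addNr der0. Qed.
Lemma derB x y : D (x - y) = D x - D y. Proof. by rewrite derD derN. Qed.
Lemma der1 : D 1 = 0.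
Proof. by apply: (addrI (D 1)); rewrite addr0 -{3}(mulr1 1) derM !scale1r. Qed.
Lemma derX x n : D x = 0 -> D (x ^+ n) = 0.
Proof.
move=> Dx; elim: n => [|n IH]; first by rewrite expr0 der1.
by rewrite exprS derM IH Dx !scaler0 addr0.
Qed.
Lemma der_sum (I : Type) (r : seq I) (P : pred I) (E : I -> F) :
  D (\sum_(i <- r | P i) E i) = \sum_(i <- r | P i) D (E i).
Proof. by apply: (big_morph D derD der0). Qed.
End DerivationTheory.

Section Independence.
Variable F : fieldType.
Implicit Types A : set F.

Definition sep_alg A x :=
  exists2 f, coefs_in A f & f.[x] = 0 /\ (f^`()).[x] != 0.

(** Every derivation kills pth powers in characteristic p; if A contains them
    all, nothing else obstructs the extension of derivations from A to F. *)
Definition derivations_extend A :=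
  [pchar F] =i pred0 \/ (exists2 p, p \in [pchar F] & forall y, A (y ^+ p)).

(** The rule f(x) |-> f'(x) is well defined on A[x] because f(x) = 0 forces
    f'(x) = 0 when x is not separably algebraic over A. *)
Lemma separating_derivation A x : subring A -> derivations_extend A ->
  ~ sep_alg A x ->
  exists D : F -> F^o, [/\ derivation D, forall a, A a -> D a = 0 & D x = 1].
Proof.
move=> subA charP nalg.
pose G0 : set (trivext F^o) := [set (f.[x], (f^`()).[x]) | f in coefs_in A].
have [||D isD HD] := @extend_derivation F F^o G0.
- split; last first.
    move=> _ [f Af <-]; rewrite /te_proj /= => fx.
    have [f'x|nf'x] := eqVneq (f^`()).[x] 0; first by rewrite fx f'x.
    by case: nalg; exists f.
  split.
  - exists 1; first by apply: coefs_inC => //; apply: subring1.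
    by rewrite derivC !hornerC.
  - move=> _ _ [f Af <-] [g Ag <-]; exists (f - g); first exact: coefs_inB.
    by rewrite derivB !hornerD !hornerN.
  - move=> _ _ [f Af <-] [g Ag <-]; exists (f * g); first exact: coefs_inM.
    rewrite derivM !hornerE te_mulE /=; congr pair; rewrite addrC; congr (_ + _).
    exact: mulrC.
- case: charP => [|[p charp H]]; [by left|right; exists p => // y].
  by exists (y ^+ p)%:P; [apply: coefs_inC|rewrite derivC !hornerC].
exists D; split=> // [a Aa|].
  by apply: (HD (a, 0)); exists a%:P; [apply: coefs_inC|rewrite derivC !hornerC].
apply: (HD (x, 1)); exists 'X; last by rewrite derivX hornerX hornerC.
exact: (coefs_inX _ 1).
Qed.

(** A sequence in which no term depends separably on the preceding ones admits
    a derivation whose value at the nth term has degree exactly n.  The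
    derivations dual to the single terms assemble on the union of the tower
    because all but finitely many vanish at each stage; this is what a value in
    a module of infinite rank requires. *)
Theorem triangular_derivation (A : nat -> set F) (x : nat -> F) :
  (forall n, subring (A n)) -> (forall n, A n `<=` A n.+1) ->
  derivations_extend (A 0%N) ->
  (forall n, A n.+1 (x n)) -> (forall n, ~ sep_alg (A n) (x n)) ->
  exists D : F -> {poly F}, [/\ derivation D, forall a, A 0%N a -> D a = 0 &
    forall n, (D (x n))`_n = 1 /\ forall i, (n < i)%N -> (D (x n))`_i = 0].
Proof.
move=> subA AS ext xA xind.
have Ale m n : (m <= n)%N -> A m `<=` A n.
  move=> /subnK <-; elim: (n - m)%N => // j IH.
  by apply: subset_trans IH _; apply: AS.
have extn n : derivations_extend (A n).
  case: ext => [|[p charp H]]; [by left|right; exists p => // y].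
  exact: Ale (H y).
have /choice[D_ HD] n := separating_derivation (subA n) (extn n) (xind n).
pose G0 : set (trivext {poly F}) :=
  [set z : trivext {poly F} | exists n, A n z.1 /\
     forall i, (z.2 : {poly F})`_i = D_ i z.1 :> F].
have maxA m n a b : A m a -> A n b -> A (maxn m n) a /\ A (maxn m n) b.
  by move=> Aa Ab; split; [apply: Ale Aa; apply: leq_maxl | apply: Ale Ab; apply: leq_maxr].
have [||D isD DE] := @extend_derivation F {poly F} G0.
- split; last first.
    move=> [a b] [n [/= _ E]]; rewrite /te_proj /= => a0; rewrite a0; congr pair.
    apply/polyP => i; rewrite E a0 coef0; have [/der0 //] := HD i.
  split.
  - exists 0%N; split; first exact: subring1 (subA 0%N).
    by move=> i; rewrite coef0 /=; have [/der1 ->] := HD i.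
  - move=> z w [m [Az Ez]] [n [Aw Ew]]; have [Az' Aw'] := maxA _ _ _ _ Az Aw.
    exists (maxn m n); split; first exact: subringB (subA _) _ _ Az' Aw'.
    by move=> i; rewrite coefB Ez Ew; have [/derB ->] := HD i.
  - move=> z w [m [Az Ez]] [n [Aw Ew]]; have [Az' Aw'] := maxA _ _ _ _ Az Aw.
    exists (maxn m n); split; first exact: subringM (subA _) _ _ Az' Aw'.
    by move=> i; rewrite coefD !coefZ Ez Ew; have [/derM ->] := HD i.
- case: ext => [|[p charp H]]; [by left|right; exists p => // y].
  exists 0%N; split=> [|i]; first exact: H.
  have [_ D0 _] := HD i; rewrite coef0 /= D0 //; exact: Ale (H y).
exists D; split=> // [a Aa|n].
  apply: (DE (a, 0)); exists 0%N; split=> // i.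
  have [_ D0 _] := HD i; rewrite coef0 /= D0 //; exact: Ale Aa.
have -> : D (x n) = \poly_(i < n.+1) D_ i (x n).
  apply: (DE (x n, _)); exists n.+1; split=> [|i] /=; first exact: xA.
  rewrite coef_poly; case: ltnP => // ltni.
  have [_ D0 _] := HD i; rewrite D0 //; exact: Ale (xA n).
rewrite coef_poly ltnSn; split; first by have [_ _ ->] := HD n.
by move=> i ltni; rewrite coef_poly ltnNge ltni.
Qed.

End Independence.

(** * Ideals free over their rings of endomorphisms *)

Section FreeIdeal.
Variables (R : idomainType) (I : set R) (HI : is_ideal I).

(** Multiplication by x0 identifies the ring of endomorphisms of I with I: an
    endomorphism is determined by its value at x0, and the hypothesis makes
    every element of I such a value. *)
Lemma principal_square_stable x0 : I x0 -> x0 != 0 ->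
  (forall y z, I y -> I z -> exists2 w, I w & w * x0 = y * z) -> stable_ideal HI.
Proof.
move=> Ix0 x00 sq M N g f g_onto.
pose P := ideal_mod HI; pose E := endo P.
have Ival (y : P) : I (val y) by apply: set_mem (valP y).
pose X0 : P := Sub x0 (mem_set Ix0).
have eX0 (e : E) (y : P) : val (val e y) * x0 = val y * val (val e X0).
  have lin (a : R) (z : P) : val e (a *: z) = a *: val e z.
    have := endo_linear e a z 0; rewrite !addr0 => ->.
    suff -> : val e 0 = 0 by rewrite addr0.
    by have := endo_linear e (- 1) 0 0; rewrite !scaler0 addr0 scaleN1r addNr.
  have : val e (val X0 *: y) = val e (val y *: X0).
    by congr (val e _); apply: val_inj; rewrite /= /GRing.scale /= mulrC.
  by rewrite !lin => /(congr1 val); rewrite /= /GRing.scale /= mulrC.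
have euniq (e e' : E) : val e X0 = val e' X0 -> e = e'.
  move=> ee; apply: endoP => y; apply: val_inj; apply: (mulIf x00).
  by rewrite !eX0 ee.
have /choice[mult multE] : forall y : P, exists e : E, val e X0 = y.
  move=> y.
  have /choice[e eE] : forall z : P, exists w : P, val w * x0 = val y * val z.
    by move=> z; have [w Iw wE] := sq _ _ (Ival y) (Ival z); exists (Sub w (mem_set Iw)).
  have elin : linear e.
    move=> a z w; apply: val_inj; apply: (mulIf x00).
    rewrite [LHS]eE /= /GRing.scale /= [RHS]mulrDl -[X in _ = X + _]mulrA.
    by rewrite !eE mulrDr mulrCA.
  exists (Sub e (asboolT elin)); apply: val_inj; apply: (mulIf x00).
  by rewrite /= eE /= mulrC.
have [m0 gm0] := g_onto (f (X0 : endo_mod P)).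
pose h (y : endo_mod P) : M := mult y *: m0.
have hlin : linear h.
  move=> a y z; rewrite /h scalerA -scalerDl; congr (_ *: _); apply: euniq.
  change (val (mult (a *: y + z)) X0 = val a (val (mult y) X0) + val (mult z) X0).
  by rewrite !multE.
pose HL := GRing.isLinear.Build E (endo_mod P) M _ h hlin.
pose hL : {linear endo_mod P -> M} := HB.pack h HL.
exists hL => y; rewrite /hL /= /h linearZ gm0 -linearZ; congr (f _).
exact: multE.
Qed.

End FreeIdeal.

Section SpanTheory.
Variable R : comNzRingType.

Lemma ideal_sum (I : set R) (J : Type) (r : seq J) (P : pred J) (F : J -> R) :
  is_ideal I -> (forall i, P i -> I (F i)) -> I (\sum_(i <- r | P i) F i).
Proof.
by move=> [I0 ID _] H; elim/big_ind: _ => //; apply: ID.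
Qed.

Lemma ideal_span_range n (g : 'I_n -> R) x : ideal_span (range g) x ->
  exists a : 'I_n -> R, x = \sum_i a i * g i.
Proof.
move/(_ [set x | exists a : 'I_n -> R, x = \sum_i a i * g i]); apply.
split; last first.
  move=> _ [i _ <-]; exists (fun j => (j == i)%:R).
  rewrite (bigD1 i) //= eqxx mul1r big1 ?addr0 // => j /negbTE ->.
  by rewrite mul0r.
split.
- by exists (fun=> 0); rewrite big1 // => i _; rewrite mul0r.
- move=> _ _ [a ->] [b ->]; exists (fun i => a i + b i).
  by rewrite -big_split; apply: eq_bigr => i _; rewrite mulrDl.
- move=> c _ [a ->]; exists (fun i => c * a i).
  by rewrite mulr_sumr; apply: eq_bigr => i _; rewrite mulrA.
Qed.

Lemma generated_by_seq (I : set R) (s : seq R) : is_ideal I ->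
  (forall x, x \in s -> I x) -> (forall x, I x -> ideal_span [set` s] x) ->
  generated_by_n I (size s).
Proof.
move=> idI sI Is; exists (fun i => s`_i); apply/seteqP; split=> x.
  move/Is; apply; split; first exact: ideal_span_ideal.
  move=> y /= ys; apply: sub_ideal_span.
  by exists (Ordinal (etrans (index_mem y s) ys)); rewrite //= nth_index.
by apply; split=> // _ [i _ <-]; apply/sI/mem_nth.
Qed.

End SpanTheory.

(** * Overrings of quadratic type and stability *)

Section FractionEmbedding.
Variables (R V : idomainType) (i : {rmorphism R -> V}).
Hypothesis i_inj : injective i.
Hypothesis i_frac : forall v, exists a b, b != 0 /\ i b * v = i a.

Local Notation K := {fraction R}.
Local Notation frac := (@tofrac R).

Lemma fraction_embedding_subproof v : exists q : K,
  forall a b, b != 0 -> i b * v = i a -> q = frac a / frac b.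
Proof.
have [a [b [b0 E]]] := i_frac v; exists (frac a / frac b) => a' b' b'0 E'.
apply/eqP; rewrite eqr_div ?tofrac_eq0 // -!tofracM tofrac_eq; apply/eqP/i_inj.
by rewrite !rmorphM -E -E'; ring.
Qed.

Definition fraction_embedding v : K := sval (cid (fraction_embedding_subproof v)).
Local Notation g := fraction_embedding.

Lemma fraction_embeddingE v a b : b != 0 -> i b * v = i a -> g v = frac a / frac b.
Proof. exact: svalP (cid (fraction_embedding_subproof v)) a b. Qed.

Lemma fraction_embedding_zmod : zmod_morphism g.
Proof.
move=> v w; have [a [b [b0 E]]] := i_frac v; have [c [d [d0 E']]] := i_frac w.
rewrite (fraction_embeddingE b0 E) (fraction_embeddingE d0 E').
rewrite (@fraction_embeddingE _ (a * d - c * b) (b * d)) ?mulf_neq0 //.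
  rewrite -[X in _ = _ + X]mulNr -tofracN addf_div ?tofrac_eq0 //.
  by rewrite -!tofracM -tofracD mulNr.
by rewrite rmorphB !rmorphM -E -E'; ring.
Qed.

Lemma fraction_embedding_monoid : monoid_morphism g.
Proof.
split=> [|v w].
  by rewrite (@fraction_embeddingE _ 1 1) ?oner_eq0 ?rmorph1 ?mulr1 ?divr1 // tofrac1 divr1.
have [a [b [b0 E]]] := i_frac v; have [c [d [d0 E']]] := i_frac w.
rewrite (fraction_embeddingE b0 E) (fraction_embeddingE d0 E').
rewrite (@fraction_embeddingE _ (a * c) (b * d)) ?mulf_neq0 //.
  by rewrite !tofracM mulf_div.
by rewrite !rmorphM -E -E'; ring.
Qed.

HB.instance Definition _ :=
  GRing.isZmodMorphism.Build V K fraction_embedding fraction_embedding_zmod.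
HB.instance Definition _ :=
  GRing.isMonoidMorphism.Build V K fraction_embedding fraction_embedding_monoid.

Lemma fraction_embedding_val r : g (i r) = frac r.
Proof.
by rewrite (@fraction_embeddingE _ r 1) ?oner_eq0 ?tofrac1 ?divr1 // rmorph1 mul1r.
Qed.

Lemma fraction_embedding_inj : injective g.
Proof.
move=> v w /eqP; rewrite -subr_eq0 -rmorphB /= => /eqP.
have [a [b [b0 E]]] := i_frac (v - w); rewrite (fraction_embeddingE b0 E).
move/eqP; rewrite mulf_eq0 invr_eq0 !tofrac_eq0 (negbTE b0) orbF => /eqP a0.
move/eqP: E; rewrite a0 rmorph0 mulf_eq0 => /orP[|].
  by rewrite -(rmorph0 i) => /eqP/i_inj/eqP; rewrite (negbTE b0).
by rewrite subr_eq0 => /eqP.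
Qed.

End FractionEmbedding.

Section QuadraticOverring.
Variables (R V : idomainType) (i : {rmorphism R -> V}) (t : V).
Hypothesis unift : uniformizer t.
Hypothesis i_inj : injective i.
Hypothesis i_unit : forall r, i r \is a GRing.unit -> exists s, s * r = 1.
Hypothesis i_conductor : forall v, exists N, forall n, (N <= n)%N ->
  exists r, i r = t ^+ n * v.
Hypothesis i_quadratic : forall a b, exists r s u, a * b = i r * a + i s * b + i u.

Local Notation tpow := (tpow t).

Let i_eq0 r : (i r == 0) = (r == 0).
Proof. by rewrite -(rmorph0 i) (inj_eq i_inj). Qed.

Lemma overring_frac v : exists a b, b != 0 /\ i b * v = i a.
Proof.
have [N HN] := i_conductor v; have [M HM] := i_conductor 1.
have [a aE] := HN _ (leq_maxl N M); have [b bE] := HM _ (leq_maxr N M).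
exists a, b; rewrite aE bE mulr1; split=> //.
by rewrite -i_eq0 bE mulr1 (tX_neq0 unift).
Qed.

Definition overring_max : set R := [set r | tpow 1 (i r)].

Lemma overring_max_ideal : is_ideal overring_max.
Proof.
rewrite /overring_max; split=> [|x y|a x] /=.
- by rewrite rmorph0; apply: tpow0.
- by rewrite rmorphD; apply: tpowD.
- by rewrite rmorphM; apply: tpowMl.
Qed.

Lemma proper_sub_max J : is_ideal J -> ~ J 1 -> J `<=` overring_max.
Proof.
move=> [_ _ JM] J1 x Jx; rewrite /overring_max /= tpow1_nonunit //.
apply/negP => /i_unit[s sx]; apply: J1; rewrite -sx; exact: JM.
Qed.

Lemma max_proper : ~ overring_max 1.
Proof. by rewrite /overring_max /= rmorph1 tpow1_nonunit // unitr1. Qed.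

Lemma overring_local : the_maximal_ideal overring_max.
Proof.
split.
  split; [exact: overring_max_ideal | exact: max_proper |].
  move=> J idJ mJ; have [J1|nJ1] := pselect (J 1); last first.
    by left; apply/seteqP; split=> //; apply: proper_sub_max.
  right; apply/seteqP; split=> // x _; case: idJ => _ _ JM.
  by rewrite -(mulr1 x); apply: JM.
move=> m' [idm' m'1 m'max].
case: (m'max _ overring_max_ideal (proper_sub_max idm' m'1)) => // E.
by case: max_proper; rewrite E.
Qed.

Lemma small_multiple x v : x != 0 -> exists N, forall n, (N <= n)%N ->
  exists r, i (r * x) = t ^+ n * v.
Proof.
move=> x0; have [_ _ /(_ (i x))] := unift; rewrite i_eq0 => /(_ x0)[c [u [uu xE]]].
have [N HN] := i_conductor (v / u); exists (N + c)%N => n len.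
have [|r rE] := HN (n - c)%N; first by rewrite leq_subRL ?(leq_trans _ len) ?leq_addl // addnC.
exists r; rewrite rmorphM rE xE mulrACA -exprD subnK ?divrK //.
by apply: leq_trans len; apply: leq_addl.
Qed.

(** Every y in the maximal ideal has a power in P: with y = t z, the powers of
    z lie in Rz + R, and a high power of t carries this module into Rx. *)
Lemma nonzero_prime P x : prime_ideal P -> P x -> x != 0 -> P = overring_max.
Proof.
move=> [idP P1 Pp] Px x0; have [P0 PD PM] := idP.
apply/seteqP; split; first exact: proper_sub_max.
move=> y [z]; rewrite expr1 => yE.
(* the powers of z stay in the module generated by z and 1 *)
have [r [s [u zz]]] := i_quadratic z z.
have zX n : exists a b, z ^+ n = i a * z + i b.
  elim: n => [|n [a [b E]]].
    by exists 0, 1; rewrite expr0 rmorph0 rmorph1 mul0r add0r.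
  exists (a * (r + s) + b), (a * u); rewrite exprSr E mulrDl -mulrA zz.
  by rewrite !rmorphD !rmorphM !rmorphD; ring.
have [N HN] := small_multiple z x0; have [M HM] := small_multiple 1 x0.
have [e eE] := HN _ (leq_maxl N M); have [f fE] := HM _ (leq_maxr N M).
set n := maxn N M in eE fE; have [a [b zn]] := zX n.
have Pyn : P (y ^+ n).
  suff -> : y ^+ n = (a * e + b * f) * x by apply: PM.
  apply: i_inj; transitivity (i a * i (e * x) + i b * i (f * x)).
    by rewrite rmorphXn /= yE exprMn zn eE fE; ring.
  by rewrite -!rmorphM -rmorphD; congr (i _); ring.
elim: n Pyn {eE fE zn} => [//|n IH]; rewrite exprS => /Pp[//|]; exact: IH.
Qed.

Lemma overring_krull : krull_dim R 1.
Proof.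
have [N HN] := i_conductor 1; have [x xE] := HN N.+1 (leqnSn N).
have x0 : x != 0 by rewrite -i_eq0 xE mulr1 (tX_neq0 unift).
have mx : overring_max x by rewrite /overring_max /= xE; exists (t ^+ N); rewrite mulr1 exprS.
split.
  exists (fun n => if n is 0%N then [set 0] else overring_max); split.
    case=> [_|n _]; last first.
      split; [exact: overring_max_ideal | exact: max_proper|].
      by move=> a b; rewrite /overring_max /= rmorphM; apply: tpow1_prime.
    split.
    - by split=> [|a b -> ->|a b ->] //=; rewrite ?addr0 ?mulr0.
    - by move/eqP; rewrite oner_eq0.
    - by move=> a b /eqP; rewrite mulf_eq0 => /orP[] /eqP ->; [left|right].
  case=> // _; split; last by move/(_ x mx)/eqP; rewrite (negbTE x0).
  by move=> _ ->; rewrite /overring_max /= rmorph0; apply: tpow0.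
move=> [P [primeP PP]].
have nz j : (j < 2)%N -> P j.+1 = overring_max.
  move=> j2; have [sPP nPP] := PP j j2.
  have [y [Py nPy]] : exists y, P j.+1 y /\ ~ P j y.
    by apply: contrapT => H; apply: nPP => y Py; apply: contrapT => nPy; case: H; exists y.
  apply: (nonzero_prime (primeP _ _) Py) => //.
  apply: contra_notN nPy => /eqP ->.
  by have [[]] := primeP j (ltnW j2).
have := PP 1%N isT; rewrite (nz 0%N) // (nz 1%N) // => -[_]; exact.
Qed.

(** For x of least value in I, the quotients y / x with y in I lie in V, and
    the product of two of them lies in their span over R together with 1.
    Hence the product of two elements of I is a multiple of x in I. *)
Lemma overring_stable : stable_ring R.
Proof.
move=> I HI [x1 Ix1 reg1].
have x10 : x1 != 0.
  apply/eqP => x10; have := reg1 1 0; rewrite x10 !mul0r => /(_ erefl)/eqP.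
  by rewrite oner_eq0.
pose ord n := `[< exists x, [/\ I x, x != 0 & ~ tpow n.+1 (i x)] >].
have ex_ord : exists n, ord n.
  have [|n [_ nt]] := tpow_exact unift (x := i x1); first by rewrite i_eq0.
  by exists n; apply/asboolP; exists x1.
have [n /asboolP[x [Ix x0 nx]] nmin] := ex_minnP ex_ord.
have xdvd y : I y -> exists a, i y = i x * a.
  move=> Iy; have [->|y0] := eqVneq y 0; first by exists 0; rewrite rmorph0 mulr0.
  have [_ _ ut] := unift.
  have [|m [u [uu xE]]] := ut (i x); first by rewrite i_eq0.
  have [|m' [u' [uu' yE]]] := ut (i y); first by rewrite i_eq0.
  have lemn : (m <= n)%N.
    rewrite leqNgt; apply/negP => ltnm; apply: nx; rewrite xE.
    by apply: tpowW ltnm _; exists u.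
  have lenm' : (n <= m')%N.
    apply: nmin; apply/asboolP; exists y; split=> //.
    rewrite yE -addn1 => /(tpow_cancel unift)/(tpow1_nonunit unift)/negP; apply.
    exact: uu'.
  have lemm' := leq_trans lemn lenm'.
  exists (t ^+ (m' - m) * (u' / u)); rewrite xE yE.
  by rewrite mulrACA -exprD subnKC // [u * _]mulrC divrK.
apply: (principal_square_stable Ix x0) => y z Iy Iz.
have [a yE] := xdvd y Iy; have [b zE] := xdvd z Iz.
have [r [s [u ab]]] := i_quadratic a b; have [_ ID IM] := HI.
exists (r * y + s * z + u * x).
  by apply: (ID); [apply: (ID); apply: IM|apply: IM].
apply: i_inj; rewrite rmorphM [RHS]rmorphM !rmorphD !rmorphM yE zE.
by rewrite [RHS]mulrACA ab; ring.
Qed.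

Local Notation g := (fraction_embedding i_inj overring_frac).

(** The quadratic relation between an element of V and itself makes it
    integral over R; conversely an element of the fraction field outside V has
    its inverse in tV and cannot be integral. *)
Lemma overring_normalization : is_normalization g.
Proof.
have g_inj : injective g by apply: fraction_embedding_inj.
split=> //; apply/seteqP; split=> [_ [v _ <-]|q].
  have [r [s [u vv]]] := i_quadratic v v.
  exists ('X^2 - (r + s)%:P * 'X - u%:P).
    apply/monicP; rewrite -addrA -opprD lead_coefDl ?lead_coefXn //.
    rewrite size_polyXn size_polyN ltnS (leq_trans (size_polyD _ _)) //.
    rewrite geq_max (leq_trans (size_polyC_leq1 _)) // andbT.
    rewrite (leq_trans (size_polyMleq _ _)) // size_polyX size_polyC.
    by case: (_ == _).
  rewrite /root !rmorphB /= map_polyXn rmorphM /= !map_polyC /= map_polyX.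
  have E : v * v - i (r + s) * v - i u = 0 by rewrite vv rmorphD; ring.
  have := congr1 g E; rewrite rmorphB rmorphB (rmorphM _ v) (rmorphM _ (i _)).
  by rewrite /= !fraction_embedding_val rmorph0 !hornerE => ->.
move=> [p mp]; rewrite /root => /eqP pq.
have [a [b [b0 qE]]] := fraction_numden q.
have gq : q * g (i b) = g (i a) by rewrite !fraction_embedding_val.
have gb0 : g (i b) != 0 by rewrite fraction_embedding_val tofrac_eq0.
have [_ _ ut] := unift.
have [a0|a0] := eqVneq a 0.
  exists 0 => //; rewrite rmorph0; apply: (mulIf gb0).
  by rewrite gq a0 rmorph0 rmorph0 mul0r.
have [|n [u [uu aE]]] := ut (i a); first by rewrite i_eq0.
have [|m [w [uw bE]]] := ut (i b); first by rewrite i_eq0.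
have [lemn|ltnm] := leqP m n.
  exists (t ^+ (n - m) * (u / w)) => //; apply: (mulIf gb0); rewrite gq -rmorphM.
  by rewrite aE bE mulrACA -exprD subnK // divrK.
(* otherwise the inverse of q lies in the maximal ideal of V *)
pose y := t ^+ (m - n) * (w / u).
have qy : q * g y = 1.
  apply: (@mulIf _ (g (i a))); first by rewrite fraction_embedding_val tofrac_eq0.
  rewrite -mulrA -rmorphM mul1r -gq; congr (q * g _).
  by rewrite aE bE mulrACA -exprD subnK ?(ltnW ltnm) // divrK.
have ty : tpow 1 y.
  by apply: tpowW (_ : (0 < m - n)%N) _; rewrite ?subn_gt0 //; exists (w / u).
have szp : (0 < size p)%N by rewrite size_poly_gt0 monic_neq0.
have : g (\sum_(j < size p) i p`_j * y ^+ ((size p).-1 - j)) = 0.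
  rewrite -[RHS](mul0r (g y ^+ (size p).-1)) -pq horner_coef size_map_poly_id0; last first.
    by rewrite tofrac_eq0 lead_coef_eq0 monic_neq0.
  rewrite rmorph_sum mulr_suml; apply: eq_bigr => j _.
  rewrite rmorphM rmorphXn /= fraction_embedding_val coef_map -mulrA; congr (_ * _).
  have lej : (j <= (size p).-1)%N by rewrite -ltnS prednK.
  by rewrite -{2}(subnKC lej) exprD mulrA -exprMn qy expr1n mul1r.
move/eqP; rewrite -(rmorph0 g) (inj_eq g_inj) => /eqP sum0.
case: (max_proper); rewrite /overring_max /= rmorph1.
have [h szE] : exists h, size p = h.+1 by exists (size p).-1; rewrite prednK.
have leadp : p`_h = 1 by have /monicP := mp; rewrite lead_coefE szE.
move: sum0; rewrite szE big_ord_recr /= subnn expr0 mulr1 leadp rmorph1 => /eqP.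
rewrite addrC addr_eq0 => /eqP ->; apply/tpowN/tpow_sum => j _; apply: tpowMl.
have -> : (h - j = (h - j).-1.+1)%N by rewrite prednK // subn_gt0.
by rewrite exprS; apply: tpowMr.
Qed.

(** Finitely many elements of V are carried into R by one power of t, and so
    would V be if they generated it. *)
Lemma overring_not_finite :
  (forall N, exists v, forall r, i r <> t ^+ N * v) -> ~ finite_normalization R.
Proof.
move=> unbounded [n [h hE]]; have [ginj grange] := overring_normalization.
have hg j : exists v, g v = h j.
  have : @normalization R (h j).
    rewrite hE; exists (fun l => (l == j)%:R).
    rewrite (bigD1 j) //= eqxx tofrac1 mul1r big1 ?addr0 // => l /negbTE ->.
    by rewrite tofrac0 mul0r.
  by rewrite -grange => -[v _ <-]; exists v.
have [w wE] := choice hg.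
have [N HN] := choice (fun j => i_conductor (w j)).
pose M := \max_j N j; have [v nv] := unbounded M.
have : @normalization R (g v) by rewrite -grange; exists v.
rewrite hE => -[a gva].
have vE : v = \sum_j i (a j) * w j.
  apply: ginj; apply: etrans gva _; rewrite [RHS]rmorph_sum.
  apply: eq_bigr => j _.
  by rewrite [RHS]rmorphM /= wE fraction_embedding_val.
have [r rE] := choice (fun j => HN j M (leq_bigmax j)).
apply: (nv (\sum_j a j * r j)); rewrite vE rmorph_sum mulr_sumr.
by apply: eq_bigr => j _; rewrite rmorphM rE mulrCA.
Qed.

Theorem overring_bad_stable :
  (forall N, exists v, forall r, i r <> t ^+ N * v) -> bad_stable_domain R.
Proof.
move=> unbounded; split.
- exact: overring_krull.
- by exists overring_max; apply: overring_local.
- exact: overring_stable.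
- exact: overring_not_finite.
Qed.

End QuadraticOverring.

(** * The elements at which a derivation is integral *)

Section Subdomain.
Variables (V : idomainType) (S : set V).

(** The inverse of a nonunit is the nonunit itself, so that the last condition
    asks no more than the inverses of elements of S that exist in V. *)
Definition division_subring :=
  [/\ S 1, forall x y, S x -> S y -> S (x - y) & forall x y, S x -> S y -> S (x / y)].
Hypothesis HS : division_subring.

Definition subdomain_pred of division_subring : {pred V} := fun x => x \in S.
Definition subdomain := {x | subdomain_pred HS x}.
HB.instance Definition _ := [isSub of subdomain for (@sval _ _)].
HB.instance Definition _ := [Choice of subdomain by <:].

Lemma subdomain_closed : divring_closed (subdomain_pred HS).
Proof.
case: (HS) => S1 SB SM; split=> [|x y /set_mem Sx /set_mem Sy|x y /set_mem Sx /set_mem Sy].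
- exact/mem_set.
- exact/mem_set/SB.
- exact/mem_set/SM.
Qed.
HB.instance Definition _ :=
  GRing.isDivringClosed.Build V (subdomain_pred HS) subdomain_closed.
HB.instance Definition _ := [SubChoice_isSubIntegralDomain of subdomain by <:].

Lemma subdomainP (x : subdomain) : S (val x). Proof. exact: set_mem (valP x). Qed.
Lemma subdomain_lift v : S v -> exists x : subdomain, val x = v.
Proof. by move=> Sv; exists (Sub v (mem_set Sv)). Qed.

End Subdomain.

Section FiniteSpanning.
Variable k : fieldType.

Lemma finite_spanning m (W : set 'rV[k]_m) :
  exists (r : nat) (w : 'I_r -> 'rV[k]_m), (forall i, W (w i)) /\
    forall x, W x -> exists c : 'I_r -> k, x = \sum_i c i *: w i.
Proof.
pose P n := `[< exists (r : nat) (w : 'I_r -> 'rV[k]_m),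
  (forall i, W (w i)) /\ \rank (\matrix_i w i) = n >].
have exP : exists n, P n.
  exists 0%N; apply/asboolP; exists 0%N, (fun=> 0); split; first by case.
  by apply/eqP; rewrite -leqn0 rank_leq_row.
have [|n /asboolP[r [w [Ww rk]]] nmax] := @ex_maxnP P m exP.
  by move=> n /asboolP[r [w [_ <-]]]; apply: rank_leq_col.
exists r, w; split=> // x Wx.
pose w' (i : 'I_r.+1) := if unlift ord0 i is Some j then w j else x.
have /nmax : P (\rank (\matrix_i w' i)).
  apply/asboolP; exists r.+1, w'; split=> // i.
  by rewrite /w'; case: unlift.
rewrite -rk => le'.
have sub : (\matrix_i w i <= \matrix_i w' i)%MS.
  apply/row_subP => i; rewrite rowK.
  have -> : w i = row (lift ord0 i) (\matrix_i w' i) by rewrite rowK /w' liftK.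
  exact: row_sub.
have /row_subP/(_ ord0) : (\matrix_i w' i <= \matrix_i w i)%MS.
  by rewrite -(geq_leqif (mxrank_leqif_sup sub)).
rewrite rowK {1}/w' unlift_none => /submxP[c xE].
exists (fun i => c 0 i); rewrite xE mulmx_sum_row.
by apply: eq_bigr => i _; rewrite rowK.
Qed.

End FiniteSpanning.

Section TwistedRing.
Variables (V : idomainType) (t : V).
Hypothesis unift : uniformizer t.
Local Notation F := {fraction V}.
Local Notation frac := (@tofrac V).
Local Notation tpow := (tpow t).
Variable D : F -> {poly F}.
Hypothesis isD : derivation D.
Hypothesis Dt : D (frac t) = 0.
Hypothesis Ddense : forall x, exists a y, D (frac a) = 0 /\ x = a + t * y.
Variable x_ : nat -> V.
Hypothesis Dx : forall n, (D (frac (x_ n)))`_n = 1 /\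
  forall i, (n < i)%N -> (D (frac (x_ n)))`_i = 0.

Definition integral : set F := range frac.
Local Notation intg := integral.

Lemma intg_subring : subring intg. Proof. exact: subring_range. Qed.
Lemma intg_frac x : intg (frac x). Proof. by exists x. Qed.

Definition component (i : nat) (x : V) : F := (D (frac x))`_i.
Local Notation d := component.

Lemma dD i x y : d i (x + y) = d i x + d i y.
Proof. by rewrite /component tofracD (derD isD) coefD. Qed.
Lemma dB i x y : d i (x - y) = d i x - d i y.
Proof. by rewrite /component tofracB (derB isD) coefB. Qed.
Lemma dM i x y : d i (x * y) = frac x * d i y + frac y * d i x.
Proof. by rewrite /component tofracM (derM isD) coefD !coefZ. Qed.
Lemma d_ker i a : D (frac a) = 0 -> d i a = 0.
Proof. by rewrite /component => ->; rewrite coef0. Qed.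
Lemma d_kerM i a x : D (frac a) = 0 -> d i (a * x) = frac a * d i x.
Proof. by move=> Da; rewrite dM (d_ker _ Da) mulr0 addr0. Qed.
Lemma d_sum i (I : Type) (r : seq I) (E : I -> V) :
  d i (\sum_(j <- r) E j) = \sum_(j <- r) d i (E j).
Proof. by rewrite /component rmorph_sum (der_sum isD) coef_sum. Qed.
Lemma DtX n : D (frac (t ^+ n)) = 0.
Proof. by rewrite tofracXn; apply: derX. Qed.
Lemma d_tX i n x : d i (t ^+ n * x) = frac t ^+ n * d i x.
Proof. by rewrite d_kerM ?DtX // tofracXn. Qed.
Lemma d0 i : d i 0 = 0. Proof. by rewrite /component tofrac0 (der0 isD) coef0. Qed.

Lemma ker_dense n x : exists a y, D (frac a) = 0 /\ x = a + t ^+ n * y.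
Proof.
elim: n => [|n [a [y [Da ->]]]].
  by exists 0, x; rewrite tofrac0 (der0 isD) expr0 mul1r add0r.
have [b [z [Db ->]]] := Ddense y; exists (a + t ^+ n * b), z; split.
  by rewrite tofracD tofracM (derD isD) (derM isD) Da Db DtX !scaler0 !addr0.
by rewrite exprSr; ring.
Qed.

(** A common denominator exists because each value of D is a polynomial. *)
Lemma d_bounded x : exists N, forall n, (N <= n)%N -> forall i, intg (frac t ^+ n * d i x).
Proof.
have [N HN] := choice (fun i => fraction_tpow unift (d i x)).
pose P := D (frac x); exists (\max_(i < size P) N i)%N => n len i.
have [lti|gei] := ltnP i (size P); last first.
  by rewrite /component nth_default // mulr0; apply: subring0 intg_subring.
have [v vE] := HN i; have lei : (N i <= n)%N.
  by apply: leq_trans len; apply: (leq_bigmax (Ordinal lti)).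
exists (t ^+ (n - N i) * v) => //.
by rewrite tofracM -vE tofracXn [d _ _ * _]mulrC mulrA -exprD subnK.
Qed.

(** Write x_i = b + t^N z with D b = 0. Then the ith component of D z is t^-N
    and those of higher index vanish; multiplying z by a constant of D close
    to t^N c gives an x for which only the components of lower index may fail
    to be integral, and these are corrected by induction. *)
Lemma d_full i (c : F) : exists x, intg (d i x - c) /\
  forall j, j != i -> intg (d j x).
Proof.
elim/ltn_ind: i c => i IH c.
have [N [v vE]] := fraction_tpow unift c.
have tN0 : frac t ^+ N != 0 by rewrite expf_neq0 // tofrac_eq0 (t_neq0 unift).
have [a [w [Da av]]] := ker_dense N v.
have [b [z [Db bz]]] := ker_dense N (x_ i).
(* the tail z of x_i has derivative t^-N times that of x_i *)
have dz j : frac t ^+ N * d j z = d j (x_ i).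
  by rewrite -d_tX bz dD (d_ker _ Db) add0r.
have [Di1 Di0] := Dx i.
have [y Hy] : exists y : nat -> V, forall j, (j < i)%N ->
    intg (d j (y j) - d j (a * z)) /\ forall l, l != j -> intg (d l (y j)).
  have [y Hy] := choice (fun j : 'I_i => IH j (ltn_ord j) (d j (a * z))).
  exists (fun j => if insub j is Some o then y o else 0) => j ltji.
  by rewrite insubT; apply: (Hy (Sub j ltji)).
exists (a * z - \sum_(j < i) y j).
have sumint (P : pred 'I_i) (l : nat) : (forall j : 'I_i, P j -> l != j) ->
    intg (\sum_(j < i | P j) d l (y j)).
  move=> H; apply: (subring_sum intg_subring) => j Pj.
  by have [_] := Hy j (ltn_ord j); apply; apply: H.
split=> [|j jni].
  rewrite dB d_sum addrAC; apply: (subringB intg_subring); last first.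
    by apply: (sumint xpredT) => j _; rewrite neq_ltn ltn_ord orbT.
  exists (- w) => //; apply: (mulfI tN0).
  rewrite mulrBr d_kerM // mulrCA dz [d i _]Di1 mulr1 [_ * c]mulrC vE av.
  by rewrite tofracD tofracM tofracXn tofracN mulrN opprD addNKr.
rewrite dB d_sum; have [ltij|ltji|eji] := ltngtP i j; last by rewrite eji eqxx in jni.
  rewrite d_kerM //; apply: (subringB intg_subring); last first.
    by apply: (sumint xpredT) => l _; rewrite neq_ltn (ltn_trans (ltn_ord l) ltij) orbT.
  suff -> : d j z = 0 by rewrite mulr0; apply: subring0 intg_subring.
  by apply: (mulfI tN0); rewrite dz mulr0; apply: Di0.
rewrite (bigD1 (Ordinal ltji)) //= opprD addrA.
apply: (subringB intg_subring); last first.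
  by apply: sumint => l; apply: contraNneq => jl; apply/eqP/val_inj.
rewrite -opprB; apply: (subringN intg_subring).
by have [] := Hy j ltji.
Qed.

Section Subring.
Variable J : pred nat.

Definition twisted : set V := [set x | forall i, J i -> intg (d i x)].

Lemma twisted_division : division_subring twisted.
Proof.
have intgM := subringM intg_subring; have intgB := subringB intg_subring.
have d1 i : d i 1 = 0 by rewrite /component tofrac1 (der1 isD) coef0.
split=> [i _|x y Rx Ry i Ji|x y Rx Ry i Ji].
- by rewrite d1; apply: subring0 intg_subring.
- by rewrite dB; apply: intgB; [apply: Rx | apply: Ry].
have [uy|nuy] := boolP (y \is a GRing.unit); last first.
  rewrite invr_out // dM; apply: (subringD intg_subring); apply: intgM => //.
  - exact: intg_frac.
  - exact: Ry.
  - exact: intg_frac.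
  - exact: Rx.
have -> : d i (x / y) = frac y^-1 * (d i x - frac (x / y) * d i y).
  have -> : d i x = frac (x / y) * d i y + frac y * d i (x / y).
    by rewrite -dM divrK.
  by rewrite addrAC subrr add0r mulrA -tofracM mulVr // tofrac1 mul1r.
apply: (intgM); first exact: intg_frac.
apply: intgB; first exact: Rx.
by apply: intgM; [apply: intg_frac | apply: Ry].
Qed.

Definition twisted_ring : idomainType := subdomain twisted_division.
Local Notation R := twisted_ring.
Definition twisted_val : {rmorphism R -> V} := [the {rmorphism R -> V} of val].
Local Notation i := twisted_val.

Lemma twistedP (r : R) : twisted (i r). Proof. exact: subdomainP. Qed.
Lemma twisted_lift v : twisted v -> exists r : R, i r = v.
Proof. exact: subdomain_lift. Qed.
Lemma twisted_inj : injective i. Proof. exact: val_inj. Qed.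
Lemma twisted_ker a : D (frac a) = 0 -> twisted a.
Proof. by move=> Da j _; rewrite d_ker //; apply: subring0 intg_subring. Qed.

Lemma twisted_unit (r : R) : i r \is a GRing.unit -> exists s, s * r = 1.
Proof.
move=> ur; have [R1 _ Rdiv] := twisted_division.
have [s sE] := twisted_lift (Rdiv _ _ R1 (twistedP r)).
by exists s; apply: twisted_inj; rewrite rmorphM rmorph1 sE mul1r mulVr.
Qed.

Lemma twisted_conductor v :
  exists N, forall n, (N <= n)%N -> exists r, i r = t ^+ n * v.
Proof.
have [N HN] := d_bounded v; exists N => n len.
by apply: twisted_lift => j _; rewrite d_tX; apply: HN.
Qed.

(** Approximating a and b by constants a0 and b0 of D, all terms of
    ab = b0 a + a0 b - a0 b0 + (a - a0)(b - b0) but the last are evidently in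
    Ra + Rb + R, and D takes integral values at the last. *)
Lemma twisted_quadratic a b : exists r s u, a * b = i r * a + i s * b + i u.
Proof.
have [N HN] := d_bounded a; have [M HM] := d_bounded b.
set n := maxn N M.
have [a0 [a' [Da aE]]] := ker_dense n a; have [b0 [b' [Db bE]]] := ker_dense n b.
have [r rE] := twisted_lift (twisted_ker Db).
have [s sE] := twisted_lift (twisted_ker Da).
have [|u uE] := @twisted_lift ((a - a0) * (b - b0) - a0 * b0).
  move=> j _; rewrite dB; apply: (subringB intg_subring); last first.
    by rewrite d_kerM // (d_ker _ Db) mulr0; apply: subring0 intg_subring.
  rewrite dM !dB (d_ker _ Da) (d_ker _ Db) !subr0.
  rewrite [in frac (a - _)]aE [in frac (b - _)]bE ![_ + _ - _]addrAC !subrr !add0r.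
  rewrite !tofracM tofracXn.
  apply: (subringD intg_subring); rewrite mulrAC mulrC.
    apply: (subringM intg_subring); first exact: intg_frac.
    by apply: HM; apply: leq_maxr.
  apply: (subringM intg_subring); first exact: intg_frac.
  by apply: HN; apply: leq_maxl.
by exists r, s, u; rewrite rE sE uE; ring.
Qed.

Lemma twisted_unbounded j : J j ->
  forall N, exists v, forall r, i r <> t ^+ N * v.
Proof.
move=> Jj N; have tN0 : frac t != 0 by rewrite tofrac_eq0 (t_neq0 unift).
have [v [[w _ wE] _]] := d_full j (frac t ^- N.+1); exists v => r rE.
have := twistedP r Jj; rewrite rE d_tX => -[z _ zE].
have : tpow 1 1.
  exists (z - t ^+ N * w); apply/eqP; rewrite -tofrac_eq tofracM tofracB tofracM.
  rewrite wE zE !tofracXn tofrac1 expr1 mulrBr -!mulrBr subKr mulrA -exprS.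
  by rewrite mulfV // expf_neq0.
by rewrite tpow1_nonunit // unitr1.
Qed.

Definition twisted_embedding : {rmorphism V -> {fraction R}} :=
  [the {rmorphism V -> {fraction R}} of fraction_embedding twisted_inj
     (overring_frac unift twisted_inj twisted_conductor)].

Lemma twisted_normalization : is_normalization twisted_embedding.
Proof.
exact: (overring_normalization unift twisted_inj twisted_conductor twisted_quadratic).
Qed.

Lemma twisted_bad_stable j : J j -> bad_stable_domain R.
Proof.
move=> Jj; apply: (overring_bad_stable unift twisted_inj) => //.
- exact: twisted_unit.
- exact: twisted_conductor.
- exact: twisted_quadratic.
- exact: twisted_unbounded Jj.
Qed.

Lemma twisted_local : the_maximal_ideal (overring_max i t).
Proof. by apply: overring_local => //; apply: twisted_unit. Qed.

(** The product of t with an element whose jth component is close to 1 / t and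
    whose other components are integral. *)
Lemma dual_element j : exists r : R, [/\ overring_max i t r,
  exists z, d j (i r) = frac (1 + t * z) &
  forall l, l != j -> exists w, d l (i r) = frac (t * w)].
Proof.
have t0 : frac t != 0 by rewrite tofrac_eq0 (t_neq0 unift).
have [y [[z _ zE] yV]] := d_full j (frac t)^-1.
have dty l : d l (t * y) = frac t * d l y by rewrite -(expr1 t) d_tX !expr1.
have dj : d j (t * y) = frac (1 + t * z).
  by rewrite dty tofracD tofracM zE tofrac1 mulrBr mulfV // addrC subrK.
have dl l : l != j -> exists w, d l (t * y) = frac (t * w).
  by move=> /yV[w _ wE]; exists w; rewrite dty tofracM wE.
have [|r rE] := @twisted_lift (t * y).
  move=> l _; have [->|/dl[w ->]] := eqVneq l j; last exact: intg_frac.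
  by rewrite dj; apply: intg_frac.
exists r; rewrite rE; split=> //; last by exists z.
by exists y; rewrite expr1; apply: rE.
Qed.

End Subring.

Section Residue.
Variables (k : fieldType) (res : {rmorphism V -> k}).
Hypothesis res_onto : residue_map res.
Implicit Types v : V.

Lemma res_eq0 v : res v = 0 <-> tpow 1 v.
Proof.
split=> [v0|tv].
  apply/(tpow1_nonunit unift); apply/negP => /divrr /(congr1 res).
  by rewrite rmorphM v0 mul0r rmorph1 => /eqP; rewrite eq_sym oner_eq0.
apply/eqP/negPn/negP => v0.
have [w _ wE] : range res (res v)^-1 by rewrite res_onto.
have : tpow 1 (v * w - 1).
  apply/(tpow1_nonunit unift); apply/negP => /divrr /(congr1 res).
  rewrite rmorphM rmorphB rmorphM wE rmorph1 mulfV // subrr mul0r => /eqP.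
  by rewrite eq_sym oner_eq0.
move/(tpowB (tpowMr w tv)); rewrite opprB addrC subrK.
by rewrite tpow1_nonunit // unitr1.
Qed.

Lemma ker_lift (c : k) : exists a, D (frac a) = 0 /\ res a = c.
Proof.
have [v _ <-] : range res c by rewrite res_onto.
have [a [y [Da ->]]] := Ddense v; exists a; split=> //.
by rewrite rmorphD (res_eq0 (t * y)).2 ?addr0 //; exists y; rewrite expr1.
Qed.

Definition dval j v : V := xget 0 [set w | frac w = d j v].
Lemma dvalE j v : intg (d j v) -> frac (dval j v) = d j v.
Proof.
move=> [w _ wE].
exact: (@xgetPex _ 0 [set w | frac w = d j v] (ex_intro _ w wE)).
Qed.
Lemma dval_uniq j v w : d j v = frac w -> dval j v = w.
Proof.
move=> E; apply/eqP; rewrite -tofrac_eq; apply/eqP.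
by rewrite dvalE // E; apply: intg_frac.
Qed.

Section Finite.
Variable n : nat.
Local Notation J := (fun j => (j < n)%N).
Local Notation R := (twisted_ring J).
Local Notation i := (twisted_val J).
Implicit Types r s : R.

Let tau_ex : exists r, i r = t.
Proof. by apply/twisted_lift/twisted_ker. Qed.
Let tau := sval (cid tau_ex).
Let tauE : i tau = t. Proof. exact: svalP (cid tau_ex). Qed.

Let Rint r (j : 'I_n) : intg (d j (i r)). Proof. exact: twistedP. Qed.

Lemma ker_liftR c : exists r, (forall j, d j (i r) = 0) /\ res (i r) = c.
Proof.
have [a [Da ac]] := ker_lift c; have [r rE] := twisted_lift (@twisted_ker J _ Da).
by exists r; rewrite rE; split=> // j; apply: d_ker.
Qed.

Lemma tau_divides r : tpow 1 (i r) -> (forall j : 'I_n, res (dval j (i r)) = 0) ->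
  exists s, r = tau * s.
Proof.
move=> [y yE] dr.
have [|s sE] := @twisted_lift J y.
  move=> j ltj; have := dr (Ordinal ltj) => /= /res_eq0[z zE].
  exists z => //; have := dvalE (Rint r (Ordinal ltj)); rewrite zE yE d_tX /=.
  rewrite tofracM tofracXn => /mulfI; apply.
  by rewrite expr1 tofrac_eq0 (t_neq0 unift).
by exists s; apply: twisted_inj; rewrite rmorphM sE tauE yE.
Qed.

(** The coordinates of r in the finite-dimensional space R / tau R. *)
Definition symbol r : 'rV[k]_(n.+1) :=
  \row_l (if unlift ord0 l is Some j then res (dval j (i r)) else res (i r)).

Lemma dvalB (j : 'I_n) r s : dval j (i (r - s)) = dval j (i r) - dval j (i s).
Proof. by apply: dval_uniq; rewrite rmorphB dB tofracB !dvalE. Qed.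
Lemma dvalM (j : 'I_n) r s :
  dval j (i (r * s)) = i r * dval j (i s) + i s * dval j (i r).
Proof. by apply: dval_uniq; rewrite rmorphM dM tofracD !tofracM !dvalE. Qed.
Lemma dval_kerR (j : 'I_n) r : d j (i r) = 0 -> dval j (i r) = 0.
Proof. by move=> E; apply: dval_uniq; rewrite E tofrac0. Qed.

Lemma symbolB r s : symbol (r - s) = symbol r - symbol s.
Proof.
apply/rowP => l; rewrite !mxE; case: unlift => [j|]; last by rewrite !rmorphB.
by rewrite dvalB rmorphB.
Qed.
Lemma symbol0 : symbol 0 = 0.
Proof. by have := symbolB 0 0; rewrite !subrr. Qed.
Lemma symbolD r s : symbol (r + s) = symbol r + symbol s.
Proof. by rewrite -{1}[s]opprK -[- s]sub0r !symbolB symbol0 sub0r opprK. Qed.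
Lemma symbolZ a r : (forall j, d j (i a) = 0) -> symbol (a * r) = res (i a) *: symbol r.
Proof.
move=> Da; apply/rowP => l; rewrite !mxE; case: unlift => [j|]; last by rewrite !rmorphM.
by rewrite dvalM (dval_kerR (Da j)) mulr0 addr0 rmorphM.
Qed.
Lemma symbol_sum (I : Type) (q : seq I) (f : I -> R) :
  symbol (\sum_(l <- q) f l) = \sum_(l <- q) symbol (f l).
Proof.
exact: (big_morph symbol symbolD symbol0).
Qed.
Lemma symbol_eq0 r : symbol r = 0 -> exists s, r = tau * s.
Proof.
move=> /rowP E; apply: tau_divides => [|j].
  by apply/res_eq0; have := E ord0; rewrite !mxE unlift_none.
by have := E (lift ord0 j); rewrite !mxE liftK.
Qed.

(** An ideal is determined up to finitely many generators by its colon ideal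
    by tau, because the symbol embeds R / tau R in a finite-dimensional space. *)
Lemma colon_fg I m : is_ideal I -> generated_by_n [set r | I (tau * r)] m ->
  exists m', generated_by_n I m'.
Proof.
move=> idI [h hE]; have [I0 ID IM] := idI.
have [q [w [Iw wspan]]] := finite_spanning [set symbol r | r in I].
have gex l : exists r, I r /\ symbol r = w l by have [r Ir rE] := Iw l; exists r.
have [g gE] := choice gex.
pose S := [seq g l | l <- enum 'I_q] ++ [seq tau * h l | l <- enum 'I_m].
exists (size S); apply: generated_by_seq => // x.
  rewrite mem_cat => /orP[] /mapP[l _ ->]; first by have [] := gE l.
  suff : [set r | I (tau * r)] (h l) by [].
  by rewrite hE; apply: sub_ideal_span; exists l.
move=> Ix; have [c xc] := wspan _ (ex_intro2 _ _ x Ix erefl).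
have [a aE] := choice (fun l => ker_liftR (c l)).
have [|y yE] := @symbol_eq0 (x - \sum_l a l * g l).
  rewrite symbolB symbol_sum xc; apply/eqP; rewrite subr_eq0; apply/eqP.
  apply: eq_bigr => l _; have [Da ac] := aE l.
  by rewrite symbolZ // ac; have [_ ->] := gE l.
have : [set r | I (tau * r)] y.
  rewrite /= -yE; apply: (idealB idI) => //; apply: ideal_sum => // l _.
  by apply: IM; have [] := gE l.
rewrite hE => /ideal_span_range[b yb].
have [J0 JD JM] := ideal_span_ideal [set` S].
rewrite -(subrK (\sum_l a l * g l) x) yE yb; apply: JD.
  rewrite mulr_sumr; apply: ideal_sum => [|l _]; first exact: ideal_span_ideal.
  rewrite mulrCA; apply: JM; apply: sub_ideal_span => /=.
  by rewrite mem_cat; apply/orP; right; apply/mapP; exists l; rewrite ?mem_enum.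
apply: ideal_sum => [|l _]; first exact: ideal_span_ideal.
apply: JM; apply: sub_ideal_span => /=.
by rewrite mem_cat; apply/orP; left; apply/mapP; exists l; rewrite ?mem_enum.
Qed.

(** A nonzero ideal contains a power of tau, and the colon ideal by tau
    contains a lower one. *)
Lemma twisted_noetherian : noetherian R.
Proof.
move=> I idI; have [I0 ID IM] := idI.
have [[x [Ix x0]]|Iz] := pselect (exists x, I x /\ x != 0); last first.
  exists 0%N; apply: (@generated_by_seq _ _ [::]) => // x Ix.
  have [->|x0] := eqVneq x 0; last by case: Iz; exists x.
  by case: (ideal_span_ideal [set` [::] : seq R]).
have [N HN] := small_multiple unift (@twisted_inj J) (@twisted_conductor J) 1 x0.
have [r rE] := HN N (leqnn N).
have : I (tau ^+ N).
  suff -> : tau ^+ N = r * x by apply: IM.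
  by apply: twisted_inj; rewrite rE mulr1 rmorphXn tauE.
elim: N I idI {I0 ID IM Ix HN rE} => [|N IH] I idI It.
  exists 1%N; apply: (@generated_by_seq _ _ [:: 1]) => // [y|y _].
    by rewrite inE => /eqP ->.
  have [_ _ M] := ideal_span_ideal [set` [:: 1 : R]].
  rewrite -(mulr1 y); apply: M; apply: sub_ideal_span. by rewrite /= inE.
have [I0 ID IM] := idI.
have [||m gm] := IH [set r | I (tau * r)].
- split=> [|y z|a y] /=; first by rewrite mulr0.
    by rewrite mulrDr; apply: ID.
  by rewrite mulrCA; apply: IM.
- by rewrite /= -exprS.
exact: colon_fg gm.
Qed.

Local Notation mR := (overring_max i t).

Lemma tau_max : mR tau.
Proof. by exists 1; rewrite expr1 mulr1; apply: tauE. Qed.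

Lemma dual_generator (j : 'I_n) : exists r, mR r /\
  forall l : 'I_n, res (dval l (i r)) = (l == j)%:R.
Proof.
have res_t w : res (t * w) = 0 by apply/res_eq0; exists w; rewrite expr1.
have [r [mr [z rj] rl]] := dual_element J j; exists r; split=> // l.
have [->|nlj] := eqVneq l j; first by rewrite (dval_uniq rj) rmorphD rmorph1 res_t addr0.
have [w wE] := rl l nlj; by rewrite (dval_uniq wE) res_t.
Qed.

Lemma max_generated : generated_by_n mR n.+1.
Proof.
have idm : is_ideal mR by apply: overring_max_ideal.
have [g gE] := choice dual_generator.
pose S := tau :: [seq g j | j <- enum 'I_n].
have -> : n.+1 = size S by rewrite /= size_map size_enum_ord.
apply: generated_by_seq => // [x|x mx].
  rewrite inE => /orP[/eqP ->|/mapP[j _ ->]]; first exact: tau_max.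
  by have [] := gE j.
have [a aE] := choice (fun j : 'I_n => ker_liftR (res (dval j (i x)))).
have spang : ideal_span [set` S] (\sum_j a j * g j).
  apply: ideal_sum => [|j _]; first exact: ideal_span_ideal.
  have [_ _] := ideal_span_ideal [set` S]; apply; apply: sub_ideal_span => /=.
  by rewrite inE; apply/orP; right; apply/mapP; exists j; rewrite ?mem_enum.
have [||y yE] := @tau_divides (x - \sum_j a j * g j).
- apply: (idealB idm) => //; apply: ideal_sum => // j _.
  by case: idm => _ _; apply; have [] := gE j.
- move=> l; rewrite dvalB rmorphB.
  have dval0 (q : 'I_n) : dval q (i 0) = 0.
    by apply: dval_uniq; rewrite rmorph0 d0 tofrac0.
  have dvalD (q : 'I_n) : {morph (fun r => dval q (i r)) : r s / r + s}.
    move=> r s; apply: dval_uniq.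
    by rewrite rmorphD dD tofracD !dvalE.
  rewrite (big_morph _ (dvalD l) (dval0 l)) rmorph_sum (bigD1 l) //= big1 ?addr0.
    have [Da ac] := aE l; have [_ gl] := gE l.
    by rewrite dvalM (dval_kerR (Da l)) mulr0 addr0 rmorphM ac gl eqxx mulr1 subrr.
  move=> j njl; have [Da ac] := aE j; have [_ gj] := gE j.
  by rewrite dvalM (dval_kerR (Da l)) mulr0 addr0 rmorphM gj eq_sym (negbTE njl) mulr0.
rewrite -(subrK (\sum_j a j * g j) x) yE.
have [_ JD JM] := ideal_span_ideal [set` S]; apply: JD => //.
by rewrite mulrC; apply: JM; apply: sub_ideal_span; rewrite /= mem_head.
Qed.

Definition tquo v : V := xget 0 [set y | v = t * y].
Lemma tquoE v y : v = t * y -> tquo v = y.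
Proof.
move=> vy; apply: (mulfI (t_neq0 unift)); rewrite -vy.
by have /esym := @xgetPex _ 0 [set y | v = t * y] (ex_intro _ y vy).
Qed.

(** The residues of r / t and of the D_j r are linear forms on the cotangent
    space of R, and together separate it. *)
Definition cotangent r : 'rV[k]_(n.+1) :=
  \row_l (if unlift ord0 l is Some j then res (dval j (i r)) else res (tquo (i r))).

Lemma cotangentD r s : mR r -> mR s -> cotangent (r + s) = cotangent r + cotangent s.
Proof.
move=> [y yE] [z zE]; rewrite expr1 in yE zE.
apply/rowP => l; rewrite !mxE; case: unlift => [j|].
  rewrite -rmorphD; congr (res _); apply: dval_uniq.
  by rewrite rmorphD dD tofracD !dvalE.
by rewrite -rmorphD (tquoE yE) (tquoE zE) (@tquoE _ (y + z)) // rmorphD yE zE mulrDr.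
Qed.

Lemma cotangentZ a r : mR r -> cotangent (a * r) = res (i a) *: cotangent r.
Proof.
move=> mr; have [y yE] := mr; rewrite expr1 in yE.
apply/rowP => l; rewrite !mxE; case: unlift => [j|].
  by rewrite dvalM rmorphD !rmorphM (res_eq0 (i r)).2 // mul0r addr0.
by rewrite -rmorphM (tquoE yE) (@tquoE _ (i a * y)) // rmorphM yE mulrCA.
Qed.

Lemma cotangent_sum q (a g : 'I_q -> R) : (forall l, mR (g l)) ->
  cotangent (\sum_l a l * g l) = \sum_l res (i (a l)) *: cotangent (g l).
Proof.
move=> mg; have idm : is_ideal mR by apply: overring_max_ideal.
suff [] : mR (\sum_l a l * g l) /\
  cotangent (\sum_l a l * g l) = \sum_l res (i (a l)) *: cotangent (g l) by [].
have [m0 mD mM] := idm; elim/big_rec2: _ => [|l y x _ [mx xy]].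
  split=> //; rewrite -(mulr0 0) cotangentZ //.
  by rewrite rmorph0 rmorph0 scale0r.
have ml : mR (a l * g l) by apply: mM.
by split; [apply: mD | rewrite cotangentD // cotangentZ // xy].
Qed.

Lemma cotangent_onto (l : 'I_(n.+1)) :
  exists r, mR r /\ cotangent r = delta_mx 0 l.
Proof.
have idm : is_ideal mR by apply: overring_max_ideal.
have tau0 : cotangent tau = delta_mx 0 ord0.
  apply/rowP => h; rewrite !mxE; case: unliftP => [j|] ->; last first.
    by rewrite eqxx tauE (@tquoE _ 1) ?mulr1 // rmorph1.
  rewrite lift_eqF andbF.
  by rewrite tauE (@dval_uniq _ _ 0) ?rmorph0 // (d_ker _ Dt).
case: (unliftP ord0 l) => [j|] ->; last by exists tau; split=> //; apply: tau_max.
have [g [mg gE]] := dual_generator j.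
have [a [Da ac]] := ker_liftR (- res (tquo (i g))).
have [m0 mD mM] := idm; have mt := tau_max.
exists (g + a * tau); split; first by apply: mD => //; apply: mM.
rewrite cotangentD ?cotangentZ //; last exact: mM.
rewrite tau0 ac; apply/rowP => h; rewrite !mxE.
case: (unliftP ord0 h) => [q|] ->.
  by rewrite gE lift_eqF mulr0 addr0 eqxx (inj_eq lift_inj).
by rewrite !eqxx mulr1 addrN eq_liftF.
Qed.

(** The cotangent map carries q generators of the maximal ideal to generators
    of a space of dimension n + 1. *)
Theorem twisted_embedding_dimension : embedding_dimension R n.+1.
Proof.
exists mR; split; first exact: twisted_local.
  exact: max_generated.
move=> q [g mg]; have mgl l : mR (g l) by rewrite mg; apply: sub_ideal_span; exists l.
have [x xE] := choice cotangent_onto.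
have aex l : exists a : 'I_q -> R, x l = \sum_h a h * g h.
  by apply: ideal_span_range; rewrite -mg; have [] := xE l.
have [a aE] := choice aex.
pose A := \matrix_(l < n.+1, h < q) res (i (a l h)).
pose B := \matrix_(h < q) cotangent (g h).
have AB : A *m B = 1%:M.
  apply/row_matrixP => l; rewrite row_mul row1 mulmx_sum_row.
  have [_ <-] := xE l; rewrite aE cotangent_sum //.
  by apply: eq_bigr => h _; rewrite rowK !mxE.
by have := mxrankM_maxr A B; rewrite AB mxrank1 => /leq_trans; apply; apply: rank_leq_row.
Qed.

End Finite.
End Residue.

(** The value of D at a generator involves finitely many indices. If finitely
    many elements generated the maximal ideal, the component of D at a large
    index would map it into the maximal ideal of V, against the abundance of
    values of D. *)
Lemma twisted_not_noetherian : ~ noetherian (twisted_ring predT).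
Proof.
set i := twisted_val predT => noeth.
have idm : is_ideal (overring_max i t) by apply: overring_max_ideal.
have [q [g gE]] := noeth _ idm.
have gm l : overring_max i t (g l) by rewrite gE; apply: sub_ideal_span; exists l.
(* all generators have derivative zero at a large index j *)
pose j := (\max_(l < q) size (D (frac (i (g l)))))%N.
have dg l : d j (i (g l)) = 0.
  by rewrite /component nth_default //; apply: (leq_bigmax l).
have [r [mr [z dj] _]] := dual_element predT j.
move: mr.
rewrite gE => /ideal_span_range[a ra].
have wex l : exists w, frac w = d j (i (a l)).
  by have [w _ wE] := twistedP (a l) (isT : predT j); exists w.
have [w wE] := choice wex.
have : tpow 1 (1 + t * z).
  suff -> : 1 + t * z = \sum_l i (g l) * w l.
    by apply: tpow_sum => l _; apply: tpowMr; apply: gm.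
  apply/eqP; rewrite -tofrac_eq -dj ra rmorph_sum d_sum rmorph_sum; apply/eqP.
  apply: eq_bigr => l _; rewrite !rmorphM dM dg mulr0 add0r.
  by congr (_ * _); apply/esym/wE.
have tz : tpow 1 (t * z) by exists z; rewrite expr1.
by move/tpowB => /(_ _ tz); rewrite addrK tpow1_nonunit // unitr1.
Qed.

End TwistedRing.

(** * From derivations to bad stable domains *)

Definition bad_domains_exist (V : idomainType) :=
  (forall d : nat, (1 < d)%N ->
     exists (R : idomainType) (g : {rmorphism V -> {fraction R}}),
       [/\ bad_stable_domain R, noetherian R, embedding_dimension R d &
           is_normalization g]) /\
  (exists (R : idomainType) (g : {rmorphism V -> {fraction R}}),
     [/\ bad_stable_domain R, ~ noetherian R & is_normalization g]).

Section Construction.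
Variables (V : idomainType) (k : fieldType) (res : {rmorphism V -> k}) (t : V).
Hypotheses (unift : uniformizer t) (res_onto : residue_map res).
Local Notation F := {fraction V}.
Local Notation frac := (@tofrac V).
Local Notation tpow := (tpow t).

Theorem bad_domains_of_derivation (D : F -> {poly F}) (x : nat -> V) :
  derivation D -> D (frac t) = 0 ->
  (forall c, exists2 a, D (frac a) = 0 & res a = c) ->
  (forall n, (D (frac (x n)))`_n = 1 /\ forall i, (n < i)%N -> (D (frac (x n)))`_i = 0) ->
  bad_domains_exist V.
Proof.
move=> isD Dt Dres Dx.
have Ddense v : exists a y, D (frac a) = 0 /\ v = a + t * y.
  have [a Da ac] := Dres (res v); have [|y yE] := (res_eq0 unift res_onto (v - a)).1.
    by rewrite rmorphB ac subrr.
  by exists a, y; split=> //; rewrite -(expr1 t) -yE addrC subrK.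
have bad J := @twisted_bad_stable _ _ unift _ isD Dt Ddense _ Dx J 0%N.
have norm J := twisted_normalization unift isD Dt Ddense J.
split=> [[|[|n]] //= _|].
  exists (twisted_ring isD (fun j => (j < n.+1)%N)), (twisted_embedding unift isD Dt _).
  split=> //; first exact: bad.
    exact: (twisted_noetherian unift Dt Ddense res_onto).
  exact: (twisted_embedding_dimension unift isD Dt Ddense Dx res_onto).
exists (twisted_ring isD predT), (twisted_embedding unift isD Dt _).
split=> //; first exact: bad.
exact: (twisted_not_noetherian unift Dt Ddense Dx).
Qed.

(** In this form the three cases reduce to the construction of subrings of F
    and of power series independent over them. *)
Theorem bad_domains_of_tower (A : nat -> set F) (x : nat -> V) :
  (forall n, subring (A n)) -> (forall n, A n `<=` A n.+1) ->
  derivations_extend (A 0%N) -> A 0%N (frac t) ->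
  (forall c, exists2 a, A 0%N (frac a) & res a = c) ->
  (forall n, A n.+1 (frac (x n))) -> (forall n, ~ sep_alg (A n) (frac (x n))) ->
  bad_domains_exist V.
Proof.
move=> subA AS ext At Ares xA xind.
have [D [isD DA Dx]] := triangular_derivation subA AS ext xA xind.
apply: (bad_domains_of_derivation isD (DA _ At) _ Dx) => c.
by have [a Aa ac] := Ares c; exists a => //; apply: DA.
Qed.

End Construction.

(** * Independent power series over countable rings *)

Section Countability.
Variable F : fieldType.
Implicit Types A : set F.

Lemma finite_roots (p : {poly F}) : p != 0 -> finite_set [set x | root p x].
Proof.
have [n] := ubnP (size p); elim: n p => // n IH p szp p0.
have [[a pa]|nr] := pselect (exists a, root p a); last first.
  by rewrite (_ : [set x | _] = set0) //; apply/seteqP; split=> // x px; case: nr; exists x.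
have /factor_theorem[q pE] := pa; rewrite pE in p0.
have q0 : q != 0 by apply: contraNneq p0 => ->; rewrite mul0r.
have szq : (size q < n)%N.
  by move: szp; rewrite pE size_Mmonic ?monicXsubC // size_XsubC addn2.
apply: (@sub_finite_set _ _ ([set a] `|` [set x | root q x])).
  move=> x /=; rewrite pE rootM root_XsubC => /orP[|/eqP]; first by right.
  by left.
by rewrite finite_setU; split; [exact: finite_set1 | exact: IH].
Qed.

Lemma countable_polys A : countable A -> countable [set f : {poly F} | coefs_in A f].
Proof.
move=> /countable_injP[h hA]; apply/countable_injP.
exists (fun f : {poly F} => pickle [seq h x | x <- (f : seq F)]).
move=> f g /set_mem Af /set_mem Ag /(pcan_inj pickleK) E; apply/polyP => j.
have sz : size f = size g by rewrite -(size_map h f) E size_map.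
have [ltj|gej] := ltnP j (size f); last by rewrite !nth_default // -?sz.
apply: hA; rewrite ?inE; [exact: Af | exact: Ag|].
by rewrite -(nth_map 0 (h 0)) // E (nth_map 0) // -sz.
Qed.

Lemma countable_adjoin A z : countable A -> countable (adjoin A z).
Proof. by move=> cA; apply: sub_countable (card_image_le _ _) (countable_polys cA). Qed.

Lemma countable_sep_alg A : countable A -> countable [set x | sep_alg A x].
Proof.
move=> cA; pose P := [set f : {poly F} | coefs_in A f /\ f != 0].
have : countable (\bigcup_(f in P) [set x | root f x]).
  apply: bigcup_countable => [|f [_ f0]]; last by apply/finite_set_countable/finite_roots.
  by apply: sub_countable (countable_polys cA); apply: subset_card_le => f [].
apply: sub_countable; apply: subset_card_le => x [f Af [fx f'x]].
exists f; last by rewrite /= /root fx.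
by split=> //; apply: contraNneq f'x => ->; rewrite deriv0 horner0.
Qed.

End Countability.

Section BinarySeries.
Variables (V : idomainType) (t : V).
Hypotheses (unift : uniformizer t) (Vcomplete : complete_local V).
Local Notation tpow := (tpow t).

Definition binary_series (b : nat -> bool) : V :=
  sval (cid (complete_series unift Vcomplete (fun j => (b j)%:R))).

Lemma binary_seriesE b n : tpow n (binary_series b - \sum_(j < n) (b j)%:R * t ^+ j).
Proof. exact: svalP (cid (complete_series unift Vcomplete (fun j => (b j)%:R))) n. Qed.

Lemma binary_series_inj : injective binary_series.
Proof.
move=> b b' E; apply/funext => n; elim/ltn_ind: n => n IH.
have := tpowB (binary_seriesE b n.+1) (binary_seriesE b' n.+1).
rewrite E !big_ord_recr /= (eq_bigr (fun j : 'I_n => (b' j)%:R * t ^+ j)); last first.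
  by move=> j _; rewrite IH.
set S := \sum_(_ < _) _; set w := binary_series b'.
have -> : w - (S + (b n)%:R * t ^+ n) - (w - (S + (b' n)%:R * t ^+ n)) =
  t ^+ n * ((b' n)%:R - (b n)%:R) by ring.
rewrite -addn1 => /(tpow_cancel unift)/(tpow1_nonunit unift).
by case: (b n) (b' n) => [] []; rewrite ?subrr ?subr0 ?sub0r ?unitrN ?unitr1.
Qed.

Lemma binary_series_uncountable (C : set V) : countable C ->
  exists b, ~ C (binary_series b).
Proof.
move=> /countable_injP[h hC]; apply: contrapT => H.
have Cb b : C (binary_series b) by apply: contrapT => nC; case: H; exists b.
pose f b := h (binary_series b).
have f_inj : injective f.
  move=> b b' E; apply: binary_series_inj; apply: hC; rewrite ?inE //; exact: Cb.
(* Cantor's diagonal *)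
pose diag n := ~~ `[< exists2 b, f b = n & b n >].
have : diag (f diag) = ~~ diag (f diag).
  rewrite {1}/diag; congr (~~ _); apply/asboolP/idP => [[b /f_inj ->]|] //.
  by exists diag.
by case: (diag _).
Qed.

End BinarySeries.

Section GreedyTower.
Variables (V : idomainType) (t : V).
Hypotheses (unift : uniformizer t) (Vcomplete : complete_local V).
Local Notation F := {fraction V}.
Local Notation frac := (@tofrac V).
Local Notation bs := (binary_series unift Vcomplete).

(** Only countably many elements are algebraic over a countable ring, so every
    term of the sequence can be chosen independent of the preceding ones. *)
Lemma greedy_tower (A0 : set F) : subring A0 -> countable A0 ->
  exists (A : nat -> set F) (b : nat -> nat -> bool),
    [/\ A 0%N = A0, forall n, subring (A n), forall n, A n `<=` A n.+1,
        forall n, A n.+1 (frac (bs (b n))) &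
        forall n, ~ sep_alg (A n) (frac (bs (b n)))].
Proof.
move=> subA0 cA0.
have next (A : set F) : exists b, countable A -> ~ sep_alg A (frac (bs b)).
  have [cA|nA] := pselect (countable A); last by exists (fun=> true).
  have [|b nb] := @binary_series_uncountable _ _ unift Vcomplete
    [set x | sep_alg A (frac x)]; last by exists b.
  have /countable_injP[h hA] := countable_sep_alg cA.
  apply/countable_injP; exists (h \o frac) => x y /set_mem Ax /set_mem Ay.
  move/(hA _ _ (mem_set (Ax : [set z | sep_alg A z] _)) (mem_set (Ay : [set z | sep_alg A z] _))).
  by move/eqP; rewrite tofrac_eq => /eqP.
have [b bP] := choice next.
pose A := fix A n := if n is m.+1 then adjoin (A m) (frac (bs (b (A m)))) else A0.
have AP n : subring (A n) /\ countable (A n).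
  elim: n => [//|n [sA cA]]; split; [exact: subring_adjoin | exact: countable_adjoin].
exists A, (fun n => b (A n)); split=> // n; have [sA cA] := AP n.
- exact: sA.
- exact: (sub_adjoin sA).
- exact: (mem_adjoin sA).
- exact: bP.
Qed.

End GreedyTower.

(** * The ring of p-adic integers *)

Section Integers.
Variable T : comNzRingType.

Definition int_subring : set T := range (fun n : int => n%:~R).

Lemma int_subringP : subring int_subring.
Proof. exact: (subring_range (intr : {rmorphism int -> T})). Qed.

Lemma countable_int_subring : countable int_subring.
Proof. by apply: sub_countable (card_image_le _ _) (countableP _). Qed.

End Integers.

Section Padic.

Lemma ideal_span1 (R : comNzRingType) (a : R) : ideal_span [set a] = multiples a.
Proof.
apply/seteqP; split=> x.
  apply; split; first exact: multiples_ideal.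
  by move=> _ ->; exists 1; rewrite mulr1.
move=> [y ->]; have [_ _ M] := ideal_span_ideal [set a].
by rewrite mulrC; apply: M; apply: sub_ideal_span.
Qed.

Lemma principal_ideal_pow (R : comNzRingType) (a : R) n x :
  ideal_pow (ideal_span [set a]) n x <-> exists y, x = a ^+ n * y.
Proof. by rewrite ideal_span1 ideal_pow_multiples. Qed.

Variables (p : nat) (p_prime : prime p).
Local Notation Zp := (padic_integers p).
Local Notation I := (ideal_span [set p%:Z]).
Local Notation toZ := (@to_completion int I : int -> Zp).

Lemma to_completion_nat n : toZ n%:Z = n%:R.
Proof.
elim: n => [//|n IH].
rewrite -[n.+1]addn1 natrD -IH PoszD; apply/esym.
by apply: etrans (completion_addE _ _) _; apply: completion_of_ext.
Qed.

Lemma padic_p_nonunit (c : Zp) : p%:R * c <> 1.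
Proof.
rewrite -to_completion_nat -(completion_ofK c) => H.
have := congr1 (fun e : Zp => adic_coset e 1) H.
rewrite [X in adic_coset X]completion_mulE /= => /(coset_eqP (ideal_pow_ideal I 1)).
move/principal_ideal_pow => [y]; rewrite expr1 => yE.
have : (p%:Z %| 1)%Z.
  apply/dvdzP; exists (adic_rep c 1 - y).
  by rewrite mulrC mulrBr -yE; ring.
by rewrite dvdzE /= dvdn1 => /eqP p1; move: p_prime; rewrite p1.
Qed.

(** For a representing sequence u of c, all u_n - u_1 are divisible by p, and
    the quotients again form a coherent sequence. *)
Lemma padic_mod_p (c : Zp) : exists (n : int) (e : Zp), c = toZ n + p%:R * e.
Proof.
have pN0 : p%:Z != 0 by rewrite eqz_nat -lt0n prime_gt0.
pose u := adic_rep c; have cu : coherent I u := adic_rep_coherent c.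
have H n : exists y, u n.+1 - u 1%N = p%:Z * y.
  elim: n => [|n [y yE]]; first by exists 0; rewrite subrr mulr0.
  have /principal_ideal_pow[z zE] := cu n.+1.
  by exists (p%:Z ^+ n * z + y); rewrite mulrDr -yE mulrA -exprS -zE; ring.
have [w wE] := choice H.
have cw : coherent I w.
  move=> n; apply/principal_ideal_pow; have /principal_ideal_pow[z zE] := cu n.+1.
  exists z; apply: (mulfI pN0); rewrite mulrA -exprS -zE mulrBr -!wE; ring.
exists (u 1%N), (completion_of cw); rewrite -[LHS](completion_ofK c) -to_completion_nat.
apply/esym; apply: etrans (congr1 (+%R _) (completion_mulE _ _)) _.
apply: etrans (completion_addE _ _) _; apply: completion_of_eqP => n.
apply/principal_ideal_pow; have /principal_ideal_pow[z zE] := cu n.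
by exists z; rewrite -zE -wE; ring.
Qed.

End Padic.

Lemma fraction_char0 (V : idomainType) : [pchar V] =i pred0 -> [pchar {fraction V}] =i pred0.
Proof.
move=> char0 q; rewrite -(char0 q) !inE; congr andb.
by rewrite -(rmorph_nat (@tofrac V)) tofrac_eq0.
Qed.

Section PadicCase.
Variables (V : idomainType) (k : fieldType) (res : {rmorphism V -> k}).
Hypotheses (Vdvr : dvr V) (Vcomplete : complete_local V) (Vres : residue_map res).
Variables (p : nat) (p_prime : prime p).
Variables (h : {rmorphism padic_integers p -> V}) (h_bij : bijective h).

Lemma padic_dvr_mod_p (v : V) : exists (n : int) (w : V), v = n%:~R + p%:R * w.
Proof.
have [h' hK h'K] := h_bij; have [n [e E]] := padic_mod_p p_prime (h' v).
exists n, (h e); rewrite -[LHS]h'K E rmorphD rmorphM rmorph_nat; congr (_ + _).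
have toZN m : @to_completion int (ideal_span [set p%:Z]) (- m%:Z) = - m%:R :> padic_integers p.
  rewrite -to_completion_nat; apply/esym.
  by apply: etrans (completion_oppE _) _; apply: completion_of_ext.
case: n {E} => m; first by rewrite to_completion_nat rmorph_nat.
by rewrite NegzE toZN rmorphN rmorph_nat mulrNz.
Qed.

Lemma padic_dvr_p_nonunit : (p%:R : V) \isn't a GRing.unit.
Proof.
have [h' hK h'K] := h_bij; apply/negP => /divrr up.
case: (@padic_p_nonunit p p_prime (h' p%:R^-1)); apply: (can_inj hK).
by rewrite rmorphM rmorph_nat h'K up rmorph1.
Qed.

(** Every element of V is an integer modulo p. If the integer attached to a
    uniformizer t were prime to p, a combination of it with p would make 1
    divisible by t; hence p divides t. *)
Lemma padic_uniformizer : uniformizer (p%:R : V).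
Proof.
have [t unift] := dvr_uniformizer Vdvr.
have tp : tpow t 1 p%:R by apply/(tpow1_nonunit unift)/padic_dvr_p_nonunit.
have pt : exists z, t = p%:R * z.
  have [n [w tE]] := padic_dvr_mod_p t.
  suff [m nE] : exists m : int, n = p%:Z * m.
    by exists (m%:~R + w); rewrite tE nE mulrDr intrM.
  apply: contrapT => ndvd; have np : coprimez p n.
    rewrite coprimezE /= prime_coprime //.
    apply: contra_notN ndvd => pn; have /dvdzP[q ->] : (p%:Z %| n)%Z by [].
    by exists q; rewrite mulrC.
  have /coprimezP[[a b] /= ab] := np.
  have : tpow t 1 1.
    have -> : 1 = a%:~R * p%:R + b%:~R * (t - p%:R * w) :> V.
      by rewrite tE addrK -!intrM -[p%:R]/(p%:Z%:~R) -intrM -intrD ab.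
    apply/tpowD/tpowMl/tpowB; [exact: tpowMl | | exact: tpowMr].
    by exists 1; rewrite mulr1.
  by rewrite (tpow1_nonunit unift) unitr1.
have [z tE] := pt; have [y pE] := tp; rewrite expr1 in pE.
have [t0 _ tdec] := unift.
have yz : y * z = 1 by apply: (mulfI t0); rewrite mulr1 mulrA -pE.
have uy : y \is a GRing.unit by apply/unitrP; exists z; rewrite [z * y]mulrC.
split; [|exact: padic_dvr_p_nonunit|].
  by apply: contra_neq t0 => p0; rewrite tE p0 mul0r.
move=> x /tdec[n [u [uu ->]]]; exists n, (u * z ^+ n); split.
  by rewrite unitrM uu unitrX //; apply/unitrP; exists y; rewrite [z * y]mulrC.
by rewrite {1}tE exprMn mulrCA mulrA [_ * u]mulrC -mulrA.
Qed.

Lemma padic_dvr_char0 : [pchar V] =i pred0.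
Proof.
move=> q; rewrite [RHS]inE; apply/negP => qV; have [p0 pu _] := padic_uniformizer.
have [qp|nqp] := eqVneq p q; first by move: p0; rewrite qp (pcharf0 qV) eqxx.
have /coprimeP : coprime p q by rewrite prime_coprime // dvdn_prime2 // (pcharf_prime qV).
move=> /(_ (prime_gt0 p_prime))[[a b] /= ab].
case/negP: pu; apply/unitrP; exists a%:R; rewrite [_ * a%:R]mulrC.
suff -> : a%:R * p%:R = 1 :> V by [].
have leb : (b * q <= a * p)%N by apply/ltnW; rewrite -subn_gt0 ab.
have := congr1 (fun m : nat => m%:R : V) ab.
by rewrite natrB // !natrM (pcharf0 qV) mulr0 subr0.
Qed.

Theorem padic_bad_domains : bad_domains_exist V.
Proof.
pose Z := @int_subring {fraction V}.
have [A [b [A0 subA AS bA bind]]] :=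
  @greedy_tower _ _ padic_uniformizer Vcomplete Z (@int_subringP _) (@countable_int_subring _).
have char0 := fraction_char0 padic_dvr_char0.
apply: (bad_domains_of_tower padic_uniformizer Vres subA AS _ _ _ bA bind).
- by left.
- by rewrite A0 rmorph_nat; exists (p%:Z).
move=> c; have [v _ <-] : range res c by rewrite Vres.
have [n [w ->]] := padic_dvr_mod_p v; exists n%:~R.
  by rewrite A0 rmorph_int; exists n.
apply/esym; rewrite rmorphD (res_eq0 padic_uniformizer Vres (p%:R * w)).2 ?addr0 //.
by exists w; rewrite expr1.
Qed.

End PadicCase.

(** * Equal characteristic zero *)

Section EqualCharacteristicZero.
Variables (V : idomainType) (k : fieldType) (res : {rmorphism V -> k}).
Hypotheses (Vcomplete : complete_local V) (Vres : residue_map res).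
Variables (t : V) (unift : uniformizer t).
Hypothesis char0V : [pchar V] =i pred0.
Hypothesis char0k : [pchar k] =i pred0.
Local Notation F := {fraction V}.
Local Notation frac := (@tofrac V).
Local Notation tpow := (tpow t).

Lemma res_unit v : res v != 0 -> v \is a GRing.unit.
Proof.
by apply: contraR => /(tpow1_nonunit unift)/(res_eq0 unift Vres) ->.
Qed.

Lemma char0_int (T : idomainType) (n : int) : [pchar T] =i pred0 -> n%:~R = 0 :> T -> n = 0.
Proof.
move=> /(pcharf0P T) c0; case: n => n /eqP.
  by rewrite -[_%:~R]/(n%:R) c0 => /eqP ->.
by rewrite NegzE mulrNz oppr_eq0 -[_%:~R]/(n.+1%:R) c0.
Qed.

Lemma tpow_horner_diff n (f : {poly V}) a b : tpow n (a - b) -> tpow n (f.[a] - f.[b]).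
Proof.
move=> [y yE]; have -> : a = b + t ^+ n * y by rewrite -yE addrC subrK.
have [c ->] := horner_taylor1 f b (t ^+ n * y).
exists ((f^`()).[b] * y + t ^+ n * y ^+ 2 * c); ring.
Qed.

(** Newton iteration with the fixed slope w^-1. *)
Lemma complete_hensel (f : {poly V}) y : res f.[y] = 0 -> res (f^`()).[y] != 0 ->
  exists2 z, res z = res y & f.[z] = 0.
Proof.
move=> fy f'y; set w := (f^`()).[y]; have uw : w \is a GRing.unit by apply: res_unit.
pose u := fix u n := if n is m.+1 then u m - f.[u m] / w else y.
have uP n : tpow 1 (u n - y) /\ tpow n.+1 f.[u n].
  elim: n => [|n [IH1 IH2]].
    by rewrite subrr; split; [apply: tpow0 | apply/(res_eq0 unift Vres)].
  have tq : tpow n.+1 (f.[u n] / w) by apply: tpowMr.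
  split; first by rewrite /= addrAC; apply: tpowB => //; apply: tpowW tq.
  have [c /= ->] := horner_taylor1 f (u n) (- (f.[u n] / w)).
  have -> : f.[u n] + (f^`()).[u n] * - (f.[u n] / w) =
      (w - (f^`()).[u n]) * (f.[u n] / w).
    by rewrite mulrBl mulrN [w * _]mulrC divrK.
  apply: tpowD; last first.
    apply: tpowMr; rewrite sqrrN; apply: tpowW (tpowX 2 tq).
    by rewrite mulnC mul2n -addnn addnS ltnS leq_addr.
  rewrite -[n.+2]add1n; apply: tpowM => //.
  by rewrite -opprB; apply: tpowN; apply: tpow_horner_diff.
have [|z zP] := complete_limit unift Vcomplete (u := u).
  move=> n /=; rewrite addrAC subrr add0r; apply/tpowN/tpowMr.
  by apply: tpowW (uP n).2.
exists z.
  apply/eqP; rewrite -subr_eq0 -rmorphB; apply/eqP/(res_eq0 unift Vres).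
  by rewrite -(subrKA (u 1%N)); apply: tpowD (zP 1%N) (uP 1%N).1.
apply: (tpow_separated unift) => n; rewrite -(subrK f.[u n] f.[z]).
apply: tpowD; first exact: tpow_horner_diff.
by apply: tpowW (uP n).2.
Qed.

(** The integers embed in the residue field, and Hensel's lemma lifts the rest
    of it. *)
Lemma coefficient_field : exists K : set V,
  sectional res K /\ forall c, exists2 x, K x & res x = c.
Proof.
have [||||K [secK _ Konto]] := @lift_residue_field V k res _ _ complete_hensel (@int_subring V).
- move=> c; have [v _ <-] : range res c by rewrite Vres.
  by exists v.
- by move=> z /res_unit uz; exists z^-1; rewrite mulVr.
- split; first exact: int_subringP.
  by move=> _ [n _ <-]; rewrite rmorph_int => /(char0_int char0k) ->.
- by left.
by exists K.
Qed.

(** The power series in t with integer coefficients, as limits of polynomials.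
    Among them there are uncountably many, which leaves room for independent
    sequences over the countable ring of polynomials, and they are linearly
    disjoint from a coefficient field. *)
Definition int_series : set V :=
  [set v | forall N, exists f : {poly int}, tpow N (v - (map_poly intr f).[t])].

Lemma int_series_poly (f : {poly int}) : int_series (map_poly intr f).[t].
Proof. by move=> N; exists f; rewrite subrr; apply: tpow0. Qed.

Lemma int_series_subring : subring int_series.
Proof.
split=> [|v w Wv Ww N|v w Wv Ww N].
- by have := int_series_poly 1; rewrite rmorph1 hornerC.
- have [f Hf] := Wv N; have [g Hg] := Ww N; exists (f - g).
  rewrite rmorphB hornerD hornerN.
  have -> : v - w - ((map_poly intr f).[t] - (map_poly intr g).[t]) =
    (v - (map_poly intr f).[t]) - (w - (map_poly intr g).[t]) by ring.
  exact: tpowB.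
- have [f Hf] := Wv N; have [g Hg] := Ww N; exists (f * g).
  rewrite rmorphM hornerM.
  have -> : v * w - (map_poly intr f).[t] * (map_poly intr g).[t] =
    (v - (map_poly intr f).[t]) * w + (map_poly intr f).[t] * (w - (map_poly intr g).[t]) by ring.
  by apply: tpowD; [apply: tpowMr | apply: tpowMl].
Qed.

Lemma int_series_binary b : int_series (binary_series unift Vcomplete b).
Proof.
move=> N; exists (\poly_(j < N) (b j)%:R).
suff -> : (map_poly intr (\poly_(j < N) (b j)%:R : {poly int})).[t] =
    \sum_(j < N) (b j)%:R * t ^+ j by apply: binary_seriesE.
rewrite poly_def rmorph_sum horner_sum; apply: eq_bigr => j _.
by rewrite -mul_polyC rmorphM /= map_polyC map_polyXn !hornerE /= rmorph_nat.
Qed.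

Lemma res_horner_int (f : {poly int}) : res (map_poly intr f).[t] = (f`_0)%:~R.
Proof.
have rt : res t = 0 by apply/(res_eq0 unift Vres); exists 1; rewrite expr1 mulr1.
rewrite -horner_map rt horner_coef0 !coef_map /=.
by rewrite rmorph_int.
Qed.

Lemma int_series_res v : int_series v -> exists n : int, res v = n%:~R.
Proof.
move=> /(_ 1%N)[f /(res_eq0 unift Vres)]; rewrite rmorphB res_horner_int => /eqP.
by rewrite subr_eq0 => /eqP ->; exists f`_0.
Qed.

(** The constant coefficient of an approximating polynomial is an integer with
    residue zero, hence zero. *)
Lemma int_series_div v : int_series (t * v) -> int_series v.
Proof.
move=> Wv N; have [f Hf] := Wv N.+1.
have f0 : f`_0 = 0.
  apply: (char0_int char0k); rewrite -res_horner_int.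
  have rtv : res (t * v) = 0 by apply/(res_eq0 unift Vres); exists v; rewrite expr1.
  have /(res_eq0 unift Vres) : tpow 1 (t * v - (map_poly intr f).[t]) by apply: tpowW Hf.
  by rewrite rmorphB rtv sub0r => /eqP; rewrite oppr_eq0 => /eqP.
have /factor_theorem[g fE] : root f 0 by rewrite /root horner_coef0 f0.
rewrite subr0 in fE; exists g; apply: (tpow_cancel unift (m := 1)).
rewrite add1n expr1 mulrBr; move: Hf.
by rewrite fE rmorphM /= map_polyX hornerMX [_ * t]mulrC.
Qed.

Section LinearDisjointness.
Variables (K : set V) (secK : sectional res K).

(** Elements of K linearly independent over the integers are linearly
    independent over the integral power series: reduce a relation modulo t and
    divide it by t. *)
Lemma independent_over_series n (c w : 'I_n -> V) : (forall j, K (c j)) ->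
  (forall m : 'I_n -> int, \sum_j (m j)%:~R * c j = 0 -> forall j, m j = 0) ->
  (forall j, int_series (w j)) -> \sum_j c j * w j = 0 -> forall j, w j = 0.
Proof.
move=> Kc indep Ww rel; have [subK Kres] := secK.
suff H N : exists w' : 'I_n -> V, [/\ forall j, w j = t ^+ N * w' j,
    forall j, int_series (w' j) & \sum_j c j * w' j = 0].
  move=> j; apply: (tpow_separated unift) => N.
  by have [w' [-> _ _]] := H N; exists (w' j).
elim: N => [|N [w' [wE Ww' rel']]]; first by exists w; split=> // j; rewrite mul1r.
have [m mE] := choice (fun j => int_series_res (Ww' j)).
have m0 : forall j, m j = 0.
  apply: indep; apply: Kres.
    apply: (subring_sum subK) => j _; apply: (subringM subK) => //.
    exact: subring_int.
  have := congr1 res rel'; rewrite rmorph0 rmorph_sum => <-; rewrite rmorph_sum.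
  by apply: eq_bigr => j _; rewrite !rmorphM mE rmorph_int mulrC.
have tw j : exists y, w' j = t * y.
  have [|y yE] := (res_eq0 unift Vres (w' j)).1; last by exists y; rewrite yE expr1.
  by rewrite mE m0.
have [y yE] := choice tw; exists y; split=> [j|j|].
- by rewrite wE yE exprSr mulrA.
- by apply: int_series_div; rewrite -yE.
apply: (mulfI (t_neq0 unift)); rewrite mulr0 -[RHS]rel' mulr_sumr.
by apply: eq_bigr => j _; rewrite yE mulrCA.
Qed.

(** The derivation of K-linear combinations of power series with integer
    coefficients is the K-linear extension of D. If the c_j are independent
    over the integers, all w_j vanish; otherwise a relation between the c_j
    eliminates one term of the sum. *)
Lemma extension_well_defined (L : lmodType F) (D : F -> L) : derivation D ->
  forall n (c w : 'I_n -> V), (forall j, K (c j)) -> (forall j, int_series (w j)) ->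
  \sum_j c j * w j = 0 -> \sum_j frac (c j) *: D (frac (w j)) = 0.
Proof.
move=> isD; elim=> [|n IH] c w Kc Ww rel; first by rewrite big_ord0.
have Dint (m : int) v : D (frac (m%:~R * v)) = m%:~R *: D (frac v).
  have Dm : D m%:~R = 0.
    have Dnat l : D l%:R = 0.
      by elim: l => [|l IHl]; rewrite ?(der0 isD) // -natr1 (derD isD) IHl (der1 isD) addr0.
    by case: m => l; [exact: Dnat | rewrite NegzE mulrNz (derN isD) Dnat oppr0].
  by rewrite tofracM rmorph_int (derM isD) Dm scaler0 addr0.
have [indep|] := pselect (forall m : 'I_n.+1 -> int,
    \sum_j (m j)%:~R * c j = 0 -> forall j, m j = 0).
  rewrite big1 // => j _; rewrite (independent_over_series Kc indep Ww rel).
  by rewrite tofrac0 (der0 isD) scaler0.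
move=> /existsNP[m H]; move: H => /not_implyP[mrel H].
move: H => /existsNP[j0 mj]; have mj0 : m j0 != 0 by apply/eqP.
(* a relation between the coefficients shortens the sum *)
have mN0 : (m j0)%:~R != 0 :> F.
  apply: contraNneq mj0 => E; apply/eqP/(char0_int char0V).
  by apply/eqP; rewrite -tofrac_eq0 rmorph_int E.
have := IH (fun j => c (lift j0 j))
  (fun j => (m j0)%:~R * w (lift j0 j) - (m (lift j0 j))%:~R * w j0).
move=> /(_ (fun j => Kc _)) short.
have WM := subringM int_series_subring.
have Wint (q : int) : int_series q%:~R by apply: (subring_int int_series_subring).
have {}short : \sum_j frac (c (lift j0 j)) *:
    D (frac ((m j0)%:~R * w (lift j0 j) - (m (lift j0 j))%:~R * w j0)) = 0.
  apply: short => [j|].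
    by apply: (subringB int_series_subring); apply: WM.
  move: rel mrel; rewrite !(bigD1_ord j0) //=.
  move=> /eqP; rewrite addrC addr_eq0 => /eqP E1 /eqP; rewrite addrC addr_eq0 => /eqP E2.
  rewrite (eq_bigr (fun j => (m j0)%:~R * (c (lift j0 j) * w (lift j0 j)) -
    w j0 * ((m (lift j0 j))%:~R * c (lift j0 j)))); last by move=> j _; ring.
  rewrite sumrB -!mulr_sumr E1 E2; ring.
apply/eqP; have := scaler_eq0 ((m j0)%:~R : F) (\sum_j frac (c j) *: D (frac (w j))).
rewrite (negbTE mN0) /= => <-; apply/eqP; rewrite -[RHS]short.
rewrite (bigD1_ord j0) //= scalerDr scaler_sumr.
under [in RHS]eq_bigr do rewrite tofracB (derB isD) !Dint scalerBr !scalerA.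
rewrite sumrB addrC; congr (_ + _).
  by apply: eq_bigr => j _; rewrite scalerA mulrC.
rewrite -scaler_suml scalerA -scaleNr; congr (_ *: _).
have := congr1 frac mrel; rewrite rmorph_sum (bigD1_ord j0) //= tofrac0 => /eqP.
rewrite addr_eq0 tofracM rmorph_int => /eqP ->; congr (- _).
by apply: eq_bigr => j _; rewrite tofracM rmorph_int mulrC.
Qed.

End LinearDisjointness.

Theorem equal_char0_bad_domains : bad_domains_exist V.
Proof.
have char0F := fraction_char0 char0V.
have [K [secK Konto]] := coefficient_field; have [subK Kres] := secK.
have subW := int_series_subring.
pose Z : set F := adjoin (@int_subring F) (frac t).
have subZ : subring Z by apply: subring_adjoin; apply: int_subringP.
have cZ : countable Z by apply/countable_adjoin/countable_int_subring.
have [A [b [A0 subA AS bA bind]]] := greedy_tower unift Vcomplete subZ cZ.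
have [|D0 [isD0 D0A D0x]] := triangular_derivation subA AS _ bA bind; first by left.
pose term (q : V * V) : trivext {poly F} := (frac (q.1 * q.2), frac q.1 *: D0 (frac q.2)).
pose KW (s : seq (V * V)) := forall q, q \in s -> K q.1 /\ int_series q.2.
pose G0 : set (trivext {poly F}) := [set \sum_(q <- s) term q | s in KW].
have G0term c w : K c -> int_series w -> G0 (frac (c * w), frac c *: D0 (frac w)).
  move=> Kc Ww; exists [:: (c, w)]; last by rewrite big_seq1.
  by move=> q; rewrite inE => /eqP ->.
have [||D isD DE] := @extend_derivation F {poly F} G0.
- split; first split.
  + suff -> : 1 = (frac (1 * 1), frac 1 *: D0 (frac 1)) :> trivext {poly F}.
      by apply: G0term; [exact: subring1 subK | exact: subring1 subW].
    by rewrite mulr1 tofrac1 (der1 isD0) scaler0.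
  + move=> _ _ [s Ks <-] [s' Ks' <-].
    exists (s ++ [seq (- q.1, q.2) | q <- s']).
      move=> q; rewrite mem_cat => /orP[/Ks //|/mapP[q' /Ks'[Kq Wq] ->]].
      by split=> //; apply: (subringN subK).
    rewrite big_cat big_map; congr (_ + _); rewrite -sumrN; apply: eq_bigr => q _.
    by rewrite /term /= mulNr !tofracN scaleNr.
  + move=> _ _ [s Ks <-] [s' Ks' <-].
    exists [seq (q.1 * q'.1, q.2 * q'.2) | q <- s, q' <- s'].
      move=> _ /allpairsP[[q q'] /= [/Ks[Kq Wq] /Ks'[Kq' Wq'] ->]].
      by split; [apply: (subringM subK) | apply: (subringM subW)].
    rewrite big_allpairs_dep big_distrlr /=; apply: eq_bigr => q _; apply: eq_bigr => q' _.
    rewrite te_mulE /term /= mulrACA !tofracM; congr pair.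
    by rewrite (derM isD0) scalerDr !scalerA; congr (_ *: _ + _ *: _); ring.
- move=> _ [s Ks <-]; have Es : \sum_(q <- s) term q =
      (\sum_(q <- s) frac (q.1 * q.2), \sum_(q <- s) frac q.1 *: D0 (frac q.2)).
    by elim: s {Ks} => [|q s IH]; rewrite ?big_nil // !big_cons IH.
  rewrite Es /te_proj /= -rmorph_sum => s0; congr pair; first exact: s0.
  rewrite big_tnth; apply: (extension_well_defined secK isD0) => [j|j|].
  + by have [] := Ks _ (mem_tnth j (in_tuple s)).
  + by have [] := Ks _ (mem_tnth j (in_tuple s)).
  by move/eqP: s0; rewrite tofrac_eq0 big_tnth => /eqP.
- by left.
have Wt : int_series t.
  by have := int_series_poly 'X; rewrite map_polyX hornerX.
have DW w : int_series w -> D (frac w) = D0 (frac w).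
  move=> Ww; have := DE _ (G0term 1 w (subring1 subK) Ww).
  by rewrite mul1r tofrac1 scale1r.
apply: (bad_domains_of_derivation unift Vres isD (x := fun n => binary_series unift Vcomplete (b n))).
- by rewrite DW // D0A // A0; apply: mem_adjoin; apply: int_subringP.
- move=> c; have [a Ka ac] := Konto c; exists a => //.
  have := DE _ (G0term a 1 Ka (subring1 subW)).
  by rewrite mulr1 tofrac1 (der1 isD0) scaler0.
move=> n; rewrite DW; [exact: D0x | exact: int_series_binary].
Qed.

End EqualCharacteristicZero.

(** * Purely inseparable adjunctions *)

Section GeneratedSubring.
Variable T : comNzRingType.
Implicit Types X S : set T.

Definition ring_gen X : set T := smallest (@subring T) X.

Lemma ring_gen_subring X : subring (ring_gen X).
Proof.
split=> [S [subS _]|x y Hx Hy S HS|x y Hx Hy S HS]; first exact: subring1 subS.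
  by have [subS _] := HS; apply: (subringB subS); [apply: Hx | apply: Hy].
by have [subS _] := HS; apply: (subringM subS); [apply: Hx | apply: Hy].
Qed.

Lemma sub_ring_gen X : X `<=` ring_gen X.
Proof. by move=> x Xx S [_]; apply. Qed.

Lemma ring_gen_min X S : subring S -> X `<=` S -> ring_gen X `<=` S.
Proof. by move=> subS XS x; apply. Qed.

Lemma ring_gen_mono X Y : X `<=` Y -> ring_gen X `<=` ring_gen Y.
Proof.
by move=> XY; apply: ring_gen_min (ring_gen_subring Y) (subset_trans XY (@sub_ring_gen Y)).
Qed.

Lemma ring_genU1 X z : ring_gen (X `|` [set z]) = adjoin (ring_gen X) z.
Proof.
have subX := ring_gen_subring X; apply/seteqP; split.
  apply: ring_gen_min; first exact: subring_adjoin.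
  move=> x [Xx|->]; last exact: mem_adjoin.
  by apply: sub_adjoin => //; apply: sub_ring_gen.
apply: adjoin_min; first exact: ring_gen_subring.
  by apply: ring_gen_mono => x; left.
by apply: sub_ring_gen; right.
Qed.

Lemma adjoin_subring X z : subring X -> adjoin X z = ring_gen (X `|` [set z]).
Proof.
move=> subX; rewrite ring_genU1; congr (adjoin _ z).
apply/seteqP; split; first exact: sub_ring_gen.
exact: ring_gen_min.
Qed.

Lemma ring_gen_id X : subring X -> ring_gen X = X.
Proof.
move=> subX; apply/seteqP; split; [exact: ring_gen_min | exact: sub_ring_gen].
Qed.

Section Sequence.
Variable b : nat -> T.

Definition gen_upto S n := ring_gen (S `|` [set b i | i in [set i | (i < n)%N]]).

Lemma gen_upto0 S : subring S -> gen_upto S 0 = S.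
Proof.
move=> subS; rewrite -[RHS]ring_gen_id //; congr ring_gen.
by apply/seteqP; split=> [x [|[]]//|x]; left.
Qed.

Lemma gen_uptoS S n : gen_upto S n.+1 = adjoin (gen_upto S n) (b n).
Proof.
rewrite -ring_genU1; congr ring_gen; rewrite -setUA; congr (_ `|` _).
apply/seteqP; split=> [_ [i /= lti <-]|_ [[i /= lti <-]|->]].
- by move: lti; rewrite ltnS leq_eqVlt => /orP[/eqP ->|lti]; [right|left; exists i].
- by exists i => //=; apply: ltnW.
- by exists n => /=.
Qed.

Lemma gen_upto_mono S m n : (m <= n)%N -> gen_upto S m `<=` gen_upto S n.
Proof.
move=> lemn; apply: ring_gen_mono; apply: setUS => _ [i /= lti <-]; exists i => //=.
exact: leq_trans lemn.
Qed.

Lemma sub_gen_upto S n : S `<=` gen_upto S n.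
Proof. by move=> x Sx; apply: sub_ring_gen; left. Qed.

Lemma mem_gen_upto S i n : (i < n)%N -> gen_upto S n (b i).
Proof. by move=> lti; apply: sub_ring_gen; right; exists i. Qed.

End Sequence.

End GeneratedSubring.

Lemma ring_gen_image (T U : comNzRingType) (f : {rmorphism T -> U}) (X : set T) :
  f @` ring_gen X = ring_gen (f @` X).
Proof.
apply/seteqP; split=> [_ [x + <-]|].
  move/(_ (f @^-1` ring_gen (f @` X))); apply; split; last first.
    by move=> y Xy; apply: sub_ring_gen; exists y.
  exact/subring_preimage/ring_gen_subring.
apply: ring_gen_min; first exact/subring_image/ring_gen_subring.
by move=> _ [x Xx <-]; exists x => //; apply: sub_ring_gen.
Qed.

Section SmallDegree.
Variables (T : comNzRingType) (p : nat).

(** Powers beyond the (p-1)st of an element whose pth power lies in S are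
    redundant in S[z]. *)
Lemma adjoin_small (S : set T) z x : (0 < p)%N -> subring S -> S (z ^+ p) ->
  adjoin S z x -> exists f, [/\ coefs_in S f, (size f <= p)%N & x = f.[z]].
Proof.
move=> p0 subS Szp [f + <-] {x}; elim/poly_ind: f => [|f c IH] Sf.
  by exists 0; split; rewrite ?size_poly0 ?horner0.
have coefE j : (f * 'X + c%:P)`_j = if j is i.+1 then f`_i else c.
  by rewrite coefD coefMX coefC; case: j => [|j] /=; rewrite ?add0r ?addr0.
have [|g [Sg szg fg]] := IH; first by move=> j; have := Sf j.+1; rewrite coefE.
have Sc : S c by have := Sf 0%N; rewrite coefE.
pose a := g`_p.-1; exists (g * 'X + c%:P - a *: 'X^p + (a * z ^+ p)%:P); split.
- move=> j; rewrite !(coefD, coefN, coefZ, coefMX, coefC, coefXn).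
  apply: (subringD subS).
    apply: (subringB subS).
      apply: (subringD subS); case: eqP => _ //; exact: subring0 subS.
    by apply: (subringM subS); [exact: Sg | exact: (subring_nat subS)].
  by case: eqP => _; [apply: (subringM subS); [exact: Sg|] | exact: subring0 subS].
- apply/leq_sizeP => j; rewrite leq_eqVlt => /orP[/eqP<-|ltpj].
    rewrite !(coefD, coefN, coefZ, coefMX, coefC, coefXn) eqxx mulr1.
    by rewrite gtn_eqF // /a !addr0 subrr.
  rewrite !(coefD, coefN, coefZ, coefMX, coefC, coefXn) !gtn_eqF //; last first.
    exact: leq_ltn_trans ltpj.
  rewrite nth_default ?mulr0 ?subr0 ?addr0 //.
  by apply: leq_trans szg _; rewrite -ltnS (leq_trans ltpj) // leqSpred.
by rewrite !hornerE fg; ring.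
Qed.

End SmallDegree.

Section PurelyInseparable.
Variables (Phi : fieldType) (p : nat) (charp : p \in [pchar Phi]).
Variables (S : set Phi) (subS : subring S) (Sp : forall x, S (x ^+ p)).

Let p_gt0 : (0 < p)%N. Proof. exact/prime_gt0/(pcharf_prime charp). Qed.

Lemma pth_subring_inv x : S x -> S x^-1.
Proof.
move=> Sx; have [->|x0] := eqVneq x 0; first by rewrite invr0; apply: subring0 subS.
have -> : x^-1 = x ^+ p.-1 * x^-1 ^+ p.
  by rewrite -[in _ ^+ p](prednK p_gt0) exprS mulrCA -exprMn mulfV // expr1n mulr1.
by apply: (subringM subS) => //; apply: (subringX subS).
Qed.

(** The minimal polynomial of c over S divides X^p - c^p = (X - c)^p and is a
    power (X - c)^j. By minimality its derivative is zero, so that p divides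
    j, unless j = 1, when c lies in S. *)
Lemma purely_inseparable_min c f : ~ S c -> coefs_in S f -> f.[c] = 0 ->
  exists2 Q, coefs_in S Q & f = Q * ('X^p - (c ^+ p)%:P).
Proof.
move=> nSc Sf fc; set g := 'X^p - _.
have idE (q : {poly Phi}) : map_poly (idfun : {rmorphism Phi -> Phi}) q = q.
  by apply: map_poly_id.
have szg : size g = p.+1 by apply: size_XnsubC.
have Sg : coefs_in S g.
  by apply: (coefs_inB subS); [exact: coefs_inX subS _ | exact: coefs_inC subS _ (Sp c)].
have gc : g.[c] = 0 by rewrite !hornerE subrr.
have gE : g = ('X - c%:P) ^+ p.
  have charpP : p \in [pchar {poly Phi}] by rewrite pchar_poly.
  by rewrite /g polyC_exp -!(pFrobenius_autE charpP) (pFrobenius_autB_comm _ (mulrC _ _)).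
have g_monic : lead_coef g = 1.
  by apply/monicP; rewrite gE monic_exp ?monicXsubC.
suff gmin : forall h, coefs_in S h -> h.[c] = 0 -> (size h < size g)%N -> h = 0.
  apply: (divide_by_minimal (pi := idfun) (y := c) (w := 1)) => //; rewrite ?idE //.
  - exact: subring1 subS.
  - by rewrite g_monic mulr1.
  - by move=> h Sh; rewrite idE; apply: gmin.
pose P n := `[< exists h, [/\ coefs_in S h, h.[c] = 0, h != 0 & size h = n] >].
have exP : exists n, P n.
  by exists (size g); apply/asboolP; exists g; split=> //; rewrite -size_poly_gt0 szg.
have [n /asboolP[h [Sh hc h0 szh]] nmin] := ex_minnP exP.
have hmin q : coefs_in S q -> q.[c] = 0 -> (size q < size h)%N -> q = 0.
  move=> Sq qc; apply: contraTeq => q0; rewrite -leqNgt szh; apply: nmin.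
  by apply/asboolP; exists q.
suff szgh : size h = size g by move=> q Sq qc; rewrite -szgh; apply: hmin.
have lead0 : lead_coef h != 0 by rewrite lead_coef_eq0.
have [|||Q _ gQ] := divide_by_minimal (pi := idfun) (y := c) subS Sh (pth_subring_inv (Sh _))
  (mulVf lead0) _ _ Sg.
- by rewrite idE.
- by move=> q Sq; rewrite idE; apply: hmin.
- by rewrite idE.
have : h %| ('X - c%:P) ^+ p by rewrite -gE gQ dvdp_mull.
move=> /dvdp_exp_XsubCP[j lejp hj].
have szhj : size h = j.+1 by rewrite (eqp_size hj) size_exp_XsubC.
move: lejp; rewrite szg szhj leq_eqVlt => /orP[/eqP -> //|ltjp].
have j0 : (0 < j)%N.
  rewrite lt0n; apply: contraTneq isT => j0.
  have /size1_polyC hE : (size h <= 1)%N by rewrite szhj j0.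
  by move: hc h0; rewrite hE hornerC => ->; rewrite eqxx.
(* a multiple root would be a root of the derivative, which is smaller *)
have [j1|jN1] := eqVneq j 1%N.
  case: nSc; move: hc; rewrite horner_coef szhj j1 !big_ord_recl big_ord0 /= addr0.
  rewrite expr0 mulr1 expr1 => /eqP; rewrite addrC addr_eq0 => /eqP h1c.
  have h1 : h`_1 != 0 by move: lead0; rewrite lead_coefE szhj j1.
  rewrite -(mulKf h1 c) h1c; apply: (subringM subS); first exact/pth_subring_inv/Sh.
  exact/(subringN subS)/Sh.
have h'c : (h^`()).[c] = 0.
  have : ('X - c%:P) ^+ 2 %| h by rewrite (eqp_dvdr _ hj) dvdp_exp2l // ltn_neqAle eq_sym jN1.
  move=> /dvdpP[q ->]; rewrite derivM deriv_exp derivXsubC.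
  by rewrite !hornerE /= !(subrr, mulr0, mul0r, mul0rn, hornerMn, hornerE) /=; ring.
have h'0 : h^`() = 0.
  by apply: hmin => //; [exact: coefs_in_deriv subS _ Sh | exact: lt_size_deriv].
have := congr1 (fun q : {poly Phi} => q`_j.-1) h'0.
rewrite coef_deriv coef0 prednK // -mulr_natr => /eqP.
have -> : h`_j = lead_coef h by rewrite lead_coefE szhj.
rewrite mulf_eq0 (negbTE lead0) /= -(dvdn_pcharf charp) => pj.
by have := dvdn_leq j0 pj; rewrite leqNgt ltjp.
Qed.

Lemma pth_subring_small c f : ~ S c -> coefs_in S f -> f.[c] = 0 ->
  (size f <= p)%N -> f = 0.
Proof.
move=> nSc Sf fc; have [Q _ ->] := purely_inseparable_min nSc Sf fc.
have [->|Q0] := eqVneq Q 0; first by rewrite mul0r.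
rewrite size_Mmonic ?monicXnsubC // size_XnsubC // addnS /= leqNgt -{1}[p]add0n.
by rewrite ltn_add2r size_poly_gt0 Q0.
Qed.

Lemma pth_subring_sep_alg c : sep_alg S c -> S c.
Proof.
move=> [f Sf [fc f'c]]; apply: contrapT => nSc; move/eqP: f'c; apply.
have [Q _ ->] := purely_inseparable_min nSc Sf fc.
rewrite derivM derivB derivXn derivC subr0 -mulr_natr.
rewrite (_ : p%:R = 0) ?mulr0 ?addr0; last by rewrite -polyC_natr (pcharf0 charp).
by rewrite !hornerE subrr mulr0.
Qed.

End PurelyInseparable.

(** * Characteristic p with uncountable p-degree *)

Section InfiniteDegree.
Variables (k : fieldType) (p : nat) (charp : p \in [pchar k]).
Local Notation kp := (@pth_powers k p).

Lemma pth_powers_subring : subring kp.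
Proof. exact: (subring_range (pFrobenius_aut charp)). Qed.

Definition pth_module (M : set k) :=
  [/\ M 0, forall x y, M x -> M y -> M (x + y) & forall a x, kp a -> M x -> M (a * x)].
Definition pth_span (X : set k) : set k := smallest pth_module X.

Lemma pth_span_module X : pth_module (pth_span X).
Proof.
split=> [M [[]]|x y Hx Hy M HM|a x Ha Hx M HM] //; have [[_ MD MM] _] := HM.
  by apply: MD; [apply: Hx | apply: Hy].
by apply: MM => //; apply: Hx.
Qed.

Lemma sub_pth_span X : X `<=` pth_span X.
Proof. by move=> x Xx M [_]; apply. Qed.

Lemma pth_span_sum X (I : Type) (r : seq I) (F : I -> k) :
  (forall i, pth_span X (F i)) -> pth_span X (\sum_(i <- r) F i).
Proof.
have [M0 MD _] := pth_span_module X.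
by move=> H; elim/big_ind: _ => // x y; apply: MD.
Qed.

Variable B : set k.
Hypothesis basisB : basis_over kp B.

(** Contained in a subspace generated over the pth powers by finitely many
    elements of the basis B. Such subrings are proper, and remain so after the
    adjunction of an element: this is how uncountability of B is used. *)
Definition finitely_supported (S : set k) :=
  exists s : seq k, (forall x, x \in s -> B x) /\ S `<=` pth_span [set` s].

Lemma finite_support_seq (r : seq k) : exists s : seq k,
  (forall x, x \in s -> B x) /\ (forall x, x \in r -> pth_span [set` s] x).
Proof.
elim: r => [|y r [s [sB rs]]]; first by exists [::].
have [s' [a [s'B Fa yE]]] := basisB.2 y.
have mono (s1 s2 : seq k) : {subset s1 <= s2} -> pth_span [set` s1] `<=` pth_span [set` s2].
  move=> s12 x; apply; split; first exact: pth_span_module.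
  by move=> z /= zs; apply: sub_pth_span => /=; apply: s12.
exists (s ++ s'); split=> x.
  by rewrite mem_cat => /orP[/sB|/s'B].
rewrite inE => /orP[/eqP ->|/rs]; last by apply: mono => z; rewrite mem_cat => ->.
rewrite yE big_seq_cond; have [M0 MD MM] := pth_span_module [set` s ++ s'].
elim/big_ind: _ => // z; rewrite andbT => zs; apply: MM => //; apply: sub_pth_span => /=.
by rewrite mem_cat zs orbT.
Qed.

Lemma finitely_supported_pth : finitely_supported kp.
Proof.
have [s [sB s1]] := finite_support_seq [:: 1].
exists s; split=> // x kx; have [_ _ M] := pth_span_module [set` s].
by rewrite -(mulr1 x); apply: M => //; apply: s1; apply: mem_head.
Qed.

Lemma finitely_supported_adjoin S c : subring S -> kp `<=` S ->
  finitely_supported S -> finitely_supported (adjoin S c).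
Proof.
move=> subS kS [s [sB Ss]].
have [s' [s'B H]] := finite_support_seq [seq x * c ^+ i | x <- s, i <- iota 0 p].
exists s'; split=> // x Ax.
have [|f [Sf szf ->]] := adjoin_small (prime_gt0 (pcharf_prime charp)) subS _ Ax.
  by apply: kS; exists c.
rewrite horner_coef; apply: pth_span_sum => i.
have lti : (i < p)%N by apply: leq_trans szf.
have [M0 MD MM] := pth_span_module [set` s'].
apply: (Ss _ (Sf i) [set y | pth_span [set` s'] (y * c ^+ i)]); split.
  split=> [|y z Hy Hz|a y ka Hy] /=; rewrite ?mul0r // ?mulrDl -?mulrA; first exact: MD.
  exact: MM.
move=> y /= ys; apply: H; apply/allpairsP; exists (y, nat_of_ord i); split=> //=.
by rewrite mem_iota.
Qed.

(** An element of B outside the finite support of S is not in S. *)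
Lemma finitely_supported_proper S : ~ countable B -> finitely_supported S ->
  exists c, ~ S c.
Proof.
move=> unctB [s [sB Ss]]; apply: contrapT => H.
have Sall c : S c by apply: contrapT => nS; case: H; exists c.
have [b [Bb bs]] : exists b, B b /\ b \notin s.
  apply: contrapT => H'; apply: unctB.
  apply: (@sub_countable _ _ _ [set` s]); last exact/finite_set_countable/finite_seq.
  apply: subset_card_le => b Bb /=; apply: contrapT => /negP bs; apply: H'.
  by exists b.
have [a [Fa bE]] : exists a : k -> k, (forall x, kp (a x)) /\
    b = \sum_(x <- undup s) a x * x.
  have subF := pth_powers_subring.
  apply: (Ss b (Sall b) [set b | exists a : k -> k, (forall x, kp (a x)) /\
    b = \sum_(x <- undup s) a x * x]); split; first split.
  - by exists (fun=> 0); split=> [x|]; [exact: subring0 subF | rewrite big1 // => x _; rewrite mul0r].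
  - move=> _ _ [a [Fa ->]] [a' [Fa' ->]]; exists (fun x => a x + a' x); split=> [x|].
      exact: subringD subF _ _ (Fa x) (Fa' x).
    by rewrite -big_split; apply: eq_bigr => x _; rewrite mulrDl.
  - move=> e _ Fe [a [Fa ->]]; exists (fun x => e * a x); split=> [x|].
      exact: subringM subF _ _ Fe (Fa x).
    by rewrite mulr_sumr; apply: eq_bigr => x _; rewrite mulrA.
  move=> y ys; exists (fun x => (x == y)%:R); split=> [x|].
    exact: subring_nat subF _.
  rewrite (bigD1_seq y) ?undup_uniq ?mem_undup //= eqxx mul1r big1 ?addr0 //.
  by move=> x /negbTE ->; rewrite mul0r.
have [indep _] := basisB; have subF := pth_powers_subring.
pose a' x := if x == b then -1 else a x.
have /eqP : a' b = 0.
  apply: (indep (b :: undup s)); rewrite ?mem_head //=.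
  - by rewrite mem_undup bs undup_uniq.
  - by move=> x; rewrite inE mem_undup => /orP[/eqP ->|/sB].
  - move=> x; rewrite /a'; case: eqP => _ //.
    exact: subringN subF _ (subring1 subF).
  rewrite big_cons {1}/a' eqxx mulN1r.
  rewrite (eq_big_seq (fun x => a x * x)); first by rewrite -bE addNr.
  move=> x; rewrite mem_undup /a' => xs; case: eqP => // xb.
  by move: bs; rewrite -xb xs.
by rewrite /a' eqxx oppr_eq0 oner_eq0.
Qed.

Lemma pth_independent_sequence : ~ countable B ->
  exists b : nat -> k, forall n, ~ gen_upto b kp n (b n).
Proof.
move=> unctB.
have next (S : set k) : exists c, finitely_supported S -> ~ S c.
  have [/(finitely_supported_proper unctB)[c nc]|nf] := pselect (finitely_supported S).
    by exists c.
  by exists 0.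
have [c cP] := choice next.
pose S := fix S n := if n is m.+1 then adjoin (S m) (c (S m)) else kp.
have SP n : [/\ subring (S n), kp `<=` S n & finitely_supported (S n)].
  elim: n => [|n [subS kS fS]].
    by split=> //; [exact: pth_powers_subring | exact: finitely_supported_pth].
  split; first exact: subring_adjoin.
    exact: subset_trans kS (sub_adjoin subS _).
  exact: finitely_supported_adjoin.
have Sle m n : (m <= n)%N -> S m `<=` S n.
  move=> /subnK <-; elim: (n - m)%N => // j IH.
  apply: subset_trans IH _; rewrite addSn /=.
  by have [subS _ _] := SP (j + m)%N; apply: sub_adjoin.
exists (fun n => c (S n)) => n Hn; have [subS kS fS] := SP n.
apply: (cP _ fS); apply: (ring_gen_min subS _ Hn).
move=> x [/kS //|[i /= ltin <-]]; apply: (Sle i.+1 n ltin).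
by have [subSi _ _] := SP i; apply: mem_adjoin.
Qed.

End InfiniteDegree.

Section CharP.
Variables (V : idomainType) (k : fieldType) (res : {rmorphism V -> k}).
Hypotheses (Vcomplete : complete_local V) (Vres : residue_map res).
Variables (t : V) (unift : uniformizer t).
Variables (p : nat) (charV : p \in [pchar V]).
Local Notation F := {fraction V}.
Local Notation frac := (@tofrac V).
Local Notation tpow := (tpow t).
Implicit Types E : set V.

Let res0 v : res v = 0 <-> tpow 1 v. Proof. exact: (res_eq0 unift Vres). Qed.
Let chark : p \in [pchar k].
Proof. exact: (rmorph_pchar res charV). Qed.
Let p_gt0 : (0 < p)%N. Proof. exact/prime_gt0/(pcharf_prime charV). Qed.
Let res_t v : res (t * v) = 0.
Proof. by apply/res0; exists v; rewrite expr1. Qed.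

(** Subrings that, like the ring of pth powers with t adjoined, are discrete
    valuation rings with uniformizer t dominated by V. *)
Definition saturated E :=
  [/\ subring E, forall x, E (x ^+ p), E t & forall y, E (t * y) -> E y].

Lemma res_subring E : saturated E -> subring (res @` E) /\ forall c, (res @` E) (c ^+ p).
Proof.
move=> [subE Ep _ _]; split=> [|c].
  exact: subring_image.
have [v _ <-] : range res c by rewrite Vres.
by exists (v ^+ p); rewrite ?rmorphXn.
Qed.

Lemma saturatedX E n y : saturated E -> E (t ^+ n * y) -> E y.
Proof.
move=> [_ _ _ sat]; elim: n y => [|n IH] y; first by rewrite mul1r.
by rewrite exprS -mulrA => /sat/IH.
Qed.

(** A relation modulo t over E has coefficients divisible by t, because the
    residue of z has degree p over the residue field of E. *)
Lemma saturated_adjoin E z : saturated E -> ~ (res @` E) (res z) -> saturated (adjoin E z).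
Proof.
move=> satE nz; have [subE Ep Et sat] := satE; have [subR Rp] := res_subring satE.
have EA := sub_adjoin subE z.
split; [exact: subring_adjoin | by move=> x; apply: EA | exact: EA |].
move=> y /(adjoin_small p_gt0 subE (Ep z))[f [Ef szf yE]].
have f0 : map_poly res f = 0.
  apply: (pth_subring_small chark subR Rp nz).
  - by move=> j; rewrite coef_map /=; exists f`_j.
  - by rewrite horner_map -yE res_t.
  - exact: leq_trans (size_poly _ _) szf.
have div j : exists g, f`_j = t * g.
  have /polyP/(_ j) := f0; rewrite coef_map coef0 /= => /res0[g].
  by rewrite expr1; exists g.
have [g gE] := choice div.
exists (\poly_(j < p) g j).
  move=> j; rewrite coef_poly; case: ifP => _; last exact: subring0 subE.
  by apply: sat; rewrite -gE.
apply: (mulfI (t_neq0 unift)); rewrite yE horner_poly (horner_coef_wide _ szf) mulr_sumr.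
by apply: eq_bigr => j _; rewrite gE mulrA.
Qed.

Definition pth_ring : set V := adjoin (range (fun x => x ^+ p)) t.

(** An element f(t) divisible by t, with pth powers u_j^p as coefficients, has
    u_0 divisible by t, so that u_0^p / t lies in the ring again. *)
Lemma saturated_pth : saturated pth_ring /\ res @` pth_ring = @pth_powers k p.
Proof.
have subP : subring (range (fun x : V => x ^+ p)).
  exact: (subring_range (pFrobenius_aut charV)).
have subA := subring_adjoin subP t.
have PA := sub_adjoin subP t.
have tA := mem_adjoin subP t.
split; last first.
  rewrite /pth_ring (adjoin_subring _ subP) ring_gen_image image_setU image_set1.
  have -> : res t = 0 by rewrite -[t]mulr1.
  have -> : res @` range (fun x : V => x ^+ p) = @pth_powers k p.
    apply/seteqP; split=> [_ [_ [x _ <-] <-]|_ [c _ <-]].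
      by exists (res x); rewrite ?rmorphXn.
    have [v _ <-] : range res c by rewrite Vres.
    by exists (v ^+ p); [exists v | rewrite rmorphXn].
  have subk := pth_powers_subring chark.
  apply/seteqP; split; last by move=> x kx; apply: sub_ring_gen; left.
  by apply: ring_gen_min => // x [|->] //; apply: subring0 subk.
split; [exact: subA | by move=> x; apply: PA; exists x | exact: tA |].
move=> y [f Pf fE].
have [v _ v0] := Pf 0%N.
have /res0[u] : res v = 0.
  have rt : res t = 0 by rewrite -[t]mulr1.
  have : res (f.[t]) = 0 by rewrite fE res_t.
  rewrite -horner_map rt horner_coef0 coef_map /= -v0 rmorphXn => /eqP.
  by rewrite expf_eq0 => /andP[_ /eqP].
rewrite expr1 => vE.
have /factor_theorem[g gE] : root (f - (f`_0)%:P) 0.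
  by rewrite /root !hornerE horner_coef0 subrr.
rewrite subr0 in gE.
have Pg j : range (fun x : V => x ^+ p) g`_j.
  have := Pf j.+1; rewrite -[f](subrK (f`_0)%:P) gE coefD coefMX coefC /=.
  by rewrite addr0.
have -> : y = g.[t] + t ^+ p.-1 * u ^+ p.
  apply: (mulfI (t_neq0 unift)); rewrite -fE -[f](subrK (f`_0)%:P) gE -v0 vE.
  rewrite hornerD hornerMX hornerC exprMn mulrDr mulrA -exprS prednK //.
  by rewrite mulrC.
apply: (subringD subA); first by exists g.
apply: (subringM subA); first exact: subringX subA _ _ tA.
by apply: PA; exists u.
Qed.

Section Maximal.
Variable b : nat -> k.
Hypothesis b_indep : forall n, ~ gen_upto b (@pth_powers k p) n (b n).

Definition independent_over E := saturated E /\ forall n, ~ gen_upto b (res @` E) n (b n).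

Lemma independent_chain (G : set (set V)) : G !=set0 -> total_on G subset ->
  (forall X, G X -> independent_over X) -> independent_over (\bigcup_(X in G) X).
Proof.
move=> G0 tot good; split; first split.
- by apply: subring_chain => // X /good[[]].
- by move=> x; have [X GX] := G0; exists X => //; have [[]] := good X GX.
- by have [X GX] := G0; exists X => //; have [[]] := good X GX.
- by move=> y [X GX Xy]; exists X => //; have [[_ _ _ sat] _] := good X GX; apply: sat.
move=> n bn.
have [_ [X GX <-]] : (\bigcup_(Y in [set gen_upto b (res @` X) n | X in G]) Y) (b n).
  apply: (ring_gen_min _ _ bn).
    apply: subring_chain.
    - by have [X GX] := G0; exists (gen_upto b (res @` X) n), X.
    - by move=> _ [X GX <-]; apply: ring_gen_subring.
    move=> _ _ [X GX <-] [Y GY <-].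
    by have [s|s] := tot _ _ GX GY; [left|right]; apply: ring_gen_mono; apply: setSU;
      apply: image_subset.
  move=> c [[v [X GX Xv] <-]|bc].
    by exists (gen_upto b (res @` X) n); [exists X | apply: sub_ring_gen; left; exists v].
  have [X GX] := G0.
  by exists (gen_upto b (res @` X) n); [exists X | apply: sub_ring_gen; right].
by have [_] := good X GX; apply.
Qed.

(** A maximal subring among those keeping the b_n p-independent is as large as
    its residues can be: together with lifts of the b_n it represents all of
    k. *)
Lemma maximal_independent : exists2 E, independent_over E &
  forall E', independent_over E' -> E `<=` E' -> E' `<=` E.
Proof.
have [satP resP] := saturated_pth.
have goodP : independent_over pth_ring by split=> // n; rewrite resP.
by have [|E [goodE _ maxE]] := maximal_above goodP; [exact: independent_chain | exists E].
Qed.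

Variable E : set V.
Hypothesis goodE : independent_over E.
Hypothesis maxE : forall E', independent_over E' -> E `<=` E' -> E' `<=` E.
Variable B : nat -> V.
Hypothesis resB : forall n, res (B n) = b n.

Let satE : saturated E. Proof. by case: goodE. Qed.
Let subE : subring E. Proof. by case: satE. Qed.

Local Notation stage := (gen_upto B E).
Definition limit_ring : set V := ring_gen (E `|` range B).

Lemma res_stage r : res @` stage r = gen_upto b (res @` E) r.
Proof.
rewrite ring_gen_image image_setU; congr (ring_gen (_ `|` _)).
apply/seteqP; split=> [_ [_ [i ii <-] <-]|_ [i ii <-]].
  by exists i; rewrite ?resB.
by exists (B i); [exists i | rewrite resB].
Qed.

(** Exchange: a residue c outside the limit could be adjoined to E, for if b n
    became dependent on c and the earlier b i over E, then c would depend on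
    b 0, ..., b n. *)
Lemma limit_residue c : exists2 a, limit_ring a & res a = c.
Proof.
have subR := (res_subring satE).1.
have Rp n x : gen_upto b (res @` E) n (x ^+ p).
  by apply: sub_ring_gen; left; apply: (res_subring satE).2.
have sub_limit n : stage n `<=` limit_ring.
  by apply: ring_gen_mono; apply: setUS => _ [i _ <-]; exists i.
suff [n [a Sa ac]] : exists n, (res @` stage n) c by exists a => //; apply: sub_limit Sa.
apply: contrapT => nc.
have nR n : ~ gen_upto b (res @` E) n c by rewrite -res_stage => Hn; apply: nc; exists n.
have [v _ vc] : range res c by rewrite Vres.
have nrv : ~ (res @` E) (res v).
  by rewrite vc => Ec; apply: (nR 0%N); apply: sub_ring_gen; left.
have satE' := saturated_adjoin satE nrv.
have nEv : ~ E v by move=> Ev; apply: nrv; exists v.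
have [n bn] : exists n, gen_upto b (res @` adjoin E v) n (b n).
  apply: contrapT => H; apply: nEv; apply: (maxE (E' := adjoin E v)).
  - by split=> // n bn; apply: H; exists n.
  - exact: sub_adjoin.
  - exact: mem_adjoin.
set K := gen_upto b (res @` E) n.
have subK : subring K by apply: ring_gen_subring.
have {}bn : adjoin K c (b n).
  apply: (ring_gen_min (subring_adjoin subK c) _ bn) => x [|bx]; last first.
    by apply: (sub_adjoin subK); apply: sub_ring_gen; right.
  move=> [w + <-]; rewrite (adjoin_subring _ subE); move: w.
  suff H : ring_gen (E `|` [set v]) `<=` res @^-1` adjoin K c by move=> w /H.
  apply: ring_gen_min; first exact/subring_preimage/subring_adjoin.
  move=> w [Ew|->]; last by rewrite /preimage /= vc; apply: mem_adjoin.
  by apply: (sub_adjoin subK); apply: sub_ring_gen; left; exists w.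
have [f [Kf szf bE]] := adjoin_small p_gt0 subK (Rp n c) bn.
have subKb : subring (gen_upto b (res @` E) n.+1) by apply: ring_gen_subring.
have : f - (b n)%:P = 0.
  apply: (pth_subring_small chark subKb (Rp n.+1) (nR n.+1)).
  - move=> i; rewrite coefB coefC; apply: (subringB subKb).
      by apply: (gen_upto_mono (leqnSn n)); apply: Kf.
    case: eqP => _; last exact: subring0 subKb.
    exact: mem_gen_upto.
  - by rewrite !hornerE -bE subrr.
  - apply: leq_trans (size_polyD _ _) _; rewrite size_polyN geq_max szf.
    exact: leq_trans (size_polyC_leq1 _) p_gt0.
move/eqP; rewrite subr_eq0 => /eqP fE.
have := Kf 0%N; rewrite fE coefC /=; have [_] := goodE; exact.
Qed.

(** The blocks 2^i, ..., 2^i + i of B supply the coefficients of t^i, so that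
    the first coefficients of z 0, ..., z n lie in a finite stage over which the
    next ones are independent. *)
Definition block_coef j i : V := if (j <= i)%N then B (2 ^ i + j) else 0.
Definition block_series j : V :=
  sval (cid (complete_series unift Vcomplete (block_coef j))).
Local Notation z := block_series.

Lemma block_tail j r : (j <= r)%N -> exists y w,
  [/\ z j = y + t ^+ r * w, stage (2 ^ r) y & res w = b (2 ^ r + j)].
Proof.
move=> lejr; have zP := svalP (cid (complete_series unift Vcomplete (block_coef j))).
have := zP r.+1; rewrite -/(z j) big_ord_recr /= => -[u uE].
exists (\sum_(i < r) block_coef j i * t ^+ i), (block_coef j r + t * u); split.
- move: uE; rewrite exprSr => /eqP; rewrite subr_eq => /eqP ->; ring.
- have subS : subring (stage (2 ^ r)) by apply: ring_gen_subring.
  have [_ _ Et _] := satE.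
  have St : stage (2 ^ r) t by apply: sub_ring_gen; left.
  apply: (subring_sum subS) => i _; apply: (subringM subS); last exact: (subringX subS).
  rewrite /block_coef; case: leqP => leji; last exact: subring0 subS.
  apply: mem_gen_upto; apply: (@leq_trans (2 ^ i.+1)); last by rewrite leq_exp2l.
  rewrite expnS mul2n -addnn ltn_add2l; apply: leq_ltn_trans leji _.
  exact: ltn_expl.
by rewrite rmorphD res_t addr0 /block_coef lejr resB.
Qed.

Local Notation tower := (gen_upto z limit_ring).

(** A relation involves a finite stage. Adjoining to it the tails of z_0, ...,
    z_(n-1) beyond a high power of t keeps it saturated, since the residues of
    the tails are p-independent. Saturation would then put the tail of z_n
    into this ring as well, although its residue is independent of the others. *)
Lemma block_series_independent n N : ~ tower n (t ^+ N * z n).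
Proof.
move=> Hn; pose zs : set V := [set z j | j in [set j | (j < n)%N]].
have [_ [r _ <-] Hr] : (\bigcup_(Y in range (fun r => ring_gen (stage r `|` zs))) Y) (t ^+ N * z n).
  have subU : subring (\bigcup_(Y in range (fun r => ring_gen (stage r `|` zs))) Y).
    apply: subring_chain.
    - by exists (ring_gen (stage 0 `|` zs)), 0%N.
    - by move=> _ [r _ <-]; apply: ring_gen_subring.
    move=> _ _ [r _ <-] [s _ <-].
    have [lers|/ltnW lesr] := leqP r s; [left|right]; apply: ring_gen_mono; apply: setSU;
      exact: gen_upto_mono.
  have in_stage r x : stage r x -> (\bigcup_(Y in range (fun r => ring_gen (stage r `|` zs))) Y) x.
    by move=> Sx; exists (ring_gen (stage r `|` zs)); [exists r | apply: sub_ring_gen; left].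
  apply: (ring_gen_min subU _ Hn) => x [|zx]; last first.
    by exists (ring_gen (stage 0 `|` zs)); [exists 0%N | apply: sub_ring_gen; right].
  apply: (ring_gen_min subU) => y [Ey|[i _ <-]].
    by apply: (in_stage 0%N); apply: sub_ring_gen; left.
  by apply: (in_stage i.+1); apply: sub_ring_gen; right; exists i => /=.
pose q := maxn r n.
have ler : (r <= 2 ^ q)%N.
  by apply: leq_trans (leq_maxl r n) _; apply/ltnW/ltn_expl.
have lenq : (n <= q)%N by apply: leq_maxr.
have tails j : exists yw : V * V, (j <= q)%N ->
    [/\ z j = yw.1 + t ^+ q * yw.2, stage (2 ^ q) yw.1 & res yw.2 = b (2 ^ q + j)].
  have [lej|ltj] := leqP j q; last by exists (0, 0).
  by have [y [w H]] := block_tail lej; exists (y, w).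
have [yw ywP] := choice tails.
(* adjoin to the stage 2^q the tails of the series, one by one *)
pose H := fix H j := if j is i.+1 then adjoin (H i) (yw i).2 else stage (2 ^ q).
have satS m : saturated (stage m) /\ res @` stage m = gen_upto b (res @` E) m.
  split; last exact: res_stage.
  elim: m => [|m IH]; first by rewrite gen_upto0.
  by rewrite gen_uptoS; apply: saturated_adjoin => //; rewrite resB res_stage; have [_] := goodE; apply.
have HP j : (j <= q.+1)%N -> saturated (H j) /\ res @` H j = gen_upto b (res @` E) (2 ^ q + j).
  elim: j => [|j IH] lej; first by rewrite addn0; apply: satS.
  have [satH resH] := IH (ltnW lej); have [_ _ rw] := ywP j lej.
  have subH : subring (H j) by case: satH.
  split.
    apply: saturated_adjoin => //; rewrite rw resH.
    by have [_] := goodE; apply.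
  rewrite /= (adjoin_subring _ subH) ring_gen_image image_setU image_set1 resH rw.
  by rewrite addnS gen_uptoS adjoin_subring //; apply: ring_gen_subring.
have [satH resH] := HP n (leq_trans lenq (leqnSn q)).
have subH : subring (H n) by case: satH.
have stageH j : (j <= q.+1)%N -> stage (2 ^ q) `<=` H j.
  elim: j => [_ x //|j IH lej]; apply: subset_trans (IH (ltnW lej)) _.
  by apply: sub_adjoin; have [[]] := HP j (ltnW lej).
have Hle i j : (i <= j)%N -> (j <= q.+1)%N -> H i `<=` H j.
  move=> leij; elim: j leij => [|j IH]; first by rewrite leqn0 => /eqP -> _ x.
  rewrite leq_eqVlt => /orP[/eqP -> _ x //|ltij lej]; apply: subset_trans (IH ltij (ltnW lej)) _.
  by apply: sub_adjoin; have [[]] := HP j (ltnW lej).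
have lenq1 : (n <= q.+1)%N by apply: leq_trans lenq _.
have HtX i : H n (t ^+ i) by apply: (subringX subH); case: satH.
have zH : H n (z n).
  apply: (@saturatedX _ N) => //; apply: (ring_gen_min subH _ Hr) => x [Sx|[j /= ltj <-]].
    by apply: (stageH n lenq1); apply: gen_upto_mono Sx.
  have lejq : (j <= q)%N by apply: leq_trans (ltnW ltj) lenq.
  have [-> Sy _] := ywP j lejq; apply: (subringD subH); first exact: stageH.
  apply: (subringM subH) => //; apply: (Hle j.+1 n) => //.
  by apply: mem_adjoin; have [[]] := HP j (leq_trans lejq (leqnSn q)).
have [zE Sy rw] := ywP n lenq.
have : H n (yw n).2.
  apply: (@saturatedX _ q) => //.
  have -> : t ^+ q * (yw n).2 = z n - (yw n).1 by rewrite zE addrAC subrr add0r.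
  by apply: (subringB subH) => //; apply: stageH.
move=> Hw; have [_ /(_ (2 ^ q + n)%N)] := goodE; apply.
by rewrite -rw -resH; exists (yw n).2.
Qed.

Definition localized (S : set V) : set F :=
  [set q | exists N v, S v /\ q * frac t ^+ N = frac v].

Lemma localized_subring S : subring S -> S t -> subring (localized S).
Proof.
move=> subS St; have SX n : S (t ^+ n) by apply: (subringX subS).
split.
- by exists 0%N, 1; rewrite tofrac1 mulr1; split=> //; apply: subring1 subS.
- move=> x y [m [v [Sv xv]]] [n [w [Sw yw]]].
  exists (m + n)%N, (v * t ^+ n - w * t ^+ m); split.
    by apply: (subringB subS); apply: (subringM subS).
  by rewrite tofracB !tofracM !tofracXn -xv -yw exprD; ring.
- move=> x y [m [v [Sv xv]]] [n [w [Sw yw]]].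
  exists (m + n)%N, (v * w); split; first exact: (subringM subS).
  by rewrite tofracM -xv -yw exprD; ring.
Qed.

(** After inverting t the tower contains all pth powers of F, so that
    separably algebraic over it means contained in it. *)
Theorem maximal_bad_domains : bad_domains_exist V.
Proof.
have limit_sub n : limit_ring `<=` tower n by apply: sub_gen_upto.
have E_limit : E `<=` limit_ring by move=> x Ex; apply: sub_ring_gen; left.
have [_ Ep Et _] := satE.
have subT n : subring (tower n) by apply: ring_gen_subring.
have loc n v : tower n v -> localized (tower n) (frac v).
  by move=> Tv; exists 0%N, v; rewrite mulr1.
have charF : p \in [pchar F] := rmorph_pchar (@tofrac V) charV.
have locp n (q : F) : localized (tower n) (q ^+ p).
  have [N [v E']] := fraction_tpow unift q; exists (N * p)%N, (v ^+ p); split.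
    by apply: limit_sub; apply: E_limit.
  by rewrite exprM -exprMn E' tofracXn.
have subL n : subring (localized (tower n)).
  by apply: localized_subring => //; apply: limit_sub; apply: E_limit.
apply: (@bad_domains_of_tower V k res t unift Vres (fun n => localized (tower n)) z) => //.
- move=> n q [N [v [Tv E']]]; exists N, v; split=> //.
  exact: gen_upto_mono Tv.
- by right; exists p.
- by apply: loc; apply: limit_sub; apply: E_limit.
- move=> c; have [a La ac] := limit_residue c; exists a => //.
  by apply: loc; apply: limit_sub.
- by move=> n; apply: loc; apply: mem_gen_upto.
move=> n /(pth_subring_sep_alg charF (subL n) (locp n))[N [v [Tv]]].
rewrite mulrC -tofracXn -tofracM => /eqP; rewrite tofrac_eq => /eqP zv.
by apply: (@block_series_independent n N); rewrite zv.
Qed.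

End Maximal.

Theorem char_p_bad_domains : uncountable_degree (@pth_powers k p) -> bad_domains_exist V.
Proof.
move=> [X [basisX unctX]].
have [b b_indep] := pth_independent_sequence chark basisX unctX.
have [E goodE maxE] := maximal_independent b_indep.
have lift n : exists v, res v = b n.
  have [v _ vb] : range res (b n) by rewrite Vres.
  by exists v.
have [B resB] := choice lift.
exact: (maximal_bad_domains goodE maxE resB).
Qed.

End CharP.

(** * Expansions in pth powers *)

Section PthPowers.
Variables (T : comNzRingType) (p : nat) (charT : p \in [pchar T]).

Lemma pth_powD (x y : T) : (x + y) ^+ p = x ^+ p + y ^+ p.
Proof. by rewrite -!(pFrobenius_autE charT) (pFrobenius_autD_comm _ (mulrC _ _)). Qed.

Lemma pth_pow_sum (I : Type) (r : seq I) (f : I -> T) :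
  (\sum_(j <- r) f j) ^+ p = \sum_(j <- r) f j ^+ p.
Proof.
apply: (big_morph _ pth_powD).
by rewrite expr0n gtn_eqF // prime_gt0 // (pcharf_prime charT).
Qed.

Lemma pth_pow_iter_sum e (I : Type) (r : seq I) (f : I -> T) :
  (\sum_(j <- r) f j) ^+ (p ^ e) = \sum_(j <- r) f j ^+ (p ^ e).
Proof.
elim: e => [|e IH]; first by rewrite expn0 expr1; apply: eq_bigr => j _; rewrite expr1.
rewrite expnSr exprM IH pth_pow_sum; apply: eq_bigr => j _.
by rewrite exprM.
Qed.

End PthPowers.

Section FrobeniusExpansion.
Variables (V : idomainType) (k : fieldType) (res : {rmorphism V -> k}).
Hypotheses (Vcomplete : complete_local V) (Vres : residue_map res).
Variables (t : V) (unift : uniformizer t) (p : nat) (charV : p \in [pchar V]).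
Variable coef : {rmorphism k -> V}.
Hypotheses (coefK : cancel coef res) (perfect : @pth_powers k p = setT).
Local Notation tpow := (tpow t).

Let p_gt0 : (0 < p)%N. Proof. exact/prime_gt0/(pcharf_prime charV). Qed.

(** A valuation is multiplicative. *)
Lemma tpow_root n M v : (0 < n)%N -> tpow (n * M) (v ^+ n) -> tpow M v.
Proof.
move=> n0 Hv; have [->|v0] := eqVneq v 0; first exact: tpow0.
have [_ _ /(_ v v0)[w [u [uu vE]]]] := unift.
have [leM|ltM] := leqP M w; first by apply: tpowW leM _; exists u.
have : tpow (n * w).+1 (v ^+ n).
  by apply: tpowW Hv; rewrite ltn_pmul2l.
rewrite vE exprMn -exprM [(w * n)%N]mulnC -addn1 => /(tpow_cancel unift).
by move/(tpow1_nonunit unift); rewrite unitrX.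
Qed.

Lemma p_digits q v : exists (f : nat -> V) w,
  v = \sum_(j < q) t ^+ j * f j ^+ p + t ^+ q * w.
Proof.
elim: q => [|q [f [w ->]]]; first by exists (fun=> 0), v; rewrite big_ord0 expr0 mul1r add0r.
have [c _ cE] : @pth_powers k p (res w) by rewrite perfect.
have [|u uE] := (res_eq0 unift Vres (w - coef c ^+ p)).1.
  by rewrite rmorphB rmorphXn /= coefK cE subrr.
exists (fun j => if j == q then coef c else f j), u.
rewrite big_ord_recr /= eqxx.
rewrite [in RHS](eq_bigr (fun j : 'I_q => t ^+ j * f j ^+ p)); last first.
  by move=> j _ /=; rewrite (ltn_eqF (ltn_ord j)).
rewrite -addrA; congr (_ + _); rewrite exprSr -mulrA -mulrDr; congr (_ * _).
by rewrite -[t]expr1 -uE addrC subrK.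
Qed.

(** V is free over its subring of pth powers on the first p powers of t: V is
    the ring of power series in t over a perfect field. *)
Lemma frobenius_basis v : exists f : 'I_p -> V, v = \sum_(j < p) t ^+ j * f j ^+ p.
Proof.
have [D HD] := choice (p_digits p).
pose u := fix u n := if n is m.+1 then sval (cid (HD (u m))) else v.
have uE n : u n = \sum_(j < p) t ^+ j * D (u n) j ^+ p + t ^+ p * u n.+1.
  exact: svalP (cid (HD (u n))).
have series j := complete_series unift Vcomplete (fun n => D (u n) j).
have [f fE] := choice series.
exists (fun j => f j); apply/eqP; rewrite -subr_eq0; apply/eqP.
apply: (tpow_separated unift) => N; apply: (@tpowW _ _ N (p * N)).
  exact: leq_pmull.
have -> : v = \sum_(j < p) t ^+ j * (\sum_(n < N) D (u n) j * t ^+ n) ^+ p + t ^+ (p * N) * u N.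
  elim: N => [|N IH].
    rewrite big1 ?muln0 ?expr0 ?mul1r ?add0r // => j _.
    by rewrite big_ord0 expr0n gtn_eqF // mulr0.
  rewrite {1}IH {1}uE mulrDr addrA mulrA -exprD -mulnSr; congr (_ + _).
  rewrite mulr_sumr -big_split; apply: eq_bigr => j _.
  rewrite big_ord_recr (pth_powD charV) /= mulrDr; congr (_ + _).
  by rewrite exprMn -exprM [(N * p)%N]mulnC; ring.
rewrite addrAC -sumrB; apply: tpowD; last by exists (u N).
apply: tpow_sum => j _; rewrite -mulrBr; apply: tpowMl.
rewrite -!(pFrobenius_autE charV) -(pFrobenius_autB_comm _ (mulrC _ _)) pFrobenius_autE.
rewrite mulnC; apply: tpowX; rewrite -opprB; apply: tpowN; exact: fE.
Qed.

(** The values of the terms t^j y_j^p differ modulo p, hence nothing cancels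
    in the sum. *)
Lemma frobenius_basis_div M (y : 'I_p -> V) :
  tpow (p * M) (\sum_(j < p) t ^+ j * y j ^+ p) -> forall j, tpow M (y j).
Proof.
elim: M y => [|M IH] y Hy j; first exact: tpowP0.
have first q : (q <= p)%N -> forall z : nat -> V,
    tpow q (\sum_(l < q) t ^+ l * z l ^+ p) -> forall l, (l < q)%N -> tpow 1 (z l).
  elim: q => [//|q IHq] leq z Hz.
  have lower l : (l < q)%N -> tpow 1 (z l).
    apply: IHq; first exact: ltnW.
    have := tpowW (leqnSn q) Hz; rewrite big_ord_recr /= => H.
    have := tpowB H (tpowMr (z q ^+ p) (tpow_tX t q)).
    by rewrite addrK.
  move=> l; rewrite ltnS leq_eqVlt => /orP[/eqP ->|]; last exact: lower.
  apply/(tpow1_nonunit unift); rewrite -(unitrX_pos _ p_gt0).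
  apply/(tpow1_nonunit unift); apply: (tpow_cancel unift (m := q)); rewrite addn1.
  move: Hz; rewrite big_ord_recr /= => H.
  have Hlow : tpow q.+1 (\sum_(l < q) t ^+ l * z l ^+ p).
    apply: tpow_sum => l0 _; apply: (@tpowW _ _ _ (l0 + 1 * p)).
      by rewrite mul1n; apply: leq_trans leq _; apply: leq_addl.
    by apply: tpowM; [apply: tpow_tX | apply/tpowX/lower].
  by have := tpowB H Hlow; rewrite addrAC subrr add0r.
pose z l := if insub l is Some o then y o else 0.
have zy (l : 'I_p) : z l = y l by rewrite /z valK.
have div l : exists w, y l = t * w.
  have [|w] := first p (leqnn p) z _ l (ltn_ord l); last by rewrite zy expr1; exists w.
  under eq_bigr do rewrite zy.
  by apply: tpowW Hy; rewrite leq_pmulr.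
have [w wE] := choice div.
have [|v vE] := IH w _ j; last by exists v; rewrite wE vE exprS mulrA.
apply: (tpow_cancel unift (m := p)); rewrite -mulnS mulr_sumr.
move: Hy; rewrite (eq_bigr (fun l : 'I_p => t ^+ p * (t ^+ l * w l ^+ p))) // => l _.
by rewrite wE exprMn; ring.
Qed.

End FrobeniusExpansion.

(** * Analytic ramification over a perfect field *)

Lemma noetherian_max (R : comNzRingType) (Q : set R -> Prop) : noetherian R ->
  (exists2 I, is_ideal I & Q I) ->
  exists I, [/\ is_ideal I, Q I & forall J, is_ideal J -> Q J -> I `<=` J -> J `<=` I].
Proof.
move=> noeth [I0 idI0 QI0]; apply: contrapT => nomax.
have next (I : set R) : exists J, is_ideal I /\ Q I ->
    [/\ is_ideal J, Q J, I `<=` J & ~ (J `<=` I)].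
  have [[idI QI]|nI] := pselect (is_ideal I /\ Q I); last by exists I0.
  apply: contrapT => H; apply: nomax; exists I; split=> // J idJ QJ IJ.
  by apply: contrapT => nJI; apply: H; exists J.
have [f fP] := choice next.
pose u := fix u n := if n is m.+1 then f (u m) else I0.
have uP n : is_ideal (u n) /\ Q (u n).
  by elim: n => [//|n IH]; have [] := fP _ IH.
have uS n : u n `<=` u n.+1 by have [] := fP _ (uP n).
have ule m n : (m <= n)%N -> u m `<=` u n.
  move=> /subnK <-; elim: (n - m)%N => // j IH.
  exact: subset_trans IH (uS _).
pose U := [set x | exists n, u n x].
have idU : is_ideal U.
  split=> [|x y [m ux] [n uy]|a x [n ux]].
  - by exists 0%N; have [[]] := uP 0%N.
  - exists (maxn m n); have [[_ D _] _] := uP (maxn m n).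
    by apply: D; [apply: ule ux; apply: leq_maxl | apply: ule uy; apply: leq_maxr].
  - by exists n; have [[_ _ M] _] := uP n; apply: M.
have [q [g gE]] := noeth U idU.
have gU j : U (g j) by rewrite gE; apply: sub_ideal_span; exists j.
have [N NP] := choice gU.
pose M := (\max_j N j)%N; have [_ _ _] := fP _ (uP M); apply => x ux.
have : U x by exists M.+1.
rewrite gE; apply; split; first by have [] := uP M.
by move=> _ [j _ <-]; apply: ule (NP j); apply: leq_bigmax.
Qed.

Section Unramified.
Variables (V : idomainType) (k : fieldType) (res : {rmorphism V -> k}).
Hypotheses (Vcomplete : complete_local V) (Vres : residue_map res).
Variables (t : V) (unift : uniformizer t) (p : nat) (charV : p \in [pchar V]).
Variable coef : {rmorphism k -> V}.
Hypotheses (coefK : cancel coef res) (perfect : @pth_powers k p = setT).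
Local Notation tpow := (tpow t).

Variables (R : idomainType) (i : {rmorphism R -> V}).
Hypothesis i_inj : injective i.
Hypothesis i_frac : forall v, exists a b, b != 0 /\ i b * v = i a.
Hypothesis i_integral : forall v, exists2 q, q \is monic & (map_poly i q).[v] = 0.
Hypothesis i_coef : forall c, exists r, i r = coef c.
Hypothesis noethR : noetherian R.

Let p_gt0 : (0 < p)%N. Proof. exact/prime_gt0/(pcharf_prime charV). Qed.
Let i_eq0 r : (i r == 0) = (r == 0).
Proof. by rewrite -(rmorph0 i) (inj_eq i_inj). Qed.
Let charR : p \in [pchar R].
Proof.
have [p_pr /eqP p0] := andP charV; rewrite inE /= p_pr /=.
by rewrite -i_eq0 rmorph_nat p0.
Qed.

Definition kappa c : R := sval (cid (i_coef c)).
Lemma kappaE c : i (kappa c) = coef c. Proof. exact: svalP (cid (i_coef c)). Qed.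
Lemma kappa0 : kappa 0 = 0. Proof. by apply: i_inj; rewrite kappaE !rmorph0. Qed.
Lemma kappa1 : kappa 1 = 1. Proof. by apply: i_inj; rewrite kappaE !rmorph1. Qed.
Lemma kappaD c d : kappa (c + d) = kappa c + kappa d.
Proof. by apply: i_inj; rewrite rmorphD !kappaE rmorphD. Qed.
Lemma kappaM c d : kappa (c * d) = kappa c * kappa d.
Proof. by apply: i_inj; rewrite rmorphM !kappaE rmorphM. Qed.
Lemma kappa_sum (I : Type) (r : seq I) (f : I -> k) :
  kappa (\sum_(j <- r) f j) = \sum_(j <- r) kappa (f j).
Proof. exact: (big_morph kappa kappaD kappa0). Qed.
Lemma kappaV c : c != 0 -> kappa c^-1 * kappa c = 1.
Proof. by move=> c0; rewrite -kappaM mulVf // kappa1. Qed.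

Local Notation contraction := (overring_max i t).

Lemma contraction_split r : exists c r', contraction r' /\ r = kappa c + r'.
Proof.
exists (res (i r)), (r - kappa (res (i r))); split; last by rewrite addrC subrK.
apply/(res_eq0 unift Vres); rewrite rmorphB kappaE rmorphB coefK.
by rewrite subrr.
Qed.

(** Clear denominators in the equation of integrality of z = y / s. *)
Lemma integral_quotient q h s y z : q \is monic -> size q = h.+1 ->
  (map_poly i q).[z] = 0 -> i y = i s * z -> exists w, y ^+ h = s * w.
Proof.
move=> mq szq qz yE.
have lead : q`_h = 1 by have /monicP := mq; rewrite lead_coefE szq.
exists (- \sum_(j < h) q`_j * s ^+ (h - j).-1 * y ^+ j); apply: i_inj.
have : \sum_(j < h.+1) i q`_j * z ^+ j = 0.
  rewrite -[RHS]qz (@horner_coef_wide _ h.+1); first by apply: eq_bigr => j _; rewrite coef_map.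
  by rewrite -szq size_poly.
rewrite big_ord_recr /= lead rmorph1 mul1r => /eqP; rewrite addrC addr_eq0 => /eqP zh.
rewrite rmorphM rmorphN rmorph_sum rmorphXn /= yE exprMn zh !mulrN; congr (- _).
rewrite !mulr_sumr; apply: eq_bigr => j _; rewrite !rmorphM !rmorphXn /= yE exprMn.
have -> : i s ^+ h = i s * (i s ^+ (h - j).-1 * i s ^+ j).
  rewrite -exprD -exprS; congr (_ ^+ _); have := ltn_ord j; move: (nat_of_ord j); lia.
ring.
Qed.

(** Units of V in R are units of R, because V is integral over R: this is what
    makes R local. *)
Lemma integral_unit r : i r \is a GRing.unit -> exists s, s * r = 1.
Proof.
move=> ur; have [q mq qz] := i_integral (i r)^-1.
have [||w] := @integral_quotient q (size q).-1 r 1 _ mq _ qz.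
- by rewrite prednK // size_poly_gt0 monic_neq0.
- by rewrite rmorph1 divrr.
by rewrite expr1n mulrC => ->; exists w.
Qed.

Lemma contraction_local : the_maximal_ideal contraction.
Proof. exact: (overring_local unift integral_unit). Qed.

Lemma contraction_nil s y : s != 0 -> contraction y -> exists h w, y ^+ h = s * w.
Proof.
move=> s0 [v vE]; have [_ _ /(_ (i s))] := unift; rewrite i_eq0 => /(_ s0)[n [u [uu sE]]].
have [q mq qz] := i_integral (v ^+ n / u).
have [||w wE] := @integral_quotient q (size q).-1 s (y ^+ n) _ mq _ qz.
- by rewrite prednK // size_poly_gt0 monic_neq0.
- by rewrite rmorphXn /= vE expr1 exprMn sE -mulrA [u * _]mulrC divrK.
by exists (n * (size q).-1)%N, w; rewrite exprM.
Qed.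

Definition kspan n (e : 'I_n -> R) : set R :=
  [set r | exists c : 'I_n -> k, r = \sum_j kappa (c j) * e j].

(** Finite codimension over the field k of coefficients of R. *)
Definition cofinite (I : set R) := exists n (e : 'I_n -> R),
  forall r, exists x, I x /\ kspan e (r - x).

Lemma cofinite_extend I a : is_ideal I ->
  cofinite [set x | exists y b, I y /\ x = y + a * b] -> cofinite [set x | I (a * x)] ->
  cofinite I.
Proof.
move=> [I0 ID IM] [n [e eP]] [m [f fP]].
exists (n + m)%N, (fun j : 'I_(n + m) => match fintype.split j with inl j => e j | inr j => a * f j end) => r.
have [_ [[y [b [Iy ->]]] [c cE]]] := eP r.
have [x [Ix [d dE]]] := fP b.
exists (y + a * x); split; first exact: ID.
exists (fun j : 'I_(n + m) => match fintype.split j with inl j => c j | inr j => d j end).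
rewrite big_split_ord /=.
transitivity (\sum_j kappa (c j) * e j + \sum_j kappa (d j) * (a * f j)); last first.
  congr (_ + _); apply: eq_bigr => j _; first by rewrite (unsplitK (inl _)).
  by rewrite (unsplitK (inr _)).
rewrite -cE; transitivity (r - (y + a * b) + a * (b - x)); first by ring.
by congr (_ + _); rewrite dE mulr_sumr; apply: eq_bigr => j _; rewrite mulrCA.
Qed.

(** An ideal maximal among those of infinite codimension that contain s is
    prime. It contains every element with a power in sR, hence the whole
    maximal ideal, whose codimension is one. *)
Lemma principal_cofinite s : s != 0 -> contraction s -> cofinite (multiples s).
Proof.
move=> s0 ms; apply: contrapT => nfin.
pose Q (I : set R) := I s /\ ~ cofinite I.
have [|I [idI [Is nI] Imax]] := @noetherian_max R Q noethR.
  exists (multiples s); last by split=> //; exists 1; rewrite mulr1.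
  exact: multiples_ideal.
have [I0 ID IM] := idI.
have bigger J : is_ideal J -> I `<=` J -> ~ (J `<=` I) -> cofinite J.
  move=> idJ IJ nJI; apply: contrapT => nJ; apply: nJI; apply: Imax => //.
  by split=> //; apply: IJ.
have primeI a b : I (a * b) -> I a \/ I b.
  move=> Iab; apply: contrapT => /not_orP[na nb]; apply: nI.
  apply: (cofinite_extend (a := a)) => //; apply: bigger.
  - split; first by exists 0, 0; rewrite mulr0 addr0.
    + move=> _ _ [y [c [Iy ->]]] [z [d [Iz ->]]]; exists (y + z), (c + d).
      by split; [apply: ID | ring].
    + move=> x _ [y [c [Iy ->]]]; exists (x * y), (x * c).
      by split; [apply: IM | ring].
  - by move=> x Ix; exists x, 0; rewrite mulr0 addr0.
  - by move=> H; apply: na; apply: H; exists 0, 1; rewrite add0r mulr1.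
  - split=> [|x y|c x] /=; first by rewrite mulr0.
      by rewrite mulrDr; apply: ID.
    by rewrite mulrCA; apply: IM.
  - by move=> x Ix; apply: IM.
  - by move=> H; apply: nb; apply: H.
have I1 : ~ I 1.
  move=> I1; apply: nI; exists 0%N, (fun=> 0) => r; exists r; split.
    by rewrite -(mulr1 r); apply: IM.
  by exists (fun=> 0); rewrite big_ord0 subrr.
have mI : contraction `<=` I.
  move=> x mx; have [h [w xw]] := contraction_nil s0 mx.
  have : I (x ^+ h) by rewrite xw mulrC; apply: IM.
  by elim: h {xw} => [//|h IH]; rewrite exprS => /primeI[|].
apply: nI; exists 1%N, (fun=> 1) => r; have [c [r' [mr' rE]]] := contraction_split r.
exists r'; split; first exact: mI.
by exists (fun=> c); rewrite big_ord1 mulr1 rE addrK.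
Qed.

Lemma cofinite_pow s n (e : 'I_n -> R) :
  (forall r, exists x, (multiples s) x /\ kspan e (r - x)) ->
  forall N r, exists (c : 'I_N -> 'I_n -> k) y,
    r = \sum_a \sum_j kappa (c a j) * (s ^+ a * e j) + s ^+ N * y.
Proof.
move=> eP; elim=> [|N IH] r.
  by exists (fun _ _ => 0), r; rewrite big_ord0 add0r mul1r.
have [c [y rE]] := IH r; have [_ [[y' ->] [d dE]]] := eP y.
exists (fun a j => if unlift ord_max a is Some a' then c a' j else d j), y'.
rewrite big_ord_recr /= unlift_none rE -addrA; congr (_ + _).
  apply: eq_bigr => a _; rewrite (_ : widen_ord _ a = lift ord_max a) ?liftK //.
  by apply: val_inj; rewrite /= /bump leqNgt ltn_ord.
rewrite (eq_bigr (fun j => s ^+ N * (kappa (d j) * e j))); last by move=> j _; rewrite mulrCA.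
by rewrite -mulr_sumr -dE exprSr; ring.
Qed.

Lemma dependent_mod (S T : finType) (M : set R) (e : S -> R) (r : T -> R) :
  is_ideal M -> (#|S| < #|T|)%N ->
  (forall x, exists (c : S -> k) y, M y /\ x = \sum_j kappa (c j) * e j + y) ->
  exists u : T -> k, (exists x, u x != 0) /\ M (\sum_x kappa (u x) * r x).
Proof.
move=> idM ltST span.
have [c cP] := choice (fun x => span (r x)); have [y yP] := choice cP.
pose C := \matrix_(a < #|T|, b < #|S|) c (enum_val a) (enum_val b).
have : kermx C != 0.
  rewrite -mxrank_eq0 mxrank_ker -lt0n subn_gt0.
  exact: leq_ltn_trans (rank_leq_col C) ltST.
move=> /rowV0Pn[v /sub_kermxP vC v0].
exists (fun x => v 0 (enum_rank x)); split.
  apply: contrapT => H; case/eqP: v0; apply/rowP => a; rewrite mxE.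
  apply/eqP; rewrite -[_ == _]negbK; apply/negP => va.
  by apply: H; exists (enum_val a); rewrite enum_valK.
have -> : \sum_x kappa (v 0 (enum_rank x)) * r x = \sum_x kappa (v 0 (enum_rank x)) * y x.
  apply/eqP; rewrite -subr_eq0 -sumrB; apply/eqP.
  transitivity (\sum_j kappa (\sum_x v 0 (enum_rank x) * c x j) * e j).
    under [RHS]eq_bigr do rewrite kappa_sum mulr_suml.
    rewrite exchange_big /=; apply: eq_bigr => x _.
    have [_ {1}->] := yP x; rewrite -mulrBr addrK mulr_sumr.
    by apply: eq_bigr => j _; rewrite kappaM mulrA.
  rewrite big1 // => j _.
  have : (v *m C) 0 (enum_rank j) = 0 by rewrite vC mxE.
  rewrite mxE (reindex_onto enum_rank enum_val) /=; last by move=> a _; rewrite enum_valK.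
  rewrite (eq_bigl xpredT) => [|x]; last by rewrite enum_rankK eqxx.
  under eq_bigr do rewrite mxE !enum_rankK.
  by move=> ->; rewrite kappa0 mul0r.
by apply: ideal_sum => // x _; case: idM => _ _; apply; have [] := yP x.
Qed.

Definition ev (f : {poly R}) z : V := (map_poly i f).[z].
Lemma evD f g z : ev (f + g) z = ev f z + ev g z. Proof. by rewrite /ev rmorphD hornerD. Qed.
Lemma evM f g z : ev (f * g) z = ev f z * ev g z. Proof. by rewrite /ev rmorphM hornerM. Qed.
Lemma evN f z : ev (- f) z = - ev f z. Proof. by rewrite /ev rmorphN hornerN. Qed.
Lemma evC c z : ev c%:P z = i c. Proof. by rewrite /ev map_polyC hornerC. Qed.
Lemma evX z : ev 'X z = z. Proof. by rewrite /ev map_polyX hornerX. Qed.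
Lemma evXn n z : ev 'X^n z = z ^+ n. Proof. by rewrite /ev map_polyXn hornerXn. Qed.
Lemma ev_sum (I : Type) (r : seq I) (P : pred I) (f : I -> {poly R}) z :
  ev (\sum_(j <- r | P j) f j) z = \sum_(j <- r | P j) ev (f j) z.
Proof. by rewrite /ev rmorph_sum horner_sum. Qed.

(** Division by the relation z^d = h(z) + s f'(z), where s is carried along as
    a remainder. *)
Lemma ev_small (z : V) (s : R) d (h f' : {poly R}) : (0 < d)%N -> (size h <= d)%N -> z ^+ d = ev h z + i s * ev f' z ->
  forall f, exists a f1 : {poly R}, (size a <= d)%N /\ ev f z = ev a z + i s * ev f1 z.
Proof.
move=> d0 szh zd f; elim/poly_ind: f => [|f c [a [f1 [sza fE]]]].
  by exists 0, 0; rewrite size_poly0 /ev rmorph0 horner0 mulr0 addr0.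
pose al := a`_d.-1.
exists (a * 'X - al *: 'X^d + al *: h + c%:P), (al *: f' + f1 * 'X); split; last first.
  rewrite -!mul_polyC !(evD, evN, evM, evC, evX, evXn) fE zd; ring.
apply/leq_sizeP => j; rewrite leq_eqVlt => /orP[/eqP<-|ltdj].
  rewrite !(coefD, coefN, coefZ, coefMX, coefC, coefXn) eqxx mulr1 gtn_eqF //.
  by rewrite /al subrr (nth_default _ szh) mulr0 !addr0.
rewrite !(coefD, coefN, coefZ, coefMX, coefC, coefXn) !gtn_eqF //; last exact: leq_ltn_trans ltdj.
rewrite (nth_default _ (leq_trans szh (ltnW ltdj))) !mulr0 nth_default ?subr0 ?addr0 //.
by apply: leq_trans sza _; rewrite -ltnS (leq_trans ltdj) // leqSpred.
Qed.

(** The dimension l of R / sR works for all z, because R[z] / s R[z] has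
    dimension at most l as well: R is contained in R[z] and s^B R[z] in R, so
    that the dimensions of R[z] / s^N R[z] and of R / s^N R differ by a
    bounded amount. Thus some power of z with exponent at most l depends on
    lower ones modulo s and, by successive approximation, up to an element of
    s^B R[z], which lies in R. *)
Lemma uniform_integral s : s != 0 -> contraction s ->
  exists l, forall z, exists q : {poly R}, [/\ q \is monic, size q = l.+1 & ev q z = 0].
Proof.
move=> s0 ms; have [l [e eP]] := principal_cofinite s0 ms; exists l => z.
have is0 : i s != 0 by rewrite i_eq0.
have [q0 mq0 q0z] := i_integral z.
(* a common denominator of the powers of z *)
have [b [b0 bP]] : exists b, b != 0 /\ forall f, exists r, i b * ev f z = i r.
  pose n := (size q0).-1.
  have zred f : exists a : {poly R}, (size a <= n.+1)%N /\ ev f z = ev a z.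
    have szn : size q0 = n.+1 by rewrite prednK // size_poly_gt0 monic_neq0.
    have lead : q0`_n = 1 by have /monicP := mq0; rewrite lead_coefE szn.
    have [||a [f1 [sza ->]]] := @ev_small z 0 n.+1 ('X^(n.+1) - q0 * 'X) 0 (ltn0Sn n) _ _ f.
    - apply/leq_sizeP => j; rewrite leq_eqVlt => /orP[/eqP<-|ltj].
        by rewrite coefB coefXn eqxx coefMX /= lead subrr.
      rewrite coefB coefXn gtn_eqF // coefMX; case: j ltj => //= j ltj.
      by rewrite nth_default ?subr0 // szn.
    - by rewrite evD evN evXn evM evX /ev q0z mul0r subr0 (rmorph0 i) mul0r addr0.
    by exists a; rewrite rmorph0 mul0r addr0.
  have [b [b0 bj]] : exists b, b != 0 /\ forall j, (j < n.+1)%N -> exists r, i b * z ^+ j = i r.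
    elim: n.+1 => [|m [b [b0 bm]]]; first by exists 1; rewrite oner_eq0.
    have [a [c [c0 cE]]] := i_frac (z ^+ m); exists (b * c); rewrite mulf_neq0 //.
    split=> // j; rewrite ltnS leq_eqVlt => /orP[/eqP ->|/bm[r rE]].
      by exists (b * a); rewrite !rmorphM -cE mulrA.
    by exists (c * r); rewrite !rmorphM -rE; ring.
  exists b; split=> // f; have [a [sza ->]] := zred f.
  have bj' j : exists r, (j < n.+1)%N -> i b * z ^+ j = i r.
    by case: (ltnP j n.+1) => [/bj[r rE]|_]; [exists r | exists 0].
  have [r rE] := choice bj'.
  exists (\sum_(j < n.+1) a`_j * r j); rewrite /ev (horner_coef_wide _ (leq_trans (size_poly _ _) sza)).
  rewrite mulr_sumr rmorph_sum; apply: eq_bigr => j _.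
  by rewrite coef_map /= mulrCA rE // rmorphM.
have [B [b' sB]] := contraction_nil b0 ms.
have SB f : exists r, i s ^+ B * ev f z = i r.
  have [r rE] := bP f; exists (b' * r).
  by rewrite -rmorphXn sB !rmorphM -rE; ring.
(* l + 1 powers of z are dependent modulo s *)
have [c [[j0 cj0] [f cE]]] : exists c : 'I_l.+1 -> k, (exists j, c j != 0) /\
    exists f, \sum_(j < l.+1) i (kappa (c j)) * z ^+ j = i s * ev f z.
  apply: contrapT => indep.
  pose N := (B * l).+1.
  have [r rE] := choice (fun j => SB 'X^j).
  have idM := multiples_ideal (s ^+ (N + B)).
  have [||u [[[a0 j0] u0] [y yE]]] := @dependent_mod ('I_(N + B) * 'I_l)%type ('I_N * 'I_l.+1)%type
    _ (fun q => s ^+ q.1 * e q.2) (fun q => s ^+ q.1 * r q.2) idM.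
  - by rewrite !card_prod !card_ord /N; nia.
  - move=> x; have [c [y xE]] := cofinite_pow eP (N + B) x.
    exists (fun q => c q.1 q.2), (s ^+ (N + B) * y); split; first by exists y.
    by rewrite xE pair_big.
  pose P (a : 'I_N) := \sum_(j < l.+1) i (kappa (u (a, j))) * z ^+ j.
  have PE : \sum_(a < N) i s ^+ a * P a = i s ^+ N * ev y%:P z.
    apply: (mulfI (expf_neq0 B is0)); rewrite mulrA -exprD [(B + N)%N]addnC evC.
    have -> : i s ^+ (N + B) * i y = i (s ^+ (N + B) * y) by rewrite rmorphM rmorphXn.
    rewrite -yE rmorph_sum mulr_sumr /=; apply/esym.
    rewrite (eq_bigr (fun q : 'I_N * 'I_l.+1 => i s ^+ B * (i s ^+ q.1 * (i (kappa (u (q.1, q.2))) * z ^+ q.2)))); last first.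
      by move=> [a j] _; rewrite !rmorphM rmorphXn -rE evXn /=; ring.
    rewrite -(pair_bigA _ (fun (a : 'I_N) (j : 'I_l.+1) => i s ^+ B * (i s ^+ a * (i (kappa (u (a, j))) * z ^+ j)))) /=.
    by apply: eq_bigr => a _; rewrite /P !mulr_sumr.
  have key : forall M (w : nat -> 'I_l.+1 -> k) f,
      \sum_(a < M) i s ^+ a * (\sum_(j < l.+1) i (kappa (w a j)) * z ^+ j) = i s ^+ M * ev f z ->
      forall a j, (a < M)%N -> w a j = 0.
    elim=> [//|M IH] w g.
    rewrite big_ord_recl expr0 mul1r => H.
    pose Q a : {poly R} := \sum_(j < l.+1) (kappa (w a j))%:P * 'X^j.
    have QE a : ev (Q a) z = \sum_(j < l.+1) i (kappa (w a j)) * z ^+ j.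
      by rewrite ev_sum; apply: eq_bigr => j _; rewrite evM evC evXn.
    have w0 j : w 0%N j = 0.
      apply: contrapT => /eqP wj; apply: indep; exists (w 0%N); split; first by exists j.
      exists ((s ^+ M)%:P * g - \sum_(a < M) (s ^+ a)%:P * Q a.+1).
      rewrite evD evN evM evC mulrBr mulrA rmorphXn /= -exprS -H ev_sum.
      have -> : i s * \sum_(a < M) ev ((s ^+ a)%:P * Q a.+1) z =
          \sum_(a < M) i s ^+ a.+1 * (\sum_(j < l.+1) i (kappa (w a.+1 j)) * z ^+ j).
        rewrite mulr_sumr; apply: eq_bigr => a _.
        by rewrite evM evC QE rmorphXn /= mulrA -exprS.
      by rewrite addrK.
    have {}H : \sum_(a < M) i s ^+ a * (\sum_(j < l.+1) i (kappa (w a.+1 j)) * z ^+ j) = i s ^+ M * ev g z.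
      have sum0 : \sum_(j < l.+1) i (kappa (w 0%N j)) * z ^+ j = 0.
        by rewrite big1 // => j _; rewrite w0 kappa0 rmorph0 mul0r.
      apply: (mulfI is0); rewrite mulrA -exprS -H sum0 add0r mulr_sumr.
      by apply: eq_bigr => a _; rewrite mulrA -exprS.
    by case=> [|a] j lta; [exact: w0 | apply: (IH (fun a => w a.+1) g)].
  pose w a j := if insub a is Some a' then u (a', j) else 0.
  have wu (a : 'I_N) j : w a j = u (a, j) by rewrite /w valK.
  have : w a0 j0 = 0.
    apply: (key N w y%:P) => //; rewrite -PE; apply: eq_bigr => a _; congr (_ * _).
    by apply: eq_bigr => j _; rewrite wu.
  by rewrite wu => /eqP; rewrite (negbTE u0).
(* the highest power in the relation is integral over the lower ones *)
have [d [cd cmax]] : exists d : 'I_l.+1, c d != 0 /\ forall j : 'I_l.+1, (d < j)%N -> c j = 0.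
  case: (@arg_maxnP _ j0 (fun j => c j != 0) (fun j => val j) cj0) => d cd dmax.
  exists d; split=> // j ltdj; apply/eqP; apply: contraTT ltdj => cj.
  by rewrite -leqNgt; apply: dmax.
pose h : {poly R} := - \sum_(j < l.+1 | (j < d)%N) (kappa (c j / c d))%:P * 'X^j.
have szh : (size h <= d)%N.
  rewrite size_polyN; apply: leq_trans (size_sum _ _ _) _.
  apply/bigmax_leqP => j ltjd; rewrite mul_polyC.
  by apply: leq_trans (size_scale_leq _ _) _; rewrite size_polyXn.
have zd : z ^+ d = ev h z + i s * ev ((kappa (c d)^-1)%:P * f) z.
  have iV : i (kappa (c d)^-1) * i (kappa (c d)) = 1 by rewrite -rmorphM kappaV // rmorph1.
  pose S := \sum_(j < l.+1 | (j < d)%N) i (kappa (c j)) * z ^+ j.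
  have cS : i (kappa (c d)) * z ^+ d + S = i s * ev f z.
    rewrite -cE (bigD1 d) //=; congr (_ + _).
    rewrite [RHS](bigID (fun j : 'I_l.+1 => (j < d)%N)) /= [X in _ = _ + X]big1 ?addr0; last first.
      move=> j /andP[jd]; rewrite -leqNgt leq_eqVlt => /orP[/eqP E|/cmax ->].
        by move: jd; rewrite -val_eqE /= E eqxx.
      by rewrite kappa0 rmorph0 mul0r.
    by apply: eq_bigl => j; rewrite -val_eqE /=; case: (ltngtP j d).
  have hE : ev h z = - (i (kappa (c d)^-1) * S).
    rewrite evN ev_sum mulr_sumr; congr (- _); apply: eq_bigr => j _.
    by rewrite evM evC evXn kappaM rmorphM /=; ring.
  rewrite hE evM evC mulrCA -cS mulrDr mulrA iV mul1r.
  by rewrite addrCA addNr addr0.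
have d0 : (0 < d)%N.
  rewrite lt0n; apply: contraTneq isT => d0.
  have h0 : h = 0 by apply/eqP; rewrite -size_poly_eq0 -leqn0; apply: leq_trans szh _; rewrite d0.
  have : tpow 1 1.
    move: zd; rewrite d0 expr0 h0 /ev rmorph0 horner0 add0r => ->.
    exact: tpowMr.
  by rewrite tpow1_nonunit // unitr1.
have red := ev_small d0 szh zd.
(* descending s-adically, every polynomial in z has degree below d *)
have desc n g : exists a g' : {poly R}, (size a <= d)%N /\ ev g z = ev a z + i s ^+ n * ev g' z.
  elim: n g => [|n IH] g; first by exists 0, g; rewrite size_poly0 /ev rmorph0 horner0 add0r mul1r.
  have [a [g' [sza ->]]] := IH g; have [a' [g'' [sza' ->]]] := red g'.
  exists (a + (s ^+ n)%:P * a'), g''; split.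
    apply: leq_trans (size_polyD _ _) _; rewrite geq_max sza mul_polyC.
    by apply: leq_trans (size_scale_leq _ _) _.
  by rewrite evD evM evC rmorphXn /= exprSr; ring.
have [a [g' [sza aE]]] := desc B 'X^d.
have [r rE] := SB g'.
have szq : (size (a + r%:P)%R <= d)%N.
  apply: leq_trans (size_polyD _ _) _; rewrite geq_max sza /=.
  exact: leq_trans (size_polyC_leq1 _) d0.
have ledl : (d <= l)%N by rewrite -ltnS.
exists (('X^d - (a + r%:P)) * 'X^(l - d)).
have mq : 'X^d - (a + r%:P) \is monic.
  by apply/monicP; rewrite lead_coefDl ?lead_coefXn // size_polyN size_polyXn ltnS.
split.
- by rewrite monicMr ?monicXn.
- rewrite size_Mmonic ?monicXn ?monic_neq0 // size_polyXn size_polyDl ?size_polyXn.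
    by rewrite addnS /= addSn subnKC.
  by rewrite size_polyN ltnS.
- by rewrite evM evD evN evD evC -rE -aE subrr mul0r.
Qed.

Lemma common_denominator n (v : 'I_n -> V) :
  exists b, b != 0 /\ forall j, exists a, i b * v j = i a.
Proof.
have [b bP] : exists b : 'I_n -> R, forall j, b j != 0 /\ exists a, i (b j) * v j = i a.
  have ex j : exists b, b != 0 /\ exists a, i b * v j = i a.
    by have [a [b [b0 E]]] := i_frac (v j); exists b; split=> //; exists a.
  by have [b bP] := choice ex; exists b.
exists (\prod_j b j); split; first by apply/prodf_neq0 => j _; have [] := bP j.
move=> j; have [_ [a aE]] := bP j; exists ((\prod_(l | l != j) b l) * a).
by rewrite (bigD1 j) //= !rmorphM mulrAC aE mulrC.
Qed.

(** The field of coefficients is perfect, so that the coordinates of an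
    element on generators of R modulo s^p are pth powers; the remainder is
    treated in the same way, N times. *)
Lemma frobenius_span s : s != 0 -> contraction s -> exists n (e : 'I_n -> R),
  forall N x, exists (w : 'I_n -> R) y, x = \sum_j e j * w j ^+ p + s ^+ (p * N) * y.
Proof.
move=> s0 ms.
have [||n [e eP]] := @principal_cofinite (s ^+ p); first by rewrite expf_neq0.
  rewrite /overring_max /= rmorphXn /=; apply: (@tpowW _ _ _ (1 * p)).
    by rewrite mul1n.
  exact: tpowX.
exists n, e; elim=> [|N IH] x.
  exists (fun=> 0), x; rewrite muln0 mul1r big1 ?add0r // => j _.
  by rewrite expr0n gtn_eqF // mulr0.
have [w [y xE]] := IH x; have [_ [[y' ->] [c cE]]] := eP y.
have root j : exists c', kappa (c j) = kappa c' ^+ p.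
  have [c' _ c'E] : @pth_powers k p (c j) by rewrite perfect.
  by exists c'; apply: i_inj; rewrite rmorphXn /= !kappaE -rmorphXn /= c'E.
have [c' c'E] := choice root.
exists (fun j => w j + s ^+ N * kappa (c' j)), y'.
rewrite (eq_bigr (fun j => e j * w j ^+ p + s ^+ (p * N) * (kappa (c j) * e j))).
  rewrite big_split /= -mulr_sumr -cE xE -addrA; congr (_ + _).
  by rewrite mulnS addnC exprD; ring.
move=> j _; rewrite (pth_powD charR) // exprMn -exprM [(N * p)%N]mulnC -c'E; ring.
Qed.

(** The map x |-> x^(p^e) is continuous from the topology induced by V to the
    s-adic topology of R. The exponent e is what is lowered to 0. *)
Definition power_dominated s e := forall g, exists M, forall x, tpow M (i x) ->
  exists y, x ^+ (p ^ e) = s ^+ g * y.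

(** If x / s^g lies in V then it is integral over R of degree l, and x^l lies
    in s^g R. *)
Lemma power_dominated_start s : s != 0 -> contraction s -> exists e, power_dominated s e.
Proof.
move=> s0 ms; have [l lP] := uniform_integral s0 ms; exists l => g.
have [_ _ /(_ (i s))] := unift; rewrite i_eq0 => /(_ s0)[n [u [uu sE]]].
exists (n * g)%N => x [z xE].
have [q [mq szq qz]] := lP (z / u ^+ g).
have [|w wE] := @integral_quotient q l (s ^+ g) x (z / u ^+ g) mq szq qz.
  by rewrite xE rmorphXn /= sE exprMn -exprM -mulrA [u ^+ g * _]mulrC divrK // unitrX.
exists (w * x ^+ (p ^ l - l)); rewrite mulrA -wE -exprD subnKC //.
apply/ltnW/ltn_expl; exact/prime_gt1/(pcharf_prime charV).
Qed.

(** The Frobenius descent: x is, up to a fixed denominator b and high powers of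
    s, a combination of the powers t^nu with coefficients that are pth powers of
    elements y_nu of R; uniqueness of such expansions in V makes the y_nu
    small as well. *)
Lemma power_dominated_step s e : s != 0 -> contraction s ->
  power_dominated s e.+1 -> power_dominated s e.
Proof.
move=> s0 ms dom g.
have [n [eps epsP]] := frobenius_span s0 ms.
have [f fE] := choice (fun j => frobenius_basis Vcomplete Vres unift charV coefK perfect (i (eps j))).
have [b [b0 [bt bf]]] : exists b, b != 0 /\ (exists a, i b * t = i a) /\
    forall j nu, exists a, i b * f j nu = i a.
  have [b1 [b10 b1P]] := common_denominator (fun q : 'I_(#|{: 'I_n * 'I_p}|) =>
    f (enum_val q).1 (enum_val q).2).
  have [a [b2 [b20 b2E]]] := i_frac t; exists (b1 * b2); split; first by rewrite mulf_neq0.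
  split; first by exists (b1 * a); rewrite !rmorphM -b2E mulrA.
  move=> j nu; have [a' a'E] := b1P (enum_rank (j, nu)).
  exists (b2 * a'); rewrite rmorphM mulrAC [i (b2 * a')]rmorphM -a'E enum_rankK /=.
  by rewrite mulrC.
have [at_ atE] := bt.
have [a aE] : exists a : 'I_n -> 'I_p -> R, forall j nu, i b * f j nu = i (a j nu).
  have ex (q : 'I_n * 'I_p) : exists c, i b * f q.1 q.2 = i c by apply: bf.
  by have [c cE] := choice ex; exists (fun j nu => c (j, nu)) => j nu; apply: (cE (j, nu)).
pose tau (nu : 'I_p) := b ^+ (p - nu) * at_ ^+ nu.
have tauE nu : i (tau nu) = i b ^+ p * t ^+ nu.
  rewrite rmorphM !rmorphXn /= -atE exprMn mulrA -exprD subnK //.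
  exact/ltnW/ltn_ord.
have epsE j : b ^+ (2 * p) * eps j = \sum_nu tau nu * a j nu ^+ p.
  apply: i_inj; rewrite rmorphM rmorphXn /= fE mulr_sumr rmorph_sum.
  apply: eq_bigr => nu _; rewrite rmorphM tauE rmorphXn /= -aE exprMn.
  by rewrite mul2n -addnn exprD; ring.
have [B [b' bB]] := contraction_nil b0 ms.
pose Q := (p ^ e)%N; pose g' := (g + B * (3 * p * Q))%N.
have Q0 : (0 < Q)%N by rewrite expn_gt0 p_gt0.
have [M MP] := dom g'.
pose N := maxn M g'; exists (p * M)%N => x tx.
have [w [r xE]] := epsP N x.
pose y nu := \sum_j a j nu * w j.
have yE : b ^+ (2 * p) * x = \sum_nu tau nu * y nu ^+ p + s ^+ (p * N) * (b ^+ (2 * p) * r).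
  rewrite {1}xE mulrDr mulr_sumr; congr (_ + _); last by ring.
  under [RHS]eq_bigr do rewrite (pth_pow_sum charR) mulr_sumr.
  rewrite exchange_big /=; apply: eq_bigr => j _.
  rewrite mulrA epsE mulr_suml; apply: eq_bigr => nu _; rewrite exprMn; ring.
have ts : tpow 1 (i s) by [].
have ty nu : tpow M (i (b * y nu)).
  apply: (frobenius_basis_div unift charV (y := fun nu => i (b * y nu))).
  have -> : \sum_(nu < p) t ^+ nu * i (b * y nu) ^+ p =
      i (b ^+ (2 * p) * x - s ^+ (p * N) * (b ^+ (2 * p) * r)).
    rewrite yE addrK rmorph_sum; apply: eq_bigr => nu' _.
    by rewrite [RHS]rmorphM tauE [i (b * _)]rmorphM exprMn [i (_ ^+ p)]rmorphXn /=; ring.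
  rewrite rmorphB; apply: tpowB; rewrite rmorphM; first exact: tpowMl.
  apply: tpowMr; rewrite rmorphXn /=; apply: (@tpowW _ _ _ (1 * (p * N))).
    by rewrite mul1n leq_mul2l leq_maxl orbT.
  exact: tpowX.
have [v vE] := choice (fun nu => MP _ (ty nu)).
have big : b ^+ (3 * p * Q) * x ^+ Q = s ^+ g' *
    (\sum_nu tau nu ^+ Q * v nu + s ^+ (p * N * Q - g') * (b ^+ (3 * p) * r) ^+ Q).
  rewrite exprM -exprMn.
  have -> : b ^+ (3 * p) * x = \sum_nu tau nu * (b * y nu) ^+ p + s ^+ (p * N) * (b ^+ (3 * p) * r).
    have E3 : b ^+ (3 * p) = b ^+ p * b ^+ (2 * p) by rewrite -exprD; congr (_ ^+ _); lia.
    rewrite E3 -mulrA yE mulrDr mulr_sumr; congr (_ + _); last by ring.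
    by apply: eq_bigr => nu _; rewrite exprMn; ring.
  rewrite [RHS]mulrDr [X in _ = _ + X]mulrA -exprD subnKC; last first.
    apply: leq_trans (leq_maxr M g') _; rewrite -/N mulnAC.
    by apply: leq_pmull; rewrite muln_gt0 p_gt0.
  rewrite -[Q in LHS]/(p ^ e)%N.
  have powD (c c' : R) : (c + c') ^+ (p ^ e) = c ^+ (p ^ e) + c' ^+ (p ^ e).
    have := @pth_pow_iter_sum R p charR e bool [:: true; false] (fun q => if q then c else c').
    by rewrite !big_cons !big_nil !addr0.
  rewrite powD (pth_pow_iter_sum charR); congr (_ + _); last first.
    by rewrite exprMn -exprM.
  rewrite mulr_sumr; apply: eq_bigr => nu _.
  by rewrite exprMn -exprM -expnS vE; ring.
set W := (X in s ^+ g' * X) in big.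
exists (b' ^+ (3 * p * Q) * W); apply: (mulfI (expf_neq0 (B * (3 * p * Q)) s0)).
rewrite [in LHS]exprM bB exprMn [_ * b' ^+ _]mulrC -mulrA big mulrA.
rewrite [RHS]mulrA -exprD addnC -/g'; ring.
Qed.

(** This makes the map from the completion of R to V injective. *)
Lemma valuation_topology s : s != 0 -> contraction s ->
  forall g, exists M, forall x, tpow M (i x) -> exists y, x = s ^+ g * y.
Proof.
move=> s0 ms; have [e dom] := power_dominated_start s0 ms.
have : power_dominated s 0 by elim: e dom => // e IH /(power_dominated_step s0 ms).
by move=> dom0 g; have [M MP] := dom0 g; exists M => x /MP.
Qed.

Lemma contraction_nonzero : exists2 s, s != 0 & contraction s.
Proof.
have [a [b [b0 E]]] := i_frac t; exists a.
  by rewrite -i_eq0 -E mulf_neq0 ?i_eq0 // (t_neq0 unift).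
by rewrite /overring_max /= -E; apply: tpowMl; rewrite -[X in tpow 1 X]expr1; apply: tpow_tX.
Qed.

(** A nilpotent of the completion is represented by a sequence whose powers
    tend to zero. The sequence itself then tends to zero in V, where the
    valuation is multiplicative, and hence in R. *)
Theorem analytically_unramified : ~ analytically_ramified R.
Proof.
move=> [m [[maxm mu] [c [c0 [n cn]]]]].
have mE : m = contraction by rewrite -(mu _ contraction_local.1).
move: c c0 cn; rewrite mE => c c0 cn; have {c0} /eqP := c0; apply.
have idp q := ideal_pow_ideal contraction q.
(* powers in the completion are computed on representatives *)
have repX j q : ideal_pow contraction q (adic_rep (c ^+ j) q - adic_rep c q ^+ j).
  elim: j => [|j IH]; first exact: completion_of_rep.
  rewrite !exprS -(subrKA (adic_rep c q * adic_rep (c ^+ j) q)).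
  have [_ D M] := idp q; apply: D; first exact: completion_of_rep.
  by rewrite -mulrBr; apply: M.
have rep0 q : ideal_pow contraction q (adic_rep (0 : adic_completion contraction) q).
  by have := @completion_of_rep R contraction _ (@coherent_cst R contraction 0) q; rewrite subr0.
have pow_tpow q x : ideal_pow contraction q x -> tpow q (i x).
  move/(_ [set x | tpow q (i x)]); apply; split.
    split=> [|y z|a y] /=; rewrite ?rmorph0 ?rmorphD ?rmorphM.
    - exact: tpow0.
    - exact: tpowD.
    - exact: tpowMl.
  move=> _ [f fI ->] /=; rewrite rmorph_prod; elim: q f fI => [|q IH] f fI; first exact: tpowP0.
  by rewrite big_ord_recl; apply: (@tpowM _ _ 1); [exact: fI | apply: IH].
have cn1 : c ^+ n.+1 = 0 by rewrite exprS cn mulr0.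
have small q M : (n.+1 * M <= q)%N -> tpow M (i (adic_rep c q)).
  move=> leq; apply: (tpow_root unift (ltn0Sn n)); apply: tpowW leq _.
  rewrite -rmorphXn; apply: pow_tpow.
  rewrite -[_ ^+ _](subKr (adic_rep (c ^+ n.+1) q)); apply: (idealB (idp q)) => //.
  by rewrite cn1; apply: rep0.
have coh q q' : (q <= q')%N -> ideal_pow contraction q (adic_rep c q' - adic_rep c q).
  move=> /subnK <-; elim: (q' - q)%N => [|d IH]; first by rewrite subrr; have [] := idp q.
  rewrite -(subrKA (adic_rep c (d + q))); have [_ D _] := idp q; apply: D => //.
  have sub r x : ideal_pow contraction (r + q) x -> ideal_pow contraction q x.
    by elim: r => // r IHr /ideal_powS.
  by apply: (sub d); exact: (adic_rep_coherent c (n := d + q)).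
have [s s0 ms] := contraction_nonzero.
apply: completion_eqP => q; apply: (idealB (idp q)); last exact: rep0.
have [M MP] := valuation_topology s0 ms q.
have [y yE] := MP _ (small _ _ (leq_maxr q (n.+1 * M))).
rewrite -[adic_rep c q](subKr (adic_rep c (maxn q (n.+1 * M)))).
apply: (idealB (idp q)); last by apply: coh; apply: leq_maxl.
rewrite yE mulrC; have [_ _ Mu] := idp q; apply: Mu.
apply: sub_ideal_span; exists (fun=> s) => //.
by rewrite prodr_const card_ord.
Qed.

End Unramified.
(** * The inclusion of a domain into its normalization *)

Section NormalizationInclusion.
Variables (R V : idomainType) (g : {rmorphism V -> {fraction R}}).
Hypothesis norm_g : is_normalization g.

Let g_inj : injective g. Proof. by case: norm_g. Qed.

Lemma normalization_inclusion_subproof r : exists v, g v = tofrac r.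
Proof.
have : @normalization R (tofrac r) by exact: integral_id.
by have [_ <-] := norm_g => -[v _ <-]; exists v.
Qed.

Definition normalization_inclusion r : V :=
  sval (cid (normalization_inclusion_subproof r)).
Local Notation i := normalization_inclusion.

Lemma normalization_inclusionE r : g (i r) = tofrac r.
Proof. exact: svalP (cid (normalization_inclusion_subproof r)). Qed.

Lemma normalization_inclusion_zmod : zmod_morphism i.
Proof.
by move=> r s; apply: g_inj; rewrite rmorphB /= !normalization_inclusionE tofracB.
Qed.

Lemma normalization_inclusion_monoid : monoid_morphism i.
Proof.
split=> [|r s]; apply: g_inj; rewrite normalization_inclusionE.
  by rewrite tofrac1 rmorph1.
by rewrite tofracM rmorphM /= !normalization_inclusionE.
Qed.

HB.instance Definition _ := GRing.isZmodMorphism.Build R V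
  normalization_inclusion normalization_inclusion_zmod.
HB.instance Definition _ := GRing.isMonoidMorphism.Build R V
  normalization_inclusion normalization_inclusion_monoid.

Lemma normalization_inclusion_inj : injective i.
Proof.
move=> r s /(congr1 g); rewrite !normalization_inclusionE => /eqP.
by rewrite tofrac_eq => /eqP.
Qed.

Lemma normalization_inclusion_frac v : exists a b, b != 0 /\ i b * v = i a.
Proof.
have [a [b [b0 E]]] := fraction_numden (g v); exists a, b; split=> //.
by apply: g_inj; rewrite rmorphM /= !normalization_inclusionE mulrC.
Qed.

Lemma normalization_inclusion_integral v :
  exists2 q, q \is monic & (map_poly i q).[v] = 0.
Proof.
have : @normalization R (g v) by have [_ <-] := norm_g; exists v.
move=> [q mq /eqP qv]; exists q => //; apply: g_inj.
rewrite -horner_map rmorph0 -[RHS]qv; congr (_.[_]).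
by apply/polyP => j; rewrite !coef_map; exact: normalization_inclusionE.
Qed.

End NormalizationInclusion.

Theorem theorem7p6 (V : idomainType) (k : fieldType)
    (res : {rmorphism V -> k})
    (Vdvr : dvr V) (Vcomplete : complete_local V) (Vres : residue_map res) :
  (forall p : nat, p \in [pchar V] -> perfect_field k ->
     forall coef : {rmorphism k -> V}, cancel coef res ->
     ~ exists (R : idomainType) (g : {rmorphism V -> {fraction R}}),
         [/\ quasilocal R, noetherian R, analytically_ramified R,
             is_normalization g &
             forall c : k, exists r : R, tofrac r = g (coef c)])
  /\
  ((exists p : nat, prime p /\
      exists h : {rmorphism padic_integers p -> V}, bijective h) \/
   ([pchar V] =i pred0 /\ [pchar k] =i pred0) \/
   (exists p : nat, p \in [pchar V] /\ uncountable_degree (@pth_powers k p)) ->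
   (forall d : nat, (1 < d)%N ->
      exists (R : idomainType) (g : {rmorphism V -> {fraction R}}),
        [/\ bad_stable_domain R, noetherian R, embedding_dimension R d &
            is_normalization g]) /\
   (exists (R : idomainType) (g : {rmorphism V -> {fraction R}}),
      [/\ bad_stable_domain R, ~ noetherian R & is_normalization g])).
Proof.
have [t unift] := dvr_uniformizer Vdvr; split.
  move=> p charV perfect coef coefK [R [g [_ noethR ramR norm_g coefR]]].
  pose i : {rmorphism R -> V} :=
    [the {rmorphism R -> V} of normalization_inclusion norm_g].
  have i_coef c : exists r, i r = coef c.
    have [r rE] := coefR c; exists r; apply: (norm_g.1).
    by rewrite normalization_inclusionE.
  have perfect_p := perfect p (rmorph_pchar res charV).
  apply: (analytically_unramified Vcomplete Vres unift charV coefK perfect_p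
    (i := i)) ramR => //.
  - exact: normalization_inclusion_inj.
  - exact: normalization_inclusion_frac.
  - exact: normalization_inclusion_integral.
move=> [[p [p_prime [h h_bij]]]|[[char0V char0k]|[p [charV uncount]]]].
- exact: (padic_bad_domains Vdvr Vcomplete Vres p_prime h_bij).
- exact: (equal_char0_bad_domains Vcomplete Vres unift char0V char0k).
- exact: (char_p_bad_domains Vcomplete Vres unift charV uncount).
Qed.
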